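(* Let $X\subset\mathbb{R}^{2d}$ be relatively separated, $s>2d$, and $T\in\mathcal{B}_{\nu_s\otimes\nu_s}$. Then the g-Gabor system $\mathcal{G}=\mathcal{G}(T,X)=(\alpha_k(T))_{k\in X}$ is intrinsically $\mathcal{J}_s$-localized, i.e. $$\sup_{k,l\in X}\|\alpha_k(T)\alpha_l(T)^*\|_{\mathcal{B}(L^2(\mathbb{R}^d))}\,(1+|k-l|)^s<\infty .$$ In particular, $\mathcal{G}(T,X)$ is a g-Bessel sequence for $L^2(\mathbb{R}^d)$.
   Context: $X\subset\mathbb{R}^{2d}$ is relatively separated if $\sup_{x\in\mathbb{R}^{2d}}|X\cap(x+[0,1]^{2d})|<\infty$. For $z=(x,\xi)\in\mathbb{R}^{2d}$, $\pi(z)f(t)=e^{2\pi i\xi\cdot t}f(t-x)$ on $L^2(\mathbb{R}^d)$, and $\alpha_z(T)=\pi(z)T\pi(z)^*$ for $T\in\mathcal{B}(L^2(\mathbb{R}^d))$. Let $\nu_s(z)=(1+|z|)^s$, $g_0(t)=2^{d/4}e^{-\pi t\cdot t}$ and $V_{g_0}f(z)=\langle f,\pi(z)g_0\rangle$. $M^1_{\nu_s}(\mathbb{R}^d)$ is the Banach space of all $f\in L^2(\mathbb{R}^d)$ with $\|f\|_{M^1_{\nu_s}}=\int_{\mathbb{R}^{2d}}|V_{g_0}f(z)|\nu_s(z)\,dz<\infty$. $\mathcal{B}_{\nu_s\otimes\nu_s}$ is the class of integral operators on $L^2(\mathbb{R}^d)$ with kernel in $M^1_{\nu_s\otimes\nu_s}(\mathbb{R}^{2d})\cong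 M^1_{\nu_s}(\mathbb{R}^d)\hat\otimes M^1_{\nu_s}(\mathbb{R}^d)$ (projective tensor product); equivalently, the operators of the form $T=\sum_{n\in\mathbb{N}}\varphi_n\otimes\psi_n$ with $\varphi_n,\psi_n\in M^1_{\nu_s}(\mathbb{R}^d)$ and $\sum_n\|\varphi_n\|_{M^1_{\nu_s}}\|\psi_n\|_{M^1_{\nu_s}}<\infty$, where $(\varphi\otimes\psi)(h)=\langle h,\psi\rangle\varphi$. The Jaffard algebra $\mathcal{J}_s=\mathcal{J}_s(X)$ consists of the $\mathcal{B}(L^2(\mathbb{R}^d))$-valued matrices $[A_{k,l}]_{k,l\in X}$ with $\sup_{k,l}\|A_{k,l}\|(1+|k-l|)^s<\infty$. A family $(T_k)_{k\in X}$ in $\mathcal{B}(L^2(\mathbb{R}^d))$ is intrinsically $\mathcal{J}_s$-localized if $[T_kT_l^*]_{k,l\in X}\in\mathcal{J}_s$, and it is a g-Bessel sequence if there is $B>0$ with $\sum_{k\in X}\|T_kf\|^2\le B\|f\|^2$ for all $f\in L^2(\mathbb{R}^d)$. *)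

(* Defs.v *)
From HB Require Import structures.
From mathcomp Require Import all_boot all_order all_algebra.
From mathcomp Require Import all_classical all_reals all_analysis.
From mathcomp Require Import complex.
Set Implicit Arguments.
Unset Strict Implicit.
Unset Printing Implicit Defensive.
Import Order.TTheory GRing.Theory Num.Theory.
Import numFieldNormedType.Exports.
Import ComplexField.Normc.
Local Open Scope classical_set_scope.
Local Open Scope ring_scope.

Notation Rvec R n := (n.-tuple (measurableTypeR R)).

Definition consv {R : realType} {n} (p : Rvec R n * measurableTypeR R) :
  Rvec R n.+1 := [tuple of p.2 :: p.1].

Lemma measurable_consv (R : realType) n : measurable_fun setT (@consv R n).
Proof. exact: measurable_cons. Qed.

Section lebesgue_step.
Context {R : realType} {n : nat}.
Variable mu : {sigma_finite_measure set (Rvec R n) -> \bar R}.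
Local Open Scope ereal_scope.

Definition lebesgue_step : set (Rvec R n.+1) -> \bar R :=
  pushforward (mu \x lebesgue_measure) consv.

Let step0 : lebesgue_step set0 = 0.
Proof. by rewrite /lebesgue_step /pushforward preimage_set0 measure0. Qed.

Let step_ge0 A : 0 <= lebesgue_step A.
Proof. by rewrite /lebesgue_step /pushforward measure_ge0. Qed.

Let step_sigma_additive : semi_sigma_additive lebesgue_step.
Proof.
pose m := measure_function_pushforward__canonical__measure_function_Measure
  (mu \x lebesgue_measure) (@measurable_consv R n).
exact: (@measure_semi_sigma_additive _ _ _ m).
Qed.

HB.instance Definition _ := isMeasure.Build _ _ _ lebesgue_step
  step0 step_ge0 step_sigma_additive.

Let step_sigma_finite : sigma_finite setT lebesgue_step.
Proof.
have /sigma_finiteP[F [TF ndF Foo]] := sigma_finiteT mu.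
have /sigma_finiteP[G [TG ndG Goo]] := sigma_finiteT (@lebesgue_measure R).
pose unconsv (v : Rvec R n.+1) : Rvec R n * measurableTypeR R :=
  ([tuple of behead v], thead v).
have munconsv : measurable_fun setT unconsv.
  apply/measurable_fun_pairP; split; first exact: measurable_behead.
  exact: measurable_tnth.
have consK : cancel (@consv R n) unconsv.
  by case=> t x; rewrite /unconsv /consv /thead tnth0 /=; congr (_, _); exact: val_inj.
exists (fun i => unconsv @^-1` (F i `*` G i)).
  rewrite -preimage_bigcup -(@preimage_setT _ _ unconsv); congr preimage.
  rewrite -setXTT TF TG predeqE => -[x y]; split.
    move=> [/= [k _ Fkx] [l _ Gly]]; exists (maxn k l) => //; split.
    - by move: x Fkx; exact/subsetPset/ndF/leq_maxl.
    - by move: y Gly; exact/subsetPset/ndG/leq_maxr.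
  by move=> [k _ []/= ? ?]; split; exists k.
move=> k; have [mFk Fkoo] := Foo k; have [mGk Gkoo] := Goo k; split.
  by rewrite -[X in measurable X]setTI; apply: munconsv => //; exact: measurableX.
rewrite /lebesgue_step /pushforward -comp_preimage.
rewrite (_ : unconsv \o consv = id); last by apply/funext => p; exact: consK.
by rewrite preimage_id product_measure1E// lte_mul_pinfty// ge0_fin_numE.
Qed.

HB.instance Definition _ := Measure_isSigmaFinite.Build _ _ _ lebesgue_step
  step_sigma_finite.

End lebesgue_step.

Fixpoint lebesgue_vec (R : realType) (n : nat) :
    {sigma_finite_measure set (Rvec R n) -> \bar R} :=
  match n with
  | 0 => \d_([tuple] : Rvec R 0)
  | m.+1 => lebesgue_step (lebesgue_vec R m)
  end.

(* Phase space R^{2d}: pairs z = (x, xi). *)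
Notation phase R d := (Rvec R d * Rvec R d)%type.
Notation cfun R d := (Rvec R d -> R[i]).

Section phase_space.
Context {R : realType} {d : nat}.
Implicit Types (x y : Rvec R d) (z w : phase R d) (X : set (phase R d)).

Definition dotv x y : R := \sum_(i < d) tnth x i * tnth y i.
Definition subv x y : Rvec R d := [tuple tnth x i - tnth y i | i < d].

Definition subp z w : phase R d := (subv z.1 w.1, subv z.2 w.2).
Definition normp z : R := Num.sqrt (dotv z.1 z.1 + dotv z.2 z.2).

(* z + [0,1]^{2d} *)
Definition unit_cube z : set (phase R d) :=
  [set w | forall i : 'I_d, 0 <= tnth (subp w z).1 i <= 1 /\
                            0 <= tnth (subp w z).2 i <= 1].

Definition relatively_separated X : Prop :=
  exists N : nat, forall z, (X `&` unit_cube z #<= `I_N)%card.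

Definition nu (s : R) z : R := (1 + normp z) `^ s.

Definition lebesgue_phase : {measure set (phase R d) -> \bar R} :=
  (lebesgue_vec R d \x lebesgue_vec R d)%E.

End phase_space.

(* Elements of L^2(R^d) are represented by Borel square-integrable functions;
   every notion below is invariant under almost-everywhere equality. *)
Section L2.
Context {R : realType} {d : nat}.
Local Notation mu := (lebesgue_vec R d).
Implicit Types f g : cfun R d.

Definition L2norm f : \bar R := 'N[mu]_2%:E[(fun t => (normc (f t))%:E)]%E.

Definition L2 f : Prop :=
  [/\ measurable_fun setT (fun t => complex.Re (f t) : measurableTypeR R),
      measurable_fun setT (fun t => complex.Im (f t) : measurableTypeR R) &
      (L2norm f < +oo)%E].

Definition inner f g : R[i] :=
  Complex (\int[mu]_t complex.Re (f t * conjc (g t)))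
          (\int[mu]_t complex.Im (f t * conjc (g t))).

Definition opnorm (T : cfun R d -> cfun R d) : \bar R :=
  ereal_sup [set L2norm (T f) | f in [set f | L2 f /\ (L2norm f <= 1)%E]].

(* The elements of B(L^2(R^d)).  Linearity and boundedness force T to map
   a.e.-equal functions to a.e.-equal functions. *)
Definition bounded_op (T : cfun R d -> cfun R d) : Prop :=
  [/\ forall f, L2 f -> L2 (T f),
      forall (a : R[i]) f g, L2 f -> L2 g ->
        {ae mu, forall t, T (fun u => a * f u + g u) t = a * T f t + T g t} &
      (opnorm T < +oo)%E].

Definition is_adjoint (T S : cfun R d -> cfun R d) : Prop :=
  bounded_op S /\ forall f g, L2 f -> L2 g -> inner (T f) g = inner f (S g).

(* The adjoint exists and is unique up to a.e. equality for every T in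
   B(L^2(R^d)); the default value 0 is not used. *)
Definition adjoint (T : cfun R d -> cfun R d) : cfun R d -> cfun R d :=
  xget (fun _ _ => 0) [set S | is_adjoint T S].

End L2.

Section time_frequency.
Context {R : realType} {d : nat}.
Local Notation op := (cfun R d -> cfun R d).
Implicit Types (z k l : phase R d) (f g h : cfun R d) (T : op) (s : R).

Definition cexpi (a : R) : R[i] := Complex (cos a) (sin a).

Definition tfshift z : op :=
  fun f t => cexpi (2 * pi * dotv z.2 t) * f (subv t z.1).

Definition gauss0 : cfun R d :=
  fun t => (2 `^ (d%:R / 4) * expR (- (pi * dotv t t)))%:C%C.

Definition stft f z : R[i] := inner f (tfshift z gauss0).

Definition M1norm s f : \bar R :=
  (\int[lebesgue_phase]_z (normc (stft f z) * nu s z)%:E)%E.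

Definition M1 s f : Prop := L2 f /\ (M1norm s f < +oo)%E.

Definition rank1 f g : op := fun h t => inner h g * f t.

(* M^1_{nu_s} (x) M^1_{nu_s}, completed projectively: absolutely convergent
   series of rank-one operators, converging in operator norm. *)
Definition Bnu s T : Prop :=
  bounded_op T /\
  exists phi psi : nat -> cfun R d,
  [/\ forall n, M1 s (phi n),
      forall n, M1 s (psi n),
      (\sum_(0 <= n <oo) (M1norm s (phi n) * M1norm s (psi n)) < +oo)%E &
      (fun N => opnorm (fun h t =>
         T h t - \sum_(0 <= n < N) rank1 (phi n) (psi n) h t)) @ \oo --> 0%E].

Definition alpha z T : op := fun f => tfshift z (T (adjoint (tfshift z) f)).

(* Families and matrices indexed by X are total functions of which only the
   values at indices in X matter. *)
Definition g_gabor T : phase R d -> op := fun k => alpha k T.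

Definition Jaffard (X : set (phase R d)) s (A : phase R d -> phase R d -> op)
    : Prop :=
  (forall k l, X k -> X l -> bounded_op (A k l)) /\
  (ereal_sup [set opnorm (A k l) * (nu s (subp k l))%:E | k in X & l in X]
     < +oo)%E.

Definition intrinsically_localized (X : set (phase R d)) s
    (T_ : phase R d -> op) : Prop :=
  (forall k, X k -> bounded_op (T_ k)) /\
  Jaffard X s (fun k l f => T_ k (adjoint (T_ l) f)).

Definition g_Bessel (X : set (phase R d)) (T_ : phase R d -> op) : Prop :=
  (forall k, X k -> bounded_op (T_ k)) /\
  exists2 B : R, 0 < B &
    forall f, L2 f ->
      (\esum_(k in X) (L2norm (T_ k f)) ^+ 2 <= B%:E * (L2norm f) ^+ 2)%E.

End time_frequency.

(* Main.v *)
Require Import Defs.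
From mathcomp Require Import all_boot all_order all_algebra.
From mathcomp Require Import all_classical all_reals all_analysis.
From mathcomp Require Import complex.
From HB Require Import structures.
From mathcomp Require Import ring lra measurable_realfun.
Import numFieldNormedType.Exports.
Import ComplexField.Normc.
Set Implicit Arguments.
Unset Strict Implicit.
Unset Printing Implicit Defensive.
Import Order.TTheory GRing.Theory Num.Theory.
Local Open Scope classical_set_scope.
Local Open Scope ring_scope.

(* Write e_w = pi(w) g_0 and V f(w) = <f, e_w>.  If f is in M^1_{nu_s}, then V f is integrable
   and f = int V f(w) e_w dw almost everywhere.  Since |<e_w, e_z>| = exp(-(pi/2)|w - z|^2) and
   nu_s is submultiplicative, pairing this formula with e_z bounds |V f(z)| nu_s(z) by
   C |f|_{M^1_s}; pairing it with pi(z) g then gives the decisive estimate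
     |<f, pi(z) g>| nu_s(z) <= C |f|_{M^1_s} |g|_{M^1_s}.
   For T = sum_n phi_n (x) psi_n one has
     |alpha_k(T) h| <= sum_n |<h, pi(k) psi_n>| |phi_n|,
   and applying this twice, with |<alpha_l(T)^* f, g>| <= |f| |alpha_l(T) g| in between, bounds
   |alpha_k(T) alpha_l(T)^*| by sum_{n,m} |<pi(k) psi_n, pi(l) psi_m>| |phi_n| |phi_m|, hence by
   a multiple of nu_s(k - l)^-1.
   As s > 2d, the sums over l in X of nu_s(k - l)^-1 are bounded uniformly in k.  By Schur's test
   each (pi(k) psi_n)_{k in X} is a Bessel sequence with bound O(|psi_n|_{M^1_s}^2), and
   Minkowski's inequality in l^2(X) yields the g-Bessel bound. *)

(** * Complex-valued integrals *)

(** Two obstacles shape the argument. The first is the reconstruction formula. A Gaussian cutoff in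
    frequency turns it into integration of f against an explicit kernel. As f has no regularity, the
    cutoff is removed only after integrating over a box: this moves the kernel from f onto the
    indicator of the box, where convergence can be computed. Equality of the integrals over all
    boxes then gives equality almost everywhere. All Gaussian integrals factor over the coordinates,
    so the computations take place on the line, and C becomes explicit: exp(s^2) bounds the product
    of exp(-(pi/2)|z|^2) and nu_s(z). The second is that vectors of L^2 are functions, operators are
    linear only almost everywhere, and the series of T converges only in operator norm. Infinite
    sums of vectors are avoided: every estimate is made for N terms plus a remainder, which is an
    operator norm tending to 0 times a factor fixed in N. Likewise sums over X are bounded over
    finite lists by constants that do not see the list. *)

Section complex_aux.
Context {R : realType}.
Implicit Types x y : R[i].

Lemma ReD x y : complex.Re (x + y) = complex.Re x + complex.Re y.
Proof. by case: x; case: y. Qed.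

Lemma ImD x y : complex.Im (x + y) = complex.Im x + complex.Im y.
Proof. by case: x; case: y. Qed.

Lemma ReN x : complex.Re (- x) = - complex.Re x.
Proof. by case: x. Qed.

Lemma ImN x : complex.Im (- x) = - complex.Im x.
Proof. by case: x. Qed.

Lemma ReM x y :
  complex.Re (x * y) = complex.Re x * complex.Re y - complex.Im x * complex.Im y.
Proof. by case: x; case: y. Qed.

Lemma ImM x y :
  complex.Im (x * y) = complex.Re x * complex.Im y + complex.Im x * complex.Re y.
Proof. by case: x; case: y => a b c e /=. Qed.

Lemma Re_conjc x : complex.Re (conjc x) = complex.Re x.
Proof. by case: x. Qed.

Lemma Im_conjc x : complex.Im (conjc x) = - complex.Im x.
Proof. by case: x. Qed.

Lemma complex_ext x y :
  complex.Re x = complex.Re y -> complex.Im x = complex.Im y -> x = y.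
Proof. by case: x; case: y => a b c e /= -> ->. Qed.

Lemma sqr_normcE x : normc x ^+ 2 = complex.Re x ^+ 2 + complex.Im x ^+ 2.
Proof. by case: x => a b; rewrite /normc sqr_sqrtr// addr_ge0// sqr_ge0. Qed.

Lemma normc_ge0 x : 0 <= normc x.
Proof. by case: x => a b; rewrite sqrtr_ge0. Qed.

Lemma normc_conj x : normc (conjc x) = normc x.
Proof. by case: x => a b; rewrite /normc /= sqrrN. Qed.

Lemma normcB x y : normc (x - y) = normc (y - x).
Proof. by rewrite -normcN opprB. Qed.

Lemma le_Re_normc x : `|complex.Re x| <= normc x.
Proof.
rewrite -(@ler_pXn2r _ 2)// ?nnegrE ?normc_ge0//.
by rewrite sqr_normcE real_normK ?num_real// lerDl sqr_ge0.
Qed.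

Lemma le_Im_normc x : `|complex.Im x| <= normc x.
Proof.
rewrite -(@ler_pXn2r _ 2)// ?nnegrE ?normc_ge0//.
by rewrite sqr_normcE real_normK ?num_real// lerDr sqr_ge0.
Qed.

Lemma normc_le_ReIm x : normc x <= `|complex.Re x| + `|complex.Im x|.
Proof.
rewrite -(@ler_pXn2r _ 2)// ?nnegrE ?normc_ge0// ?addr_ge0//.
rewrite sqr_normcE sqrrD !real_normK ?num_real//.
by rewrite lerD2r lerDl mulrn_wge0// mulr_ge0.
Qed.

Lemma mulc_conj x : x * conjc x = (normc x ^+ 2)%:C%C.
Proof.
by apply: complex_ext; rewrite ?ReM ?ImM sqr_normcE; case: x => a b /=; ring.
Qed.

Lemma normc_real (a : R) : normc a%:C%C = `|a|.
Proof. by rewrite /normc /= expr0n addr0 sqrtr_sqr. Qed.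

Lemma conjcM x y : conjc (x * y) = conjc x * conjc y.
Proof. by apply: complex_ext; case: x; case: y => a b c e /=; ring. Qed.

Lemma conjcD x y : conjc (x + y) = conjc x + conjc y.
Proof. by apply: complex_ext; case: x; case: y => a b c e /=; ring. Qed.

Lemma normc_sum (I : Type) (r : seq I) (P : pred I) (F : I -> R[i]) :
  normc (\sum_(i <- r | P i) F i) <= \sum_(i <- r | P i) normc (F i).
Proof.
elim/big_ind2: _ => //; first by rewrite normc0.
by move=> a b c e ab ce; rewrite (le_trans (le_normcD _ _))// lerD.
Qed.

Lemma normc_prod (I : Type) (r : seq I) (P : pred I) (F : I -> R[i]) :
  normc (\prod_(i <- r | P i) F i) = \prod_(i <- r | P i) normc (F i).
Proof.
elim/big_ind2: _ => //; first by rewrite normc1.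
by move=> a b c e <- <-; rewrite normcM.
Qed.

End complex_aux.

Section complex_measurable.
Context {R : realType} d (T : measurableType d).
Implicit Types f g : T -> R[i].

Definition cmeas f :=
  measurable_fun setT (fun t => complex.Re (f t) : measurableTypeR R) /\
  measurable_fun setT (fun t => complex.Im (f t) : measurableTypeR R).

Lemma cmeas_cst c : cmeas (fun=> c).
Proof. by split; exact: measurable_cst. Qed.

Lemma cmeasD f g : cmeas f -> cmeas g -> cmeas (fun t => f t + g t).
Proof.
move=> [fr fi] [gr gi]; split.
- by under eq_fun do rewrite ReD; exact: measurable_funD.
- by under eq_fun do rewrite ImD; exact: measurable_funD.
Qed.

Lemma cmeasN f : cmeas f -> cmeas (fun t => - f t).
Proof.
move=> [fr fi]; split.
- by under eq_fun do rewrite ReN; exact: measurableT_comp.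
- by under eq_fun do rewrite ImN; exact: measurableT_comp.
Qed.

Lemma cmeasB f g : cmeas f -> cmeas g -> cmeas (fun t => f t - g t).
Proof. by move=> mf mg; apply: cmeasD => //; exact: cmeasN. Qed.

Lemma cmeasM f g : cmeas f -> cmeas g -> cmeas (fun t => f t * g t).
Proof.
move=> [fr fi] [gr gi]; split.
- by under eq_fun do rewrite ReM; apply: measurable_funB; exact: measurable_funM.
- by under eq_fun do rewrite ImM; apply: measurable_funD; exact: measurable_funM.
Qed.

Lemma cmeas_conj f : cmeas f -> cmeas (fun t => conjc (f t)).
Proof.
move=> [fr fi]; split.
- by under eq_fun do rewrite Re_conjc.
- by under eq_fun do rewrite Im_conjc; exact: measurableT_comp.
Qed.

Lemma cmeas_real (f : T -> R) :
  measurable_fun setT (f : T -> measurableTypeR R) -> cmeas (fun t => (f t)%:C%C).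
Proof. by move=> mf; split => //=; exact: measurable_cst. Qed.

Lemma cmeas_prod (I : Type) (r : seq I) (P : pred I) (F : I -> T -> R[i]) :
  (forall i, cmeas (F i)) -> cmeas (fun t => \prod_(i <- r | P i) F i t).
Proof.
move=> mF; elim: r => [|i r IH].
  by under eq_fun do rewrite big_nil; exact: cmeas_cst.
under eq_fun do rewrite big_cons.
by case: (P i) => //; exact: cmeasM.
Qed.

Lemma cmeas_normc f : cmeas f ->
  measurable_fun setT (fun t => normc (f t) : measurableTypeR R).
Proof.
move=> [fr fi].
rewrite (_ : (fun t => _) =
  (fun t => Num.sqrt (complex.Re (f t) ^+ 2 + complex.Im (f t) ^+ 2))); last first.
  by apply/funext => t; rewrite -sqr_normcE sqrtr_sqr ger0_norm ?normc_ge0.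
apply: (@measurableT_comp _ _ _ _ _ _ (@Num.sqrt R)).
  by apply: continuous_measurable_fun; exact: sqrt_continuous.
by apply: measurable_funD; exact: measurable_funX.
Qed.

End complex_measurable.

Lemma cmeas_comp {R : realType} d1 d2 (T1 : measurableType d1) (T2 : measurableType d2)
    (f : T2 -> R[i]) (h : T1 -> T2) :
  cmeas f -> measurable_fun setT h -> cmeas (fun t => f (h t)).
Proof.
by move=> [fr fi] mh; split; [exact: measurableT_comp fr mh|exact: measurableT_comp fi mh].
Qed.

Section complex_integral.
Context {R : realType} d (T : measurableType d) (mu : {measure set T -> \bar R}).
Implicit Types f g : T -> R[i].

Definition cinteg f :=
  mu.-integrable setT (fun t => (complex.Re (f t))%:E) /\
  mu.-integrable setT (fun t => (complex.Im (f t))%:E).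

(** Built from real and imaginary parts exactly as [inner] is, so that an inner product is a [cint]
    by conversion. *)
Definition cint f : R[i] :=
  Complex (\int[mu]_t complex.Re (f t)) (\int[mu]_t complex.Im (f t)).

Lemma cinteg_cmeas f : cinteg f -> cmeas f.
Proof.
by move=> [/measurable_int/measurable_EFinP fr /measurable_int/measurable_EFinP fi].
Qed.

Lemma emeas_normc f : cmeas f -> measurable_fun setT (fun t => (normc (f t))%:E).
Proof. by move=> mf; apply/measurable_EFinP; exact: cmeas_normc. Qed.

Lemma cinteg_normc f : cinteg f ->
  mu.-integrable setT (fun t => (normc (f t))%:E).
Proof.
move=> fi; have mf := cinteg_cmeas fi; case: fi => fr fi.
apply: (@le_integrable _ _ _ _ setT measurableT _
  (fun t => (`|complex.Re (f t)|%:E + `|complex.Im (f t)|%:E)%E)).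
- exact: emeas_normc.
- move=> t _ /=; rewrite lee_fin ger0_norm ?normc_ge0//.
  by rewrite (le_trans (normc_le_ReIm _))// ler_norm.
- by apply: integrableD => //; exact: (integrable_norm (f := fun t => _)).
Qed.

Lemma cintegP f : cmeas f -> (\int[mu]_t (normc (f t))%:E < +oo)%E -> cinteg f.
Proof.
move=> mf foo.
have inf : mu.-integrable setT (fun t => (normc (f t))%:E).
  apply/integrableP; split; first exact: emeas_normc.
  by under eq_integral do rewrite /= ger0_norm ?normc_ge0//.
split; apply: (le_integrable measurableT _ _ inf).
- by apply/measurable_EFinP; case: mf.
- by move=> t _ /=; rewrite lee_fin [leRHS]ger0_norm ?normc_ge0// le_Re_normc.
- by apply/measurable_EFinP; case: mf.
- by move=> t _ /=; rewrite lee_fin [leRHS]ger0_norm ?normc_ge0// le_Im_normc.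
Qed.

Lemma cinteg_lty f : cinteg f -> (\int[mu]_t (normc (f t))%:E < +oo)%E.
Proof.
move=> /cinteg_normc /integrableP[_].
by under eq_integral do rewrite /= ger0_norm ?normc_ge0//.
Qed.

Lemma cinteg_le f (g : T -> R) : cmeas f ->
  mu.-integrable setT (fun t => (g t)%:E) ->
  (forall t, normc (f t) <= g t) -> cinteg f.
Proof.
move=> mf ig fg; apply: cintegP => //.
have /integrableP[mg goo] := ig.
apply: le_lt_trans goo; apply: ge0_le_integral => //.
- by move=> t _; rewrite lee_fin normc_ge0.
- exact: emeas_normc.
- exact: measurableT_comp.
- by move=> t _ /=; rewrite lee_fin (le_trans (fg t))// ler_norm.
Qed.

Lemma cintegD f g : cinteg f -> cinteg g -> cinteg (fun t => f t + g t).
Proof.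
move=> [fr fi] [gr gi]; split.
- by under eq_fun do rewrite ReD EFinD; exact: integrableD.
- by under eq_fun do rewrite ImD EFinD; exact: integrableD.
Qed.

Lemma cintD f g : cinteg f -> cinteg g ->
  cint (fun t => f t + g t) = cint f + cint g.
Proof.
move=> [fr fi] [gr gi]; apply: complex_ext; rewrite ?ReD ?ImD /=.
- by rewrite -RintegralD//; congr fine; apply: eq_integral => t _; rewrite ReD.
- by rewrite -RintegralD//; congr fine; apply: eq_integral => t _; rewrite ImD.
Qed.

Lemma cintegZ c f : cinteg f -> cinteg (fun t => c * f t).
Proof.
move=> fi; apply: cintegP; first by apply: cmeasM; [exact: cmeas_cst|exact: cinteg_cmeas].
under eq_integral do rewrite normcM EFinM.
rewrite ge0_integralZl//.
- by rewrite lte_mul_pinfty// ?lee_fin ?normc_ge0//; exact: cinteg_lty.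
- exact/emeas_normc/cinteg_cmeas.
- by move=> t _; rewrite lee_fin normc_ge0.
- by rewrite lee_fin normc_ge0.
Qed.

Lemma cintZ c f : cinteg f -> cint (fun t => c * f t) = c * cint f.
Proof.
move=> [fr fi]; apply: complex_ext; rewrite ?ReM ?ImM /=.
- rewrite -!RintegralZl// -RintegralB//.
  + by congr fine; apply: eq_integral => t _; rewrite ReM.
  + exact: (integrableZl measurableT _ fr).
  + exact: (integrableZl measurableT _ fi).
- rewrite -!RintegralZl// -RintegralD//.
  + by congr fine; apply: eq_integral => t _; rewrite ImM.
  + exact: (integrableZl measurableT _ fi).
  + exact: (integrableZl measurableT _ fr).
Qed.

Lemma cintegN f : cinteg f -> cinteg (fun t => - f t).
Proof.
by move=> fi; under eq_fun do rewrite -mulN1r; exact: cintegZ.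
Qed.

Lemma cintN f : cinteg f -> cint (fun t => - f t) = - cint f.
Proof.
move=> fi; rewrite -mulN1r -cintZ//; congr cint; apply/funext => t.
by rewrite mulN1r.
Qed.

Lemma cintegB f g : cinteg f -> cinteg g -> cinteg (fun t => f t - g t).
Proof. by move=> fi gi; apply: cintegD => //; exact: cintegN. Qed.

Lemma cintB f g : cinteg f -> cinteg g ->
  cint (fun t => f t - g t) = cint f - cint g.
Proof. by move=> fi gi; rewrite cintD ?cintN//; exact: cintegN. Qed.

Lemma cint_conj f : cinteg f -> cint (fun t => conjc (f t)) = conjc (cint f).
Proof.
move=> [fr fi]; apply: complex_ext; rewrite ?Re_conjc ?Im_conjc /=.
- by congr fine; apply: eq_integral => t _; rewrite Re_conjc.
- under eq_Rintegral do rewrite Im_conjc -mulN1r.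
  by rewrite RintegralZl// mulN1r.
Qed.

Lemma cint0 : cint (fun=> 0) = 0.
Proof. by rewrite /cint /Rintegral !integral0. Qed.

(** Rotation argument: with c the integral, |c|^2 is the real part of the integral of [conjc c * f],
    which is at most |c| times the integral of |f|; then |c| cancels. *)
Lemma normc_cint f : cinteg f ->
  normc (cint f) <= fine (\int[mu]_t (normc (f t))%:E).
Proof.
move=> fi; set c := cint f; set N := fine _.
have N0 : 0 <= N.
  by apply: fine_ge0; apply: integral_ge0 => t _; rewrite lee_fin normc_ge0.
have [->//|c0] := eqVneq (normc c) 0.
have cpos : 0 < normc c by rewrite lt_neqAle eq_sym c0 normc_ge0.
rewrite -(ler_pM2l cpos) -expr2.
have -> : normc c ^+ 2 = complex.Re (conjc c * c).
  by rewrite mulrC mulc_conj.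
rewrite /c -/c -cintZ// /=.
have ->  : normc c * N = \int[mu]_t (normc c * normc (f t)).
  by rewrite RintegralZl//; exact: cinteg_normc.
have [h1 h2] := cintegZ (conjc c) fi.
apply: le_Rintegral => //.
  exact: (integrableZl measurableT _ (cinteg_normc fi)).
by move=> t _; rewrite -/(cint f) -/c -[normc c]normc_conj -normcM (le_trans (ler_norm _))// le_Re_normc.
Qed.

Lemma eq_cint f g : f =1 g -> cint f = cint g.
Proof. by move=> /funext ->. Qed.

Lemma ae_eq_cint f g : cmeas f -> cmeas g ->
  {ae mu, forall t, f t = g t} -> cint f = cint g.
Proof.
move=> [fr fi] [gr gi] fg; apply: complex_ext => /=; congr fine.
- apply: ae_eq_integral => //; try exact/measurable_EFinP.
  by apply: filterS fg => t -> _.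
- apply: ae_eq_integral => //; try exact/measurable_EFinP.
  by apply: filterS fg => t -> _.
Qed.

(** Real and imaginary parts are dominated by the modulus, so each falls under real dominated
    convergence. Convergence is expressed by the modulus of the difference, which keeps every limit
    in [R]. *)
Lemma cint_dominated_cvg (f_ : nat -> T -> R[i]) (f : T -> R[i]) (g : T -> R) :
  (forall n, cmeas (f_ n)) -> cmeas f ->
  {ae mu, forall t, (fun n => normc (f_ n t - f t)) @ \oo --> (0 : R)} ->
  mu.-integrable setT (fun t => (g t)%:E) ->
  {ae mu, forall t, forall n, normc (f_ n t) <= g t} ->
  cinteg f /\ (fun n => normc (cint (f_ n) - cint f)) @ \oo --> (0 : R).
Proof.
move=> mf_ mf cf ig gf.
have cRe : {ae mu, forall t, setT t ->
    (fun n => (complex.Re (f_ n t))%:E) @ \oo --> (complex.Re (f t))%:E}.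
  apply: filterS cf => t ct _; apply: cvg_EFin; first exact: nearW.
  apply/(@cvgrPdist_le _ R^o) => e e0; move/cvgrPdist_le : ct => /(_ e e0).
  apply: filterS => n; rewrite sub0r normrN ger0_norm ?normc_ge0//.
  by apply: le_trans; rewrite /= -ReN -ReD normcB le_Re_normc.
have cIm : {ae mu, forall t, setT t ->
    (fun n => (complex.Im (f_ n t))%:E) @ \oo --> (complex.Im (f t))%:E}.
  apply: filterS cf => t ct _; apply: cvg_EFin; first exact: nearW.
  apply/(@cvgrPdist_le _ R^o) => e e0; move/cvgrPdist_le : ct => /(_ e e0).
  apply: filterS => n; rewrite sub0r normrN ger0_norm ?normc_ge0//.
  by apply: le_trans; rewrite /= -ImN -ImD normcB le_Im_normc.
have bRe : {ae mu, forall t n, setT t -> (`|(complex.Re (f_ n t))%:E| <= (g t)%:E)%E}.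
  by apply: filterS gf => t ct n _ /=; rewrite lee_fin (le_trans (le_Re_normc _)).
have bIm : {ae mu, forall t n, setT t -> (`|(complex.Im (f_ n t))%:E| <= (g t)%:E)%E}.
  by apply: filterS gf => t ct n _ /=; rewrite lee_fin (le_trans (le_Im_normc _)).
have [] := @dominated_convergence _ _ _ mu setT measurableT
  (fun n t => (complex.Re (f_ n t))%:E) (fun t => (complex.Re (f t))%:E)
  (fun t => (g t)%:E) _ _ cRe ig bRe.
- by move=> n; apply/measurable_EFinP; case: (mf_ n).
- by apply/measurable_EFinP; case: mf.
move=> ir _ lr.
have [] := @dominated_convergence _ _ _ mu setT measurableT
  (fun n t => (complex.Im (f_ n t))%:E) (fun t => (complex.Im (f t))%:E)
  (fun t => (g t)%:E) _ _ cIm ig bIm.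
- by move=> n; apply/measurable_EFinP; case: (mf_ n).
- by apply/measurable_EFinP; case: mf.
move=> ii _ li; split => //.
have {}lr : (fun n => \int[mu]_t complex.Re (f_ n t)) @ \oo --> \int[mu]_t complex.Re (f t).
  by apply: fine_cvg; rewrite fineK//; exact: integrable_fin_num.
have {}li : (fun n => \int[mu]_t complex.Im (f_ n t)) @ \oo --> \int[mu]_t complex.Im (f t).
  by apply: fine_cvg; rewrite fineK//; exact: integrable_fin_num.
apply/cvgrPdist_le => e e0.
have e20 : 0 < e / 2 by rewrite divr_gt0.
move/cvgrPdist_le : lr => /(_ _ e20) lr; move/cvgrPdist_le : li => /(_ _ e20) li.
near=> n; rewrite sub0r normrN ger0_norm ?normc_ge0//.
rewrite normcB (le_trans (normc_le_ReIm _))// ReD ImD ReN ImN (splitr e) lerD//=.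
- by near: n.
- by near: n.
Unshelve. all: by end_near.
Qed.

End complex_integral.

(** * Fubini and Tonelli for complex-valued functions *)

Section complex_fubini.
Context {R : realType} d1 d2 (T1 : measurableType d1) (T2 : measurableType d2).
Variables (m1 : {sigma_finite_measure set T1 -> \bar R})
          (m2 : {sigma_finite_measure set T2 -> \bar R}).
Local Open Scope ereal_scope.
Implicit Types F : T1 * T2 -> R[i].

(** Sections of f may fail to be integrable, so the section integral is written as the difference of
    those of the positive and negative parts, each measurable by Tonelli. *)
Lemma measurable_Rintegral_F (f : T1 * T2 -> R) :
  measurable_fun setT (f : _ -> measurableTypeR R) ->
  measurable_fun setT (fun x => (\int[m2]_y f (x, y))%R : measurableTypeR R).
Proof.
move=> mf; rewrite /Rintegral; apply: (measurableT_comp (fine_measurable measurableT)) => //.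
have mfE : measurable_fun setT (fun z => (f z)%:E) by exact/measurable_EFinP.
rewrite (_ : (fun x => _) = fun x =>
    \int[m2]_y (EFin \o f)^\+ (x, y) - \int[m2]_y (EFin \o f)^\- (x, y)); last first.
  apply/funext => x; rewrite integralE; congr (_ - _);
  by apply: eq_integral => y _; rewrite ?funeposE ?funenegE.
apply: emeasurable_funB.
- apply: (@measurable_fun_fubini_tonelli_F _ _ _ _ _ m2 (EFin \o f)^\+) => //.
  exact: measurable_funepos.
- apply: (@measurable_fun_fubini_tonelli_F _ _ _ _ _ m2 (EFin \o f)^\-) => //.
  exact: measurable_funeneg.
Qed.

Lemma cmeas_cint_section F : cmeas F ->
  cmeas (fun x => cint m2 (fun y => F (x, y))).
Proof.
by move=> [Fr Fi]; split; [exact: (measurable_Rintegral_F Fr)|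
                           exact: (measurable_Rintegral_F Fi)].
Qed.

(** The real section integral agrees with the extended one only where the section is integrable,
    because [fine] replaces infinite values by 0; this happens for almost every x, which is
    enough. *)
Lemma Rintegral_fubini1 (f : T1 * T2 -> R) :
  (m1 \x m2).-integrable setT (fun z => (f z)%:E) ->
  [/\ m1.-integrable setT (fun x => (\int[m2]_y f (x, y))%R%:E) &
  (\int[m1 \x m2]_z f z = \int[m1]_x \int[m2]_y f (x, y))%R].
Proof.
move=> fi; have mf : measurable_fun setT (f : _ -> measurableTypeR R).
  by apply/measurable_EFinP; exact: measurable_int fi.
have ae : {ae m1, forall x, setT x ->
    fubini_F m2 (EFin \o f) x = (\int[m2]_y f (x, y))%R%:E}.
  apply: filterS (ae_integrable1 fi) => x xi _ /=.
  by rewrite /fubini_F /= fineK//; exact: integrable_fin_num.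
have mR := measurable_Rintegral_F mf.
split.
  apply/integrableP; split; first exact/measurable_EFinP.
  have /integrableP[_] := integrable_fubini_F fi.
  apply: le_lt_trans; rewrite le_eqVlt; apply/orP; left; apply/eqP.
  apply: ae_eq_integral => //.
  - by apply: measurableT_comp => //; exact/measurable_EFinP.
  - by apply: measurableT_comp => //; exact: (measurable_int _ (integrable_fubini_F fi)).
  - by apply: filterS ae => x /(_ Logic.I) /= -> _.
rewrite {1}/Rintegral -integral12_prod_meas1//; congr fine.
apply: ae_eq_integral => //.
- exact: (measurable_int _ (integrable_fubini_F fi)).
- exact/measurable_EFinP.
Qed.

Lemma cint_fubini1 F : cinteg (m1 \x m2) F ->
  cint (m1 \x m2) F = cint m1 (fun x => cint m2 (fun y => F (x, y))).
Proof.
move=> [/Rintegral_fubini1[_ Fr] /Rintegral_fubini1[_ Fi]].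
by apply: complex_ext; [exact: Fr|exact: Fi].
Qed.

Lemma cinteg_tonelli F : cmeas F ->
  \int[m1]_x \int[m2]_y (normc (F (x, y)))%:E < +oo -> cinteg (m1 \x m2) F.
Proof.
move=> mF Foo; apply: cintegP => //.
rewrite (fubini_tonelli1 (fun z => (normc (F z))%:E))//.
- exact: emeas_normc.
- by move=> z; rewrite lee_fin normc_ge0.
Qed.

End complex_fubini.

Lemma measurable_swap d1 d2 (T1 : measurableType d1) (T2 : measurableType d2) :
  measurable_fun setT (fun z : T1 * T2 => (z.2, z.1)).
Proof. by apply/measurable_fun_pairP; split; [exact: measurable_snd|exact: measurable_fst]. Qed.

Section complex_fubini_swap.
Context {R : realType} d1 d2 (T1 : measurableType d1) (T2 : measurableType d2).
Variables (m1 : {sigma_finite_measure set T1 -> \bar R})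
          (m2 : {sigma_finite_measure set T2 -> \bar R}).
Local Open Scope ereal_scope.
Implicit Types F : T1 -> T2 -> R[i].

(** Absolute convergence is checked in one order only; Tonelli carries it to the product and to the
    other order. *)
Lemma cint_swap F : cmeas (fun z : T1 * T2 => F z.1 z.2) ->
  \int[m1]_x \int[m2]_y (normc (F x y))%:E < +oo ->
  cint m1 (fun x => cint m2 (F x)) = cint m2 (fun y => cint m1 (F ^~ y)).
Proof.
move=> mF Foo.
have i1 := @cinteg_tonelli _ _ _ _ _ m1 m2 _ mF Foo.
rewrite -(cint_fubini1 i1).
have ms := @measurable_swap _ _ T2 T1.
have mF' : cmeas (fun z : T2 * T1 => F z.2 z.1).
  exact: (cmeas_comp mF ms).
have i2 : cinteg (m2 \x m1) (fun z : T2 * T1 => F z.2 z.1).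
  apply: cinteg_tonelli => //=.
  rewrite -(fubini_tonelli (fun z : T1 * T2 => (normc (F z.1 z.2))%:E))//.
  - exact: emeas_normc.
  - by move=> z; rewrite lee_fin normc_ge0.
rewrite -(cint_fubini1 i2); case: i1 => r1 j1; case: i2 => r2 j2.
apply: complex_ext => /=; rewrite /Rintegral; congr fine.
- by rewrite -integral12_prod_meas1// -integral21_prod_meas1.
- by rewrite -integral12_prod_meas1// -integral21_prod_meas1.
Qed.

Lemma cint_prod (f : T1 -> R[i]) (g : T2 -> R[i]) :
  cinteg m1 f -> cinteg m2 g ->
  cinteg (m1 \x m2) (fun z => f z.1 * g z.2)%R /\
  (cint (m1 \x m2) (fun z => f z.1 * g z.2) = cint m1 f * cint m2 g)%R.
Proof.
move=> fi gi; have mf := cinteg_cmeas fi; have mg := cinteg_cmeas gi.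
have ii : cinteg (m1 \x m2) (fun z => f z.1 * g z.2)%R.
  apply: cinteg_tonelli.
    by apply: cmeasM; [exact: (cmeas_comp mf)|exact: (cmeas_comp mg)].
  under eq_integral => x _.
    under eq_integral do rewrite normcM EFinM /=.
    rewrite (@ge0_integralZl _ _ _ m2 _ measurableT (fun y => (normc (g y))%:E))//; last 3 first.
      exact: emeas_normc.
      by move=> y _; rewrite lee_fin normc_ge0.
      by rewrite lee_fin normc_ge0.
    rewrite muleC; over.
  rewrite ge0_integralZl//; last 3 first.
    exact: emeas_normc.
    by move=> y _; rewrite lee_fin normc_ge0.
    by apply: integral_ge0 => y _; rewrite lee_fin normc_ge0.
  rewrite lte_mul_pinfty//; last exact: cinteg_lty.
    by apply: integral_ge0 => y _; rewrite lee_fin normc_ge0.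
  rewrite ge0_fin_numE; first exact: cinteg_lty.
  by apply: integral_ge0 => y _; rewrite lee_fin normc_ge0.
split => //; rewrite cint_fubini1//=.
transitivity (cint m1 (fun x => cint m2 g * f x)%R).
  by apply: eq_cint => x; rewrite /= cintZ// mulrC.
by rewrite cintZ// mulrC.
Qed.

End complex_fubini_swap.

(** * Change of variables along a measurable map *)

Section complex_pushforward.
Context {R : realType} d1 d2 (T1 : measurableType d1) (T2 : measurableType d2).
Variables (mu : {measure set T1 -> \bar R}) (phi : T1 -> T2).
Hypothesis mphi : measurable_fun setT phi.
Variable nu : {measure set T2 -> \bar R}.
Hypothesis nuE : forall A, measurable A -> nu A = pushforward mu phi A.
Local Open Scope ereal_scope.

(** [nu] is a measure in its own right that agrees with the pushforward on measurable sets. This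
    covers both the step from dimension n to n + 1 and the invariance of Lebesgue measure, where
    [nu] and [mu] coincide. *)
Lemma ge0_integral_image (f : T2 -> \bar R) :
  measurable_fun setT f -> (forall x, 0 <= f x) ->
  \int[nu]_y f y = \int[mu]_x f (phi x).
Proof.
move=> mf f0.
pose m := measure_function_pushforward__canonical__measure_function_Measure mu mphi.
rewrite (@eq_measure_integral _ _ _ setT m nu f); last by move=> A mA _; exact: nuE.
by rewrite (ge0_integral_pushforward mphi mu measurableT mf)// preimage_setT.
Qed.

Lemma cinteg_image (f : T2 -> R[i]) : cmeas f ->
  cinteg nu f <-> cinteg mu (fun x => f (phi x)).
Proof.
move=> mf; have mfp : cmeas (fun x => f (phi x)) by exact: cmeas_comp.
have E : \int[nu]_y (normc (f y))%:E = \int[mu]_x (normc (f (phi x)))%:E.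
  rewrite (ge0_integral_image (f := fun y => (normc (f y))%:E))//.
  - exact: emeas_normc.
  - by move=> x; rewrite lee_fin normc_ge0.
by split=> /cinteg_lty foo; apply: cintegP => //; rewrite ?E// -E.
Qed.

Lemma cint_image (f : T2 -> R[i]) : cmeas f ->
  cint nu f = cint mu (fun x => f (phi x)).
Proof.
move=> [fr fi].
have Rint (g : T2 -> R) : measurable_fun setT (g : T2 -> measurableTypeR R) ->
    (\int[nu]_y g y = \int[mu]_x g (phi x))%R.
  move=> mg; have mgE : measurable_fun setT (fun z => (g z)%:E) by exact/measurable_EFinP.
  rewrite /Rintegral; congr fine.
  rewrite [LHS]integralE [RHS]integralE; congr (_ - _).
  - rewrite (ge0_integral_image (f := (EFin \o g)^\+))//.
      by apply: eq_integral => x _; rewrite !funeposE.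
    exact: measurable_funepos.
  - rewrite (ge0_integral_image (f := (EFin \o g)^\-))//.
      by apply: eq_integral => x _; rewrite !funenegE.
    exact: measurable_funeneg.
by apply: complex_ext => /=; exact: Rint.
Qed.

End complex_pushforward.
(** * The space L^2(R^d) *)

Section L2_theory.
Context {R : realType} {d : nat}.
Local Notation mu := (lebesgue_vec R d).
Implicit Types f g h : cfun R d.

(** The real-valued L^2 norm. It is meaningful under [L2 f], where [L2norm_n2] identifies it with
    [L2norm]; an infinite integral would be sent to 0. *)
Definition n2 f : R := Num.sqrt (\int[mu]_t (normc (f t) ^+ 2)).

Lemma n2_ge0 f : 0 <= n2 f.
Proof. exact: sqrtr_ge0. Qed.

Lemma L2normE f :
  L2norm f = ((\int[mu]_t (normc (f t) ^+ 2)%:E) `^ 2^-1)%E.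
Proof.
rewrite /L2norm unlock; congr (_ `^ _)%E; apply: eq_integral => t _.
by rewrite /= ger0_norm ?normc_ge0// powR_mulrn ?normc_ge0.
Qed.

Lemma integral_sqr_normc_ge0 f : (0 <= \int[mu]_t (normc (f t) ^+ 2)%:E)%E.
Proof. by apply: integral_ge0 => t _; rewrite lee_fin sqr_ge0. Qed.

Lemma L2P f : L2 f <-> cmeas f /\ (\int[mu]_t (normc (f t) ^+ 2)%:E < +oo)%E.
Proof.
split=> [[fr fi]|[[fr fi] foo]].
  rewrite L2normE => foo; split => //.
  by apply: (@lty_poweRy _ _ 2^-1).
split => //; rewrite L2normE.
by rewrite poweR_lty.
Qed.

Lemma L2_cmeas f : L2 f -> cmeas f.
Proof. by case/L2P. Qed.

Lemma emeas_sqr_normc f : cmeas f ->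
  measurable_fun setT (fun t => (normc (f t) ^+ 2)%:E).
Proof. by move=> mf; apply/measurable_EFinP/measurable_funX/cmeas_normc. Qed.

Lemma L2_integrable f : L2 f ->
  mu.-integrable setT (fun t => (normc (f t) ^+ 2)%:E).
Proof.
case/L2P => mf foo; apply/integrableP; split; first exact: emeas_sqr_normc.
by under eq_integral do rewrite /= ger0_norm ?sqr_ge0//.
Qed.

Lemma sqr_n2 f : n2 f ^+ 2 = \int[mu]_t (normc (f t) ^+ 2).
Proof. by rewrite sqr_sqrtr// fine_ge0// integral_sqr_normc_ge0. Qed.

Lemma EFin_sqr_n2 f : L2 f ->
  (n2 f ^+ 2)%:E = (\int[mu]_t (normc (f t) ^+ 2)%:E)%E.
Proof.
by move=> Lf; rewrite sqr_n2 fineK//; exact/integrable_fin_num/L2_integrable.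
Qed.

Lemma L2norm_n2 f : L2 f -> L2norm f = (n2 f)%:E.
Proof.
move=> Lf; rewrite L2normE -EFin_sqr_n2// poweR_EFin; congr EFin.
by rewrite powR12_sqrt ?sqr_ge0// sqrtr_sqr ger0_norm ?n2_ge0.
Qed.

Lemma L2_le f (g : Rvec R d -> R) : cmeas f ->
  mu.-integrable setT (fun t => (g t)%:E) ->
  (forall t, normc (f t) ^+ 2 <= g t) -> L2 f.
Proof.
move=> mf ig fg; apply/L2P; split => //.
have /integrableP[mg goo] := ig.
apply: le_lt_trans goo; apply: ge0_le_integral => //.
- by move=> t _; rewrite lee_fin sqr_ge0.
- exact: emeas_sqr_normc.
- exact: measurableT_comp.
- by move=> t _ /=; rewrite lee_fin (le_trans (fg t))// ler_norm.
Qed.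

Lemma L2D f g : L2 f -> L2 g -> L2 (fun t => f t + g t).
Proof.
move=> Lf Lg.
apply: (@L2_le _ (fun t => 2 * normc (f t) ^+ 2 + 2 * normc (g t) ^+ 2)).
- by apply: cmeasD; exact: L2_cmeas.
- apply: (@integrableD _ _ _ mu _ measurableT (fun t => (2 * normc (f t) ^+ 2)%:E)
    (fun t => (2 * normc (g t) ^+ 2)%:E)).
  + exact: (integrableZl measurableT 2 (L2_integrable Lf)).
  + exact: (integrableZl measurableT 2 (L2_integrable Lg)).
move=> t; have := le_normcD (f t) (g t).
have := normc_ge0 (f t); have := normc_ge0 (g t); have := normc_ge0 (f t + g t).
set a := normc (f t); set b := normc (g t); set c := normc (_ + _).
move=> c0 b0 a0 cab; rewrite (@le_trans _ _ ((a + b) ^+ 2))//.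
  by rewrite ler_pXn2r// nnegrE addr_ge0.
by have := sqr_ge0 (a - b); nra.
Qed.

Lemma L2Z (c : R[i]) f : L2 f -> L2 (fun t => c * f t).
Proof.
move=> Lf.
apply: (@L2_le _ (fun t => normc c ^+ 2 * normc (f t) ^+ 2)).
- by apply: cmeasM; [exact: cmeas_cst|exact: L2_cmeas].
- exact: (integrableZl measurableT _ (L2_integrable Lf)).
- by move=> t; rewrite normcM exprMn.
Qed.

Lemma L2N f : L2 f -> L2 (fun t => - f t).
Proof. by move=> /(L2Z (-1)); under eq_fun do rewrite mulN1r. Qed.

Lemma L2B f g : L2 f -> L2 g -> L2 (fun t => f t - g t).
Proof. by move=> Lf Lg; apply: L2D => //; exact: L2N. Qed.

Lemma L20 : L2 (fun=> 0 : R[i]) (d := d).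
Proof.
apply/L2P; split; first exact: cmeas_cst.
by under eq_integral do rewrite normc0 expr0n; rewrite integral0.
Qed.

Lemma L2_sum (I : Type) (r : seq I) (F : I -> cfun R d) :
  (forall i, L2 (F i)) -> L2 (fun t => \sum_(i <- r) F i t).
Proof.
move=> LF; elim: r => [|i r IH].
  by under eq_fun do rewrite big_nil; exact: L20.
by under eq_fun do rewrite big_cons; exact: L2D.
Qed.

Lemma n2_ae f g : cmeas f -> cmeas g -> {ae mu, forall t, f t = g t} -> n2 f = n2 g.
Proof.
move=> mf mg fg; congr (Num.sqrt (fine _)); apply: ae_eq_integral => //.
- exact: emeas_sqr_normc.
- exact: emeas_sqr_normc.
- by apply: filterS fg => t -> _.
Qed.

Lemma n2_eq0 f : L2 f -> n2 f = 0 -> {ae mu, forall t, f t = 0}.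
Proof.
move=> Lf f0; have := EFin_sqr_n2 Lf; rewrite f0 expr0n /= => /esym i0.
have mf := emeas_sqr_normc (L2_cmeas Lf).
have : ae_eq mu setT (fun t => (normc (f t) ^+ 2)%:E) (cst 0%E).
  apply/(@ae_eq_integral_abs _ _ _ mu _ measurableT _ mf).
  by under eq_integral do rewrite gee0_abs ?lee_fin ?sqr_ge0//.
apply: filterS => t /(_ Logic.I) /= [] /eqP.
by rewrite sqrf_eq0 => /eqP /eq0_normc.
Qed.

Lemma n20 f : {ae mu, forall t, f t = 0} -> cmeas f -> n2 f = 0.
Proof.
move=> f0 mf; have m0 : cmeas (fun _ : Rvec R d => 0 : R[i]) by exact: cmeas_cst.
rewrite (n2_ae mf m0 f0).
by rewrite /n2 /Rintegral; under eq_integral do rewrite normc0 expr0n; rewrite integral0 sqrtr0.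
Qed.

Lemma int_normcM_le f g : L2 f -> L2 g ->
  (\int[mu]_t (normc (f t) * normc (g t))%:E <= (n2 f * n2 g)%:E)%E.
Proof.
move=> Lf Lg.
have mf := cmeas_normc (L2_cmeas Lf); have mg := cmeas_normc (L2_cmeas Lg).
have p2 : (0 < 2 :> R) by [].
have := @hoelder _ _ _ mu _ _ 2 2 mf mg p2 p2.
rewrite Lnorm1 -/(L2norm f) -/(L2norm g) !L2norm_n2//.
have h2 : (2^-1 + 2^-1 = 1 :> R) by rewrite [RHS]splitr !div1r.
move=> /(_ h2); apply: le_trans.
rewrite le_eqVlt; apply/orP; left; apply/eqP; apply: eq_integral => t _ /=.
by rewrite ger0_norm// mulr_ge0// normc_ge0.
Qed.

Lemma cinteg_inner f g : L2 f -> L2 g -> cinteg mu (fun t => f t * conjc (g t)).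
Proof.
move=> Lf Lg; apply: cintegP.
  by apply: cmeasM; [exact: L2_cmeas|exact/cmeas_conj/L2_cmeas].
under eq_integral do rewrite normcM normc_conj.
by apply: le_lt_trans (int_normcM_le Lf Lg) _; exact: ltry.
Qed.

Lemma innerE f g : inner f g = cint mu (fun t => f t * conjc (g t)).
Proof. by []. Qed.

Lemma inner_CS f g : L2 f -> L2 g -> normc (inner f g) <= n2 f * n2 g.
Proof.
move=> Lf Lg; rewrite innerE (le_trans (normc_cint (cinteg_inner Lf Lg)))//.
rewrite -lee_fin fineK.
  under eq_integral do rewrite normcM normc_conj.
  exact: int_normcM_le.
rewrite ge0_fin_numE; first exact: cinteg_lty (cinteg_inner Lf Lg).
by apply: integral_ge0 => t _; rewrite lee_fin normc_ge0.
Qed.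

Lemma inner_conj f g : L2 f -> L2 g -> inner g f = conjc (inner f g).
Proof.
move=> Lf Lg; rewrite !innerE -cint_conj; last exact: cinteg_inner.
by apply: eq_cint => t; rewrite conjcM conjcK mulrC.
Qed.

Lemma innerDl f g h : L2 f -> L2 g -> L2 h ->
  inner (fun t => f t + g t) h = inner f h + inner g h.
Proof.
move=> Lf Lg Lh; rewrite !innerE -cintD; try exact: cinteg_inner.
by apply: eq_cint => t; rewrite mulrDl.
Qed.

Lemma innerZl c f h : L2 f -> L2 h -> inner (fun t => c * f t) h = c * inner f h.
Proof.
move=> Lf Lh; rewrite !innerE -cintZ; last exact: cinteg_inner.
by apply: eq_cint => t; rewrite mulrA.
Qed.

Lemma innerDr f g h : L2 f -> L2 g -> L2 h ->
  inner h (fun t => f t + g t) = inner h f + inner h g.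
Proof.
move=> Lf Lg Lh; rewrite !innerE -cintD; try exact: cinteg_inner.
by apply: eq_cint => t; rewrite conjcD mulrDr.
Qed.

Lemma innerZr c f h : L2 f -> L2 h ->
  inner h (fun t => c * f t) = conjc c * inner h f.
Proof.
move=> Lf Lh; rewrite !innerE -cintZ; last exact: cinteg_inner.
by apply: eq_cint => t; rewrite conjcM mulrCA.
Qed.

Lemma inner_suml (I : Type) (r : seq I) (F : I -> cfun R d) h :
  (forall i, L2 (F i)) -> L2 h ->
  inner (fun t => \sum_(i <- r) F i t) h = \sum_(i <- r) inner (F i) h.
Proof.
move=> LF Lh; elim: r => [|i r IH].
  rewrite big_nil innerE -[RHS](cint0 mu); apply: eq_cint => t.
  by rewrite big_nil mul0r.
rewrite big_cons -IH -innerDl//; last exact: L2_sum.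
by congr inner; apply/funext => t; rewrite big_cons.
Qed.

Lemma inner_sumr (I : Type) (r : seq I) (F : I -> cfun R d) h :
  (forall i, L2 (F i)) -> L2 h ->
  inner h (fun t => \sum_(i <- r) F i t) = \sum_(i <- r) inner h (F i).
Proof.
move=> LF Lh; elim: r => [|i r IH].
  rewrite big_nil innerE -[RHS](cint0 mu); apply: eq_cint => t.
  by rewrite big_nil (_ : conjc 0 = 0) ?mulr0//; apply: complex_ext => //=; rewrite oppr0.
rewrite big_cons -IH -innerDr//; last exact: L2_sum.
by congr inner; apply/funext => t; rewrite big_cons.
Qed.

Lemma inner_ae f f' g : cmeas f -> cmeas f' -> cmeas g ->
  {ae mu, forall t, f t = f' t} -> inner f g = inner f' g.
Proof.
move=> mf mf' mg ff'; rewrite !innerE; apply: ae_eq_cint.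
- by apply: cmeasM => //; exact: cmeas_conj.
- by apply: cmeasM => //; exact: cmeas_conj.
- by apply: filterS ff' => t ->.
Qed.

Lemma inner_self f : inner f f = (n2 f ^+ 2)%:C%C.
Proof.
apply: complex_ext; rewrite /= ?sqr_n2.
- by congr fine; apply: eq_integral => t _; rewrite mulc_conj.
- by rewrite /Rintegral; under eq_integral do rewrite mulc_conj; rewrite integral0.
Qed.

Lemma n2D f g : L2 f -> L2 g -> n2 (fun t => f t + g t) <= n2 f + n2 g.
Proof.
move=> Lf Lg; rewrite -(@ler_pXn2r _ 2)// ?nnegrE ?addr_ge0 ?n2_ge0//.
have Lfg := L2D Lf Lg.
have -> : n2 (fun t => f t + g t) ^+ 2 = n2 f ^+ 2 + n2 g ^+ 2 +
    2 * complex.Re (inner f g).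
  have -> : n2 (fun t => f t + g t) ^+ 2 =
    complex.Re (inner (fun t => f t + g t) (fun t => f t + g t)) by rewrite inner_self.
  have -> : n2 f ^+ 2 = complex.Re (inner f f) by rewrite inner_self.
  have -> : n2 g ^+ 2 = complex.Re (inner g g) by rewrite inner_self.
  by rewrite innerDl// !innerDr// (inner_conj Lf Lg) !ReD Re_conjc; ring.
have := le_Re_normc (inner f g); have := inner_CS Lf Lg.
have := ler_norm (complex.Re (inner f g)).
by move=> h1 h2 h3; rewrite sqrrD; lra.
Qed.

Lemma n2Z c f : L2 f -> n2 (fun t => c * f t) = normc c * n2 f.
Proof.
move=> Lf; rewrite /n2 -[normc c in RHS]ger0_norm ?normc_ge0//.
rewrite -sqrtr_sqr -sqrtrM ?sqr_ge0// -RintegralZl//; last exact: L2_integrable.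
by congr (Num.sqrt (fine _)); apply: eq_integral => t _; rewrite normcM exprMn.
Qed.

Lemma n2N f : L2 f -> n2 (fun t => - f t) = n2 f.
Proof.
move=> Lf; congr (Num.sqrt (fine _)); apply: eq_integral => t _.
by rewrite normcN.
Qed.

Lemma n2B f g : L2 f -> L2 g -> n2 (fun t => f t - g t) <= n2 f + n2 g.
Proof. by move=> Lf Lg; rewrite (le_trans (n2D Lf (L2N Lg)))// n2N. Qed.

Lemma n2_sum (I : Type) (r : seq I) (F : I -> cfun R d) :
  (forall i, L2 (F i)) ->
  n2 (fun t => \sum_(i <- r) F i t) <= \sum_(i <- r) n2 (F i).
Proof.
move=> LF; elim: r => [|i r IH].
  rewrite big_nil n20//; first by apply: aeW => t; rewrite big_nil.
  by under eq_fun do rewrite big_nil; exact: cmeas_cst.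
rewrite big_cons (_ : (fun t => _) = fun t => F i t + \sum_(j <- r) F j t); last first.
  by apply/funext => t; rewrite big_cons.
by rewrite (le_trans (n2D (LF i) (L2_sum _ LF)))// lerD2l.
Qed.

Lemma n2_dist f g : L2 f -> L2 g -> n2 f <= n2 g + n2 (fun t => f t - g t).
Proof.
move=> Lf Lg; rewrite -{1}(_ : (fun t => g t + (f t - g t)) = f).
  by apply: n2D => //; exact: L2B.
by apply/funext => t; rewrite addrC subrK.
Qed.

End L2_theory.
(** * Lebesgue measure on R^n *)

Section lebesgue_line.
Context {R : realType}.
Local Notation leb := (@lebesgue_measure R).

(** Lebesgue measure is determined by its values on half-open intervals, and the preimage of ]b, c]
    is ]b + a, c + a], of the same length. *)
Lemma lebesgue_measure_translation (a : R) A : measurable A ->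
  leb A = pushforward leb (fun x : measurableTypeR R => x - a : measurableTypeR R) A.
Proof.
move=> mA.
have mphi : measurable_fun setT (fun x : measurableTypeR R => x - a : measurableTypeR R).
  by apply: measurable_funB => //; exact: measurable_cst.
pose m := measure_function_pushforward__canonical__measure_function_Measure leb mphi.
apply: (@lebesgue_measure_unique R m) => //= _ [[b c]] _ <- /=.
rewrite /m /= /pushforward.
have -> : (fun x : measurableTypeR R => x - a : measurableTypeR R) @^-1` `]b, c]%classic
    = `](b + a), (c + a)]%classic.
  by apply/seteqP; split=> x /=; rewrite !in_itv /= ltrBrDr lerBlDr.
rewrite !lebesgue_measure_itv /= !lte_fin ltrD2r.
by case: ifPn => // _; rewrite -!EFinB opprD addrACA subrr addr0.
Qed.

Lemma ge0_integral_translation (a : R) (f : R -> \bar R) :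
  measurable_fun setT (f : measurableTypeR R -> _) -> (forall x, 0 <= f x)%E ->
  (\int[leb]_x f (x - a)%R = \int[leb]_x f x)%E.
Proof.
move=> mf f0; symmetry.
apply: (ge0_integral_image (phi := fun x : measurableTypeR R => x - a : measurableTypeR R)) => //.
  by apply: measurable_funB => //; exact: measurable_cst.
by move=> A mA; exact: lebesgue_measure_translation.
Qed.

Lemma cint_opp (f : R -> R[i]) : cmeas (f : measurableTypeR R -> _) ->
  cint leb (fun x => f (- x)) = cint leb f.
Proof.
move=> mf; symmetry.
apply: (cint_image (phi := -%R : measurableTypeR R -> measurableTypeR R)) => //.
by move=> A mA; exact/esym/lebesgue_measureN.
Qed.

Lemma cint_translation (a : R) (f : R -> R[i]) : cmeas (f : measurableTypeR R -> _) ->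
  cint leb (fun x => f (x - a)) = cint leb f.
Proof.
move=> mf; symmetry.
apply: (cint_image (phi := fun x : measurableTypeR R => x - a : measurableTypeR R)) => //.
  by apply: measurable_funB => //; exact: measurable_cst.
by move=> A mA; exact: lebesgue_measure_translation.
Qed.

End lebesgue_line.

Section lebesgue_vec_theory.
Context {R : realType}.
Local Notation leb := (@lebesgue_measure R).
Local Open Scope ereal_scope.

Lemma tnth_consv0 n (p : Rvec R n * measurableTypeR R) : tnth (consv p) ord0 = p.2.
Proof. by rewrite tnth0. Qed.

Lemma tnth_consvS n (p : Rvec R n * measurableTypeR R) j :
  tnth (consv p) (lift ord0 j) = tnth p.1 j.
Proof. by rewrite tnthS. Qed.

Lemma ge0_integral_vec0 (f : Rvec R 0 -> \bar R) :
  \int[lebesgue_vec R 0]_t f t = f [tuple].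
Proof.
rewrite (@integral_dirac _ _ _ _ setT) ?diracT ?mul1e//.
move=> _ A mA; rewrite setTI.
have [fA|fA] := pselect (A (f [tuple])).
  by rewrite (_ : _ @^-1` _ = setT)//; apply/seteqP; split=> // t _ /=; rewrite tuple0.
rewrite (_ : _ @^-1` _ = set0)//; apply/seteqP; split=> // t /=.
by rewrite tuple0 => /fA.
Qed.

Lemma ge0_integral_vecS n (f : Rvec R n.+1 -> \bar R) :
  measurable_fun setT f -> (forall x, 0 <= f x) ->
  \int[lebesgue_vec R n.+1]_t f t =
  \int[lebesgue_vec R n]_t \int[leb]_x f (consv (t, x)).
Proof.
move=> mf f0.
rewrite (ge0_integral_image (mu := (lebesgue_vec R n \x leb)) (measurable_consv (n:=n)))//.
rewrite (fubini_tonelli1 (fun z => f (consv z)))//.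
exact: measurableT_comp mf (measurable_consv (n:=n)).
Qed.

Lemma cint_vecS n (f : Rvec R n.+1 -> R[i]) : cmeas f ->
  (cinteg (lebesgue_vec R n.+1) f <->
     cinteg (lebesgue_vec R n \x leb) (fun z => f (consv z))) /\
  cint (lebesgue_vec R n.+1) f = cint (lebesgue_vec R n \x leb) (fun z => f (consv z)).
Proof.
move=> mf; split.
  exact: (cinteg_image (mu := (lebesgue_vec R n \x leb)) (measurable_consv (n:=n))).
exact: (cint_image (mu := (lebesgue_vec R n \x leb)) (measurable_consv (n:=n))).
Qed.

Lemma measurable_subv n (a : Rvec R n) :
  measurable_fun setT (fun t : Rvec R n => subv t a : Rvec R n).
Proof.
apply/measurable_fun_tnthP => i.
rewrite (_ : _ \o _ = fun t : Rvec R n => (tnth t i - tnth a i)%R); last first.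
  by apply/funext => t /=; rewrite tnth_mktuple.
by apply: measurable_funB; [exact: measurable_tnth|exact: measurable_cst].
Qed.

Lemma subv_consv n (p : Rvec R n * measurableTypeR R) (a : Rvec R n.+1) :
  subv (consv p) a = consv (subv p.1 [tuple of behead a], (p.2 - thead a)%R).
Proof.
apply: eq_from_tnth => i; rewrite tnth_mktuple.
case: (unliftP ord0 i) => [j ->|->].
  rewrite !tnth_consvS /= tnth_mktuple; congr (_ - _)%R.
  by rewrite tnth_behead; congr (tnth a _); apply/val_inj; rewrite /= inordK// ltnS.
by rewrite !tnth_consv0.
Qed.

(** Induction through Tonelli: the inner integral over the first coordinate absorbs its shift, and
    the induction hypothesis, applied to the section integral, absorbs the shift of the remaining
    ones. *)
Lemma ge0_integral_vec_translation n (a : Rvec R n) (f : Rvec R n -> \bar R) :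
  measurable_fun setT f -> (forall x, 0 <= f x) ->
  \int[lebesgue_vec R n]_t f (subv t a) = \int[lebesgue_vec R n]_t f t.
Proof.
elim: n a f => [|n IH] a f mf f0.
  by rewrite !ge0_integral_vec0; congr f; exact: tuple0.
have ms := measurableT_comp mf (measurable_subv a).
rewrite (ge0_integral_vecS mf f0) (@ge0_integral_vecS _ (fun t => f (subv t a)) ms)//.
have mfc : measurable_fun setT (fun z : Rvec R n * measurableTypeR R => f (consv z)).
  exact: measurableT_comp mf (measurable_consv (n:=n)).
under eq_integral => t _.
  under eq_integral do rewrite subv_consv /=.
  rewrite (@ge0_integral_translation _ _ (fun x => f (consv (subv t [tuple of behead a], x))))//; last first.
    exact: (measurableT_comp mfc (pair1_measurable _)).
  over.
rewrite (IH _ (fun t => \int[leb]_x f (consv (t, x))))//.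
- exact: (measurable_fun_fubini_tonelli_F (m2 := leb) (fun z => f (consv z))).
- by move=> t; exact: integral_ge0.
Qed.

Lemma lebesgue_vec_translation n (a : Rvec R n) A : measurable A ->
  lebesgue_vec R n A = pushforward (lebesgue_vec R n) (fun t => subv t a) A.
Proof.
move=> mA.
have mB : measurable ((fun t => subv t a) @^-1` A).
  by rewrite -[X in measurable X]setTI; exact: measurable_subv.
have EA B : measurable B ->
    \int[lebesgue_vec R n]_t (\1_B t)%:E = lebesgue_vec R n B.
  by move=> ?; rewrite integral_indic// setIT.
rewrite /pushforward -!EA// -(@ge0_integral_vec_translation n a (fun t => (\1_A t)%:E))//.
by apply/measurable_EFinP; exact: measurable_indic.
Qed.

Lemma cint_vec_translation n (a : Rvec R n) (f : Rvec R n -> R[i]) : cmeas f ->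
  (cinteg (lebesgue_vec R n) f <-> cinteg (lebesgue_vec R n) (fun t => f (subv t a))) /\
  cint (lebesgue_vec R n) (fun t => f (subv t a)) = cint (lebesgue_vec R n) f.
Proof.
move=> mf; have nuE A : measurable A -> _ := @lebesgue_vec_translation n a A.
split; first exact: (cinteg_image (measurable_subv a) nuE).
by symmetry; exact: (cint_image (measurable_subv a) nuE).
Qed.

(** This is what reduces the Gaussian integrals on R^d to the line. *)
Lemma cint_vec_prod n (F : 'I_n -> R -> R[i]) :
  (forall i, cinteg leb (F i)) ->
  cinteg (lebesgue_vec R n) (fun t => \prod_(i < n) F i (tnth t i))%R /\
  (cint (lebesgue_vec R n) (fun t => \prod_(i < n) F i (tnth t i)) =
   \prod_(i < n) cint leb (F i))%R.
Proof.
elim: n F => [|n IH] F iF.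
  under eq_fun do rewrite big_ord0; rewrite big_ord0; split.
    apply: cintegP; first exact: cmeas_cst.
    by rewrite ge0_integral_vec0 normc1 ltry.
  by apply: complex_ext; rewrite /= /Rintegral ge0_integral_vec0.
have mF : cmeas (fun t : Rvec R n.+1 => \prod_(i < n.+1) F i (tnth t i))%R.
  apply: cmeas_prod => i; apply: cmeas_comp (measurable_tnth i).
  exact: cinteg_cmeas (iF i).
have [IH1 IH2] := IH (fun i => F (lift ord0 i)) (fun i => iF _).
have [p1 p2] := cint_prod IH1 (iF ord0).
have E : (fun z => \prod_(i < n.+1) F i (tnth (consv z) i))%R =
   (fun z : Rvec R n * measurableTypeR R =>
      \prod_(i < n) F (lift ord0 i) (tnth z.1 i) * F ord0 z.2)%R.
  apply/funext => z; rewrite big_ord_recl tnth_consv0 mulrC; congr (_ * _)%R.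
  by apply: eq_bigr => i _; rewrite tnth_consvS.
have [c1 c2] := cint_vecS mF; split; first by apply/c1; rewrite E.
by rewrite c2 E p2 IH2 big_ord_recl mulrC.
Qed.

Lemma Rintegral_vec_prod n (F : 'I_n -> R -> R) :
  (forall i, leb.-integrable setT (fun x => (F i x)%:E)) ->
  (lebesgue_vec R n).-integrable setT (fun t => (\prod_(i < n) F i (tnth t i))%R%:E) /\
  (\int[lebesgue_vec R n]_t \prod_(i < n) F i (tnth t i) =
   \prod_(i < n) \int[leb]_x F i x)%R.
Proof.
move=> iF; have iF' i : cinteg leb (fun x => (F i x)%:C%C).
  by split; [exact: iF|exact: (integrable0 leb setT)].
have [[h1 _] h2] := cint_vec_prod iF'.
have E (I : finType) (G : I -> R) : (\prod_i (G i)%:C%C = (\prod_i G i)%:C%C)%R.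
  by elim/big_rec2 : _ => // i x y _ ->; apply: complex_ext => /=; ring.
have cE (g : R -> R) : cint leb (fun x => (g x)%:C%C) = ((\int[leb]_x g x)%:C%C)%R.
  by apply: complex_ext => //=; rewrite /Rintegral integral0.
split.
  by apply: eq_integrable h1 => // t _; rewrite E.
have := congr1 (@complex.Re R) h2; rewrite (eq_bigr _ (fun i _ => cE (F i))) E /= => <-.
by congr fine; apply: eq_integral => t _; rewrite E.
Qed.

(** Serves to discard the faces of a box, where [cvg_bump] does not apply. In the induction the
    hyperplane is a product with a null factor: a hyperplane of lower dimension or a single point of
    the line. *)
Lemma negligible_coord n (i : 'I_n) (c : R) :
  {ae lebesgue_vec R n, forall t, tnth t i != c}.
Proof.
have mS m (j : 'I_m) : measurable [set t : Rvec R m | tnth t j = c].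
  rewrite -[X in measurable X]setTI.
  exact: (measurable_tnth j measurableT (measurable_set1 c)).
suff h : lebesgue_vec R n [set t | tnth t i = c] = 0.
  exists [set t | tnth t i = c]; split; [exact: mS|exact: h|].
  by move=> t /= tc; have [//|ne] := eqVneq (tnth t i) c; case: (tc ne).
elim: n i => [[]//|n IH] i.
have -> : lebesgue_vec R n.+1 [set t | tnth t i = c] =
   (lebesgue_vec R n \x leb) (consv @^-1` [set t | tnth t i = c]) by [].
case: (unliftP ord0 i) => [j ->|->].
  have -> : consv @^-1` [set t : Rvec R n.+1 | tnth t (lift ord0 j) = c] =
     [set t : Rvec R n | tnth t j = c] `*` setT.
    by apply/seteqP; split=> z /=; rewrite tnth_consvS => //; case.
  rewrite product_measure1E; [|exact: mS|exact: measurableT].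
  by transitivity (0 * leb setT); [congr (_ * _); exact: IH|exact: mul0e].
have -> : consv @^-1` [set t : Rvec R n.+1 | tnth t ord0 = c] =
   [set: Rvec R n] `*` [set c].
  by apply/seteqP; split=> z /=; rewrite tnth_consv0 => //; case.
by rewrite product_measure1E//= lebesgue_measure_set1 mule0.
Qed.

End lebesgue_vec_theory.

(** * Functions with vanishing integral over every box *)

Section density_measure.
Context {R : realType} d (T : measurableType d) (mu : {measure set T -> \bar R}).
Local Open Scope ereal_scope.

(** Turns the positive and negative parts of a function into measures, so that uniqueness of
    measures can compare them. Carrying [mf] and [f0] as arguments lets the measure structure be
    inferred from the term. *)
Definition density_measure (f : T -> \bar R) (mf : measurable_fun setT f)
  (f0 : forall x, 0 <= f x) (A : set T) := \int[mu]_(x in A) f x.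

Section instance.
Variables (f : T -> \bar R) (mf : measurable_fun setT f) (f0 : forall x, 0 <= f x).

Let density0 : density_measure mf f0 set0 = 0.
Proof. by rewrite /density_measure integral_set0. Qed.

Let density_ge0 A : 0 <= density_measure mf f0 A.
Proof. by apply: integral_ge0. Qed.

Let density_sigma_additive : semi_sigma_additive (density_measure mf f0).
Proof.
move=> A mA tA mUA; rewrite /density_measure.
rewrite ge0_integral_bigcup//; last exact: measurable_funTS.
apply: is_cvg_ereal_nneg_natsum_cond => n _ _.
exact: integral_ge0.
Qed.

HB.instance Definition _ := isMeasure.Build _ _ _
  (density_measure mf f0) density0 density_ge0 density_sigma_additive.

End instance.
End density_measure.

Section boxes.
Context {R : realType} {n : nat}.
Local Notation mu := (lebesgue_vec R n).

(** Half-open like the intervals that generate the Borel sets of the line, so that a slab over such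
    an interval is a countable union of boxes. *)
Definition box (a b : 'I_n -> R) : set (Rvec R n) :=
  [set t | forall i, a i < tnth t i <= b i].

Let boxes : set (set (Rvec R n)) := [set A | exists a b, A = box a b].

Lemma measurable_box a b : measurable (box a b).
Proof.
have -> : box a b = \bigcap_(i in [set: 'I_n]) ((fun t => tnth t i) @^-1` `]a i, b i]%classic).
  apply/seteqP; split=> t /= h i; first by move=> _; rewrite /= in_itv /= h.
  by have := h i Logic.I; rewrite /= in_itv.
apply: fin_bigcap_measurable => // i _.
rewrite -[X in measurable X]setTI; apply: (measurable_tnth i measurableT).
exact: measurable_itv.
Qed.

Lemma setI_closed_boxes : setI_closed boxes.
Proof.
move=> _ _ [a [b ->]] [a' [b' ->]].
exists (fun i => Num.max (a i) (a' i)), (fun i => Num.min (b i) (b' i)).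
apply/seteqP; split=> t /=.
  by move=> [h h'] i; rewrite gt_max le_min; have /andP[-> ->] := h i; have /andP[-> ->] := h' i.
by move=> h; split=> i; have := h i; rewrite /= gt_max le_min => /andP[/andP[h1 h2] /andP[h3 h4]]; rewrite ?h1 ?h2 ?h3 ?h4.
Qed.

Lemma box_cover : \bigcup_k (box (fun=> - k%:R) (fun=> k%:R)) = setT.
Proof.
apply/seteqP; split=> // t _.
pose s := \sum_(i < n) `|tnth t i|.
have [k kP] : exists k : nat, s < k%:R.
  by exists (Num.truncn s).+1; exact: truncnS_gt.
exists k => // i.
have : `|tnth t i| <= s by rewrite /s (bigD1 i)//= lerDl sumr_ge0.
move=> /le_lt_trans/(_ kP); rewrite ltr_norml => /andP[-> /ltW ->]//.
Qed.

(** The sets B whose cylinder over coordinate i is generated by boxes form a sigma-algebra. It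
    contains each ]b, c], since that cylinder is the union over k of the boxes with side ]b, c] in
    direction i and ]-k, k] in the others. *)
Lemma measurable_boxes : measurable = <<s boxes >>.
Proof.
apply/seteqP; split; last first.
  apply: smallest_sub; first exact: sigma_algebra_measurable.
  by move=> _ [a [b ->]]; exact: measurable_box.
have sb : sigma_algebra setT <<s boxes >> by exact: smallest_sigma_algebra.
apply: smallest_sub => //.
rewrite -bigcup_seq => A [i _ [B mB <-]]; rewrite setTI.
pose E := [set B : set (measurableTypeR R) | <<s boxes >> ((fun t : Rvec R n => tnth t i) @^-1` B)].
have sE : sigma_algebra setT E.
  case: sb => s0 sC sU; split.
  - by rewrite /E /= preimage_set0.
  - move=> C EC; rewrite /E /= setTD preimage_setC -setTD; exact: sC.
  - by move=> F EF; rewrite /E /= preimage_bigcup; exact: sU.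
suff : measurable `<=` E by apply.
apply: smallest_sub => // _ [[b c]] _ <-.
rewrite /E /=.
have -> : (fun t : Rvec R n => tnth t i) @^-1` `]b, c]%classic =
   \bigcup_k (box (fun j => if j == i then b else - k%:R) (fun j => if j == i then c else k%:R)).
  apply/seteqP; split=> t /=.
    rewrite in_itv /= => bc.
    have : (\bigcup_k (box (fun=> - k%:R) (fun=> k%:R))) t by rewrite box_cover.
    by move=> [k _ kt]; exists k => // j; case: eqP => [->//|_]; exact: kt.
  by move=> [k _ /(_ i)]; rewrite eqxx in_itv.
case: sb => _ _; apply => k; apply: sub_gen_smallest.
by do 2 eexists.
Qed.

(** The positive and negative parts of D are densities of two measures that agree on boxes. Boxes
    are stable under intersection, generate the sigma-algebra and exhaust the space by sets of
    finite mass, so the two measures coincide. *)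
Lemma ae_eq0_boxes (D : Rvec R n -> R) :
  measurable_fun setT (D : _ -> measurableTypeR R) ->
  (forall a b, mu.-integrable (box a b) (fun t => (D t)%:E)) ->
  (forall a b, \int[mu]_(t in box a b) (D t)%:E = 0)%E ->
  {ae mu, forall t, D t = 0}.
Proof.
move=> mD iD D0; have mE : measurable_fun setT (fun t => (D t)%:E) by exact/measurable_EFinP.
pose p := (fun t => (D t)%:E)^\+%E; pose q := (fun t => (D t)%:E)^\-%E.
have mp : measurable_fun setT p by exact: measurable_funepos.
have mq : measurable_fun setT q by exact: measurable_funeneg.
have p0 x : (0 <= p x)%E by exact: funepos_ge0.
have q0 x : (0 <= q x)%E by exact: funeneg_ge0.
pose m1 : {measure set (Rvec R n) -> \bar R} := density_measure mu mp p0.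
pose m2 : {measure set (Rvec R n) -> \bar R} := density_measure mu mq q0.
have fp a b : (\int[mu]_(t in box a b) p t)%E \is a fin_num.
  apply: integrable_fin_num; first exact: measurable_box.
  by apply: integrable_funepos => //; exact: measurable_box.
have fq a b : (\int[mu]_(t in box a b) q t)%E \is a fin_num.
  apply: integrable_fin_num; first exact: measurable_box.
  by apply: integrable_funeneg => //; exact: measurable_box.
have E A : measurable A -> (\int[mu]_(t in A) p t = \int[mu]_(t in A) q t)%E.
  move=> mA; change (m1 A = m2 A).
  apply: (@measure_unique _ _ _ boxes (fun k => box (fun=> - k%:R) (fun=> k%:R))
    measurable_boxes setI_closed_boxes _ box_cover m1 m2) => //.
  - by move=> k; do 2 eexists.
  - move=> _ [a [b ->]]; rewrite /m1 /m2 /= /density_measure.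
    have := D0 a b; rewrite [X in X = _]integralE -/p -/q => pq.
    by rewrite -[LHS](subeK _ (fq a b)) pq add0e.
  - move=> k; rewrite /m1 /= /density_measure.
    by move: (fp (fun=> - k%:R) (fun=> k%:R)); rewrite fin_numElt => /andP[].
have mpos : measurable [set t | 0 <= D t].
  rewrite -[X in measurable X]setTI (_ : [set t | 0 <= D t] = D @^-1` `[0, +oo[%classic).
    by apply: mD => //; exact: measurable_itv.
  by apply/seteqP; split=> t /=; rewrite in_itv /= andbT.
have mneg : measurable (~` [set t | 0 <= D t]) by exact: measurableC.
(* Split along the set where D is nonnegative: on it the integral of [p] equals that of [q], which
   vanishes there, and off it [p] itself vanishes. *)
have ip : (\int[mu]_t p t = 0)%E.
  rewrite -(setUv [set t | 0 <= D t]) ge0_integral_setU//; last 2 first.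
    by rewrite setUv.
    exact/disj_setPCl.
  rewrite E// [X in (X + _)%E]integral0_eq ?add0e; last first.
    by move=> t /= Dt; rewrite /q funenegE; apply/max_idPr; rewrite -EFinN lee_fin oppr_le0.
  rewrite integral0_eq// => t /= /negP; rewrite -ltNge => Dt.
  by rewrite /p funeposE; apply/max_idPr; rewrite lee_fin ltW.
have iq : (\int[mu]_t q t = 0)%E by rewrite -E.
have aep : ae_eq mu setT p (cst 0%E).
  apply/(@ae_eq_integral_abs _ _ _ mu _ measurableT _ mp).
  by under eq_integral do rewrite gee0_abs//.
have aeq : ae_eq mu setT q (cst 0%E).
  apply/(@ae_eq_integral_abs _ _ _ mu _ measurableT _ mq).
  by under eq_integral do rewrite gee0_abs//.
apply: filterS2 aep aeq => t /(_ Logic.I) /= pt /(_ Logic.I) /= qt.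
have /(congr1 (fun g => g t)) := funeposneg (fun t => (D t)%:E).
rewrite /= -/p -/q pt qt sube0.
by case.
Qed.

End boxes.
(** * Gaussians and their Fourier transforms *)

Section gauss_line.
Context {R : realType}.
Local Notation leb := (@lebesgue_measure R).
Implicit Types a x y : R.

(** Normalized so that for a > 0 the total mass is a^(-1/2) and the Fourier transform is a^(-1/2)
    times [gauss a^-1]. A negative a occurs once, for the integrating factor in [phiE]. *)
Definition gauss a x : R := expR (- (pi * a * x ^+ 2)).

Lemma gauss_ge0 a x : 0 <= gauss a x. Proof. exact: expR_ge0. Qed.

Lemma gaussN a x : gauss a (- x) = gauss a x.
Proof. by rewrite /gauss sqrrN. Qed.

Lemma continuous_gauss a : continuous (gauss a).
Proof.
move=> x; apply: continuous_comp; last exact: continuous_expR.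
apply: continuousN; apply: continuousM; first exact: cst_continuous.
exact: exprn_continuous.
Qed.

Lemma measurable_gauss a : measurable_fun setT (gauss a : measurableTypeR R -> measurableTypeR R).
Proof. by apply: continuous_measurable_fun; exact: continuous_gauss. Qed.

(** Identification with the centred normal density of variance 1/(2 pi a), from which integrability
    and total mass are read off. *)
Lemma gauss_normal a x : 0 < a ->
  Num.sqrt a * gauss a x = normal_pdf 0 (Num.sqrt (2 * pi * a))^-1 x.
Proof.
move=> a0.
have pa : 0 < 2 * pi * a by rewrite !mulr_gt0// pi_gt0.
rewrite normal_pdfE ?invr_eq0 ?sqrtr_eq0 -?ltNge//.
have pi0 : (pi : R) != 0 by rewrite gt_eqF// pi_gt0.
have aN0 : a != 0 by rewrite gt_eqF.
have s2 : (Num.sqrt (2 * pi * a))^-1 ^+ 2 = (2 * pi * a)^-1.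
  by rewrite exprVn sqr_sqrtr// ltW.
rewrite /normal_peak /normal_fun s2 subr0 /gauss; congr (_ * expR _).
  rewrite -sqrtrV; last first.
    by rewrite mulrn_wge0// mulr_ge0 ?pi_ge0// invr_ge0 ltW.
  by congr Num.sqrt; rewrite -mulr_natl; move: (pi : R) pi0 => p p0; field; rewrite ?p0 ?aN0.
by rewrite -mulr_natl; move: (pi : R) pi0 => p p0; field; rewrite ?p0 ?aN0.
Qed.

Lemma integrable_gauss a : 0 < a -> leb.-integrable setT (fun x => (gauss a x)%:E).
Proof.
move=> a0.
have sa : Num.sqrt a != 0 by rewrite sqrtr_eq0 -ltNge.
apply: (@eq_integrable _ _ _ leb _ measurableT (fun x => ((Num.sqrt a)^-1%:E *
   (normal_pdf 0 (Num.sqrt (2 * pi * a))^-1 x)%:E)%E)).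
  by move=> x _; rewrite -gauss_normal// -EFinM mulKf.
by apply: integrableZl => //; exact: integrable_normal_pdf.
Qed.

Lemma Rintegral_gauss a : 0 < a -> \int[leb]_x gauss a x = (Num.sqrt a)^-1.
Proof.
move=> a0; have sa : Num.sqrt a != 0 by rewrite sqrtr_eq0 -ltNge.
apply: (mulfI sa); rewrite mulfV// -RintegralZl//; last exact: integrable_gauss.
rewrite /Rintegral; under eq_integral do rewrite gauss_normal//.
by rewrite integral_normal_pdf.
Qed.

Lemma is_derive_gauss a x :
  is_derive x 1 (gauss a) (- (2 * pi * a * x) * gauss a x).
Proof.
apply: is_derive_eq.
by rewrite /GRing.scale /= /gauss !mulr1; ring.
Qed.

Lemma is_derive_sinM y x : is_derive x 1 (fun x => sin (y * x)) (y * cos (y * x)).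
Proof.
apply: is_derive_eq.
by rewrite /GRing.scale /= !mulr1; ring.
Qed.

Lemma is_derive_cosM y x : is_derive y 1 (fun y => cos (y * x)) (- (x * sin (y * x))).
Proof.
apply: is_derive_eq.
by rewrite /GRing.scale /= !mulr1; ring.
Qed.

(** On a symmetric interval the integral of f is a boundary term of F, which tends to 0, while by
    dominated convergence these integrals tend to the integral over the line. *)
Lemma Rintegral_derive0 (F f : R -> R) :
  continuous f -> (forall x, is_derive x 1 F (f x)) ->
  leb.-integrable setT (fun x => (f x)%:E) ->
  (fun n : nat => F n%:R) @ \oo --> (0 : R) ->
  (fun n : nat => F (- n%:R)) @ \oo --> (0 : R) ->
  \int[leb]_x f x = 0.
Proof.
move=> cf dF ifE F1 F2.
pose I n : set R := `[- n%:R, n%:R]%classic.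
have mI n : measurable (I n : set (measurableTypeR R)) by exact: measurable_itv.
have mf : measurable_fun setT (f : measurableTypeR R -> measurableTypeR R).
  exact: continuous_measurable_fun.
(* The index is shifted by one because the fundamental theorem is applied on an interval with
   distinct endpoints. *)
have E n : (\int[leb]_(x in I n.+1) (f x)%:E = (F n.+1%:R)%:E - (F (- n.+1%:R))%:E)%E.
  apply: continuous_FTC2.
  - by rewrite (@lt_trans _ _ 0)// oppr_lt0.
  - exact: continuous_subspaceT.
  - have cF : continuous F.
      move=> x; apply: differentiable_continuous; apply/derivable1_diffP.
      exact: (@ex_derive _ _ _ _ _ _ _ (dF x)).
    split.
    + by move=> x _; exact: (@ex_derive _ _ _ _ _ _ _ (dF x)).
    + by apply: cvg_at_right_filter; exact: cF.
    + by apply: cvg_at_left_filter; exact: cF.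
  - by move=> x _; rewrite derive1E; exact: (@derive_val _ _ _ _ _ _ _ (dF x)).
have [] := @dominated_convergence _ _ _ leb setT measurableT
  (fun n x => ((f x)%:E * (\1_(I n.+1) x)%:E)%E) (fun x => (f x)%:E) (fun x => `|(f x)%:E|%E).
- move=> n; apply: emeasurable_funM; first exact/measurable_EFinP.
  by apply/measurable_EFinP; exact: measurable_indic.
- exact/measurable_EFinP.
- apply: aeW => x _; apply: cvg_near_cst.
  exists (Num.truncn `|x|) => // n /= xn.
  have Ix : I n.+1 x.
    rewrite /I /= in_itv /= -ler_norml.
    by apply: ltW; apply: lt_le_trans (truncnS_gt _) _; rewrite ler_nat.
  by rewrite indicE mem_set ?mule1.
- exact: (integrable_abse ifE).
- apply: aeW => x n _; rewrite abseM -[leRHS]mule1 lee_pmul//.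
  by rewrite /= lee_fin indicE; case: (_ \in _); rewrite ?normr1 ?normr0.
move=> _ _ l1; apply: EFin_inj; rewrite /Rintegral fineK; last exact: integrable_fin_num.
apply: (cvg_unique _ l1) => //.
rewrite (_ : [sequence _]_n = fun n => ((F n.+1%:R) - (F (- n.+1%:R)))%:E); last first.
  apply/funext => n; rewrite /= EFinB -E [RHS]integral_mkcond; apply: eq_integral => x _.
  by rewrite epatch_indic.
apply: cvg_EFin; first exact: nearW.
rewrite -[X in _ --> X](subrr (0 : R)).
apply: cvgB; [by rewrite -(cvg_shiftS (fun n => F n%:R)) in F1|].
by rewrite -(cvg_shiftS (fun n => F (- n%:R))) in F2.
Qed.

(** Half of the exponent absorbs |x|: one has |x| <= 1 + x^2 and 1 + u <= exp(u) with u = pi a x^2 /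
    2, and the constant is chosen so that its product with 1 + u exceeds 1 + x^2. *)
Lemma le_normM_gauss a x : 0 < a ->
  `|x| * gauss a x <= (1 + 2 / (pi * a)) * gauss (a / 2) x.
Proof.
move=> a0; have pa : 0 < pi * a by rewrite mulr_gt0// pi_gt0.
have -> : gauss a x = gauss (a / 2) x * gauss (a / 2) x.
  by rewrite /gauss -expRD; congr expR; field.
rewrite mulrA ler_wpM2r ?gauss_ge0//.
have e1 : 1 + pi * (a / 2) * x ^+ 2 <= expR (pi * (a / 2) * x ^+ 2) by exact: expR_ge1Dx.
rewrite /gauss expRN ler_pdivrMr ?expR_gt0//.
have x2 : `|x| <= 1 + x ^+ 2.
  by rewrite -[x ^+ 2]real_normK ?num_real//; have := sqr_ge0 (`|x| - 1); nra.
apply: (le_trans x2); apply: (@le_trans _ _ ((1 + 2 / (pi * a)) * (1 + pi * (a / 2) * x ^+ 2))).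
  have pi0 : (pi : R) != 0 by rewrite gt_eqF// pi_gt0.
  have aN0 : a != 0 by rewrite gt_eqF.
  have -> : (1 + 2 / (pi * a)) * (1 + pi * (a / 2) * x ^+ 2) =
     1 + x ^+ 2 + (2 / (pi * a) + pi * a / 2 * x ^+ 2).
    by move: (pi : R) pi0 => p p0; field; rewrite ?p0 ?aN0.
  rewrite lerDl; apply: addr_ge0; first by rewrite divr_ge0// ltW.
  by rewrite mulr_ge0 ?sqr_ge0// divr_ge0// ltW.
by rewrite ler_wpM2l// addr_ge0// divr_ge0// ltW.
Qed.

Lemma integrable_normM_gauss a : 0 < a ->
  leb.-integrable setT (fun x => (`|x| * gauss a x)%:E).
Proof.
move=> a0; have a20 : 0 < a / 2 by rewrite divr_gt0.
apply: (@le_integrable _ _ _ leb _ measurableT _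
  (fun x => ((1 + 2 / (pi * a))%:E * (gauss (a / 2) x)%:E)%E)).
- apply/measurable_EFinP; apply: measurable_funM; last exact: measurable_gauss.
  by apply: continuous_measurable_fun; exact: norm_continuous.
- move=> x _; rewrite /= lee_fin ger0_norm ?mulr_ge0 ?gauss_ge0//.
  by rewrite (le_trans (le_normM_gauss _ a0))// ler_norm.
- by apply: integrableZl => //; exact: integrable_gauss.
Qed.

Let phi a y : R := \int[leb]_x (cos (y * x) * gauss a x).

Lemma continuous_cosM y : continuous (fun x : R => cos (y * x)).
Proof.
move=> x; apply: continuous_comp; last exact: continuous_cos.
exact: mulrl_continuous.
Qed.

Lemma continuous_sinM y : continuous (fun x : R => sin (y * x)).
Proof.
move=> x; apply: continuous_comp; last exact: continuous_sin.
exact: mulrl_continuous.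
Qed.

Lemma integrable_boundedM_gauss a (f : R -> R) : 0 < a -> continuous f ->
  (forall x, `|f x| <= 1) -> leb.-integrable setT (fun x => (f x * gauss a x)%:E).
Proof.
move=> a0 cf f1.
apply: (@le_integrable _ _ _ leb _ measurableT _ (fun x => (gauss a x)%:E)).
- apply/measurable_EFinP; apply: measurable_funM; last exact: measurable_gauss.
  exact: continuous_measurable_fun.
- move=> x _; rewrite /= lee_fin normrM -[leRHS]mul1r ler_wpM2r//.
- exact: integrable_gauss.
Qed.

Lemma integrable_boundedXM_gauss a (f : R -> R) : 0 < a -> continuous f ->
  (forall x, `|f x| <= 1) -> leb.-integrable setT (fun x => (x * f x * gauss a x)%:E).
Proof.
move=> a0 cf f1.
apply: (@le_integrable _ _ _ leb _ measurableT _ (fun x => (`|x| * gauss a x)%:E)).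
- apply/measurable_EFinP; apply: measurable_funM; last exact: measurable_gauss.
  by apply: measurable_funM => //; exact: continuous_measurable_fun.
- move=> x _; rewrite /= lee_fin !normrM normr_id ler_wpM2r//.
  by rewrite -[leRHS]mulr1 ler_wpM2l.
- exact: integrable_normM_gauss.
Qed.

Lemma cvg_boundedM_gauss a (f : R -> R) (u : nat -> R) : 0 < a ->
  (forall x, `|f x| <= 1) -> (forall n, `|u n| = n%:R) ->
  (fun n => f (u n) * gauss a (u n)) @ \oo --> (0 : R).
Proof.
move=> a0 f1 un; apply: norm_cvg0.
have pa : 0 < pi * a by rewrite mulr_gt0// pi_gt0.
(* The majorant 2 / (pi a (n + 1)) comes from exp(x) >= 1 + x together with n^2 >= (n + 1)/2, valid
   for n >= 1. *)
apply: (@squeeze_cvgr _ _ _ _ (fun=> 0) (fun n => (pi * a)^-1 * n.+1%:R^-1 * 1 *2)).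
- near=> n; rewrite normr_ge0 /= normrM (ger0_norm (gauss_ge0 _ _)).
  rewrite -[leRHS]mul1r ler_pM// ?gauss_ge0//.
  have n0 : 1 <= n%:R :> R by rewrite ler1n; near: n; exists 1%N.
  rewrite /gauss -[u n ^+ 2]real_normK ?num_real// un expRN.
  have e1 : 1 + pi * a * n%:R ^+ 2 <= expR (pi * a * n%:R ^+ 2) by exact: expR_ge1Dx.
  have e2 : pi * a * n.+1%:R / 2 <= expR (pi * a * n%:R ^+ 2).
    rewrite (le_trans _ e1)// -natr1.
    suff : (n%:R + 1) / 2 <= n%:R ^+ 2 :> R by move=> h; nra.
    nra.
  rewrite mulr1 (_ : _ * 2 = (pi * a * n.+1%:R / 2)^-1); last first.
    by rewrite [RHS]invfM invrK [in RHS](invfM (pi * a)).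
  by rewrite lef_pV2 ?posrE ?expR_gt0// divr_gt0// mulr_gt0.
- exact: cvg_cst.
- rewrite -[X in _ --> X](_ : (pi * a)^-1 * 0 * 1 * 2 = 0); last by ring.
  apply: cvgMl; apply: cvgMl; apply: cvgMr; exact: cvg_harmonic.
Unshelve. all: by end_near.
Qed.

(** Integration by parts in the form of [Rintegral_derive0]: sin(y x) [gauss a x] vanishes at both
    ends, so the integral of its derivative is 0. *)
Lemma sinM_gauss_parts a y : 0 < a ->
  2 * pi * a * \int[leb]_x (x * sin (y * x) * gauss a x) = y * phi a y.
Proof.
move=> a0.
have j1 : leb.-integrable setT (fun x => (cos (y * x) * gauss a x)%:E).
  by apply: integrable_boundedM_gauss; [|exact: continuous_cosM|move=> x; exact: cos_max].
have j2 : leb.-integrable setT (fun x => (x * sin (y * x) * gauss a x)%:E).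
  by apply: integrable_boundedXM_gauss; [|exact: continuous_sinM|move=> x; exact: sin_max].
have i1 : leb.-integrable setT (fun x => (y * (cos (y * x) * gauss a x))%:E).
  exact: (integrableZl measurableT y j1).
have i2 : leb.-integrable setT (fun x => (2 * pi * a * (x * sin (y * x) * gauss a x))%:E).
  exact: (integrableZl measurableT (2 * pi * a) j2).
have := @Rintegral_derive0 (fun x => sin (y * x) * gauss a x)
  (fun x => y * (cos (y * x) * gauss a x) - 2 * pi * a * (x * sin (y * x) * gauss a x)).
rewrite RintegralB// !RintegralZl//.
move=> h; apply/esym/eqP; rewrite -subr_eq0; apply/eqP; apply: h.
- move=> x; apply: cvgB; apply: cvgM; try exact: cvg_cst.
    by apply: cvgM; [exact: continuous_cosM|exact: continuous_gauss].
  apply: cvgM; last exact: continuous_gauss.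
  by apply: cvgM; [exact: cvg_id|exact: continuous_sinM].
- move=> x; have ds := is_derive_sinM y x; have dg := is_derive_gauss a x.
  apply: is_derive_eq; rewrite /GRing.scale /= ?mulr1.
  by move: (pi : R) => p; ring.
- by under eq_fun do rewrite EFinB; exact: integrableB.
- apply: (cvg_boundedM_gauss (f := fun x => sin (y * x)) (u := fun n => n%:R)) => //.
    by move=> x; exact: sin_max.
  by move=> n; rewrite ger0_norm.
- apply: (cvg_boundedM_gauss (f := fun x => sin (y * x)) (u := fun n => - n%:R)) => //.
    by move=> x; exact: sin_max.
  by move=> n; rewrite normrN ger0_norm.
Qed.

(* Differentiating under the integral sign and integrating by parts gives a linear differential
   equation in y, which determines phi a. *)
Lemma is_derive_phi a y : 0 < a ->
  is_derive y 1 (phi a) (- (y / (2 * pi * a)) * phi a y).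
Proof.
move=> a0; pose f (y x : R) : R := cos (y * x) * gauss a x.
have d1 (z x : R) : is_derive z 1 (f ^~ x) (- (x * sin (z * x)) * gauss a x).
  have dc := is_derive_cosM z x; apply: is_derive_eq.
  by rewrite /GRing.scale /= ?mulr1; ring.
have p1 z x : partial1of2 f z x = - (x * sin (z * x)) * gauss a x.
  by rewrite partial1of2E; exact: (@derive_val _ _ _ _ _ _ _ (d1 z x)).
have Ia : `]y - 1, y + 1[%classic y by rewrite /= in_itv /=; lra.
have intf x : `]y - 1, y + 1[%classic x -> leb.-integrable setT (EFin \o f x).
  by move=> _; apply: integrable_boundedM_gauss; [|exact: continuous_cosM|move=> z; exact: cos_max].
have derf x z : `]y - 1, y + 1[%classic x -> setT z -> derivable (f ^~ z) x 1.
  by move=> _ _; exact: (@ex_derive _ _ _ _ _ _ _ (d1 x z)).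
have G0 x : 0 <= `|x| * gauss a x by rewrite mulr_ge0 ?gauss_ge0.
have Gub x z : `]y - 1, y + 1[%classic x -> setT z -> `|partial1of2 f x z| <= `|z| * gauss a z.
  move=> _ _; rewrite p1 normrM normrN normrM (ger0_norm (gauss_ge0 _ _)).
  by rewrite ler_wpM2r ?gauss_ge0// -[leRHS]mulr1 ler_wpM2l// sin_max.
have iG := integrable_normM_gauss a0.
have D1 := derivable_under_integral measurableT Ia intf derf G0 iG Gub.
have D2 := differentiation_under_integral measurableT Ia intf derf G0 iG Gub.
have pa : 2 * pi * a != 0 by rewrite gt_eqF// !mulr_gt0// pi_gt0.
apply: DeriveDef; first exact: D1.
rewrite -derive1E; rewrite /f in D2; rewrite /phi D2.
apply: (mulfI pa).
transitivity (- (2 * pi * a * \int[leb]_x (x * sin (y * x) * gauss a x))).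
  rewrite -mulrN; congr (_ * _); rewrite -mulN1r -RintegralZl//; last first.
    by apply: integrable_boundedXM_gauss; [|exact: continuous_sinM|move=> x; exact: sin_max].
  by congr fine; apply: eq_integral => x _; rewrite p1; congr EFin; ring.
rewrite sinM_gauss_parts// -/(phi a y).
by move: (phi a y) (2 * pi * a) pa => P c c0; field; rewrite ?c0.
Qed.

Lemma phiE a y : 0 < a ->
  phi a y = (Num.sqrt a)^-1 * expR (- (y ^+ 2 / (4 * pi * a))).
Proof.
move=> a0; have pa : pi * a != 0 by rewrite gt_eqF// mulr_gt0// pi_gt0.
have pi0 : (pi : R) != 0 by rewrite gt_eqF// pi_gt0.
have aN0 : a != 0 by rewrite gt_eqF.
(* With this b, [gauss b z] is exp(z^2 / (4 pi a)), the integrating factor of the differential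
   equation for [phi a]; hence [h] is constant. *)
pose b := - (4 * pi ^+ 2 * a)^-1.
pose h z := phi a z * gauss b z.
have dh (z : R) : is_derive z 1 h 0.
  have dp := is_derive_phi z a0; have dg := is_derive_gauss b z.
  apply: is_derive_eq; rewrite /GRing.scale /= /b.
  move: (phi a z) (gauss b z) (pi : R) pi0 => P G p p0.
  by field; rewrite ?p0 ?aN0.
have := is_derive_0_is_cst y 0 dh.
rewrite /h {2}/gauss expr0n mulr0 oppr0 expR0 mulr1 => E.
have -> : phi a y = phi a 0 * expR (- (y ^+ 2 / (4 * pi * a))).
  rewrite -E -mulrA /gauss -expRD /b (_ : _ + _ = 0) ?expR0 ?mulr1//.
  by move: (pi : R) pi0 => p p0; field; rewrite ?p0 ?aN0.
congr (_ * _); rewrite -Rintegral_gauss//; congr fine; apply: eq_integral => x _.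
by rewrite mul0r cos0 mul1r.
Qed.

Lemma normc_cexpi (x : R) : normc (cexpi x) = 1.
Proof. by rewrite /normc /= cos2Dsin2 sqrtr1. Qed.

Lemma cexpiD (x y : R) : cexpi (x + y) = cexpi x * cexpi y.
Proof.
by apply: complex_ext; rewrite ?ReM ?ImM /= ?cosD ?sinD //; ring.
Qed.

Lemma cexpi0 : cexpi 0 = 1 :> R[i].
Proof. by rewrite /cexpi cos0 sin0. Qed.

Lemma conjc_cexpi (x : R) : conjc (cexpi x) = cexpi (- x).
Proof. by apply: complex_ext; rewrite /= ?cosN ?sinN. Qed.

Lemma cmeas_cexpi d (T : measurableType d) (f : T -> R) :
  measurable_fun setT (f : _ -> measurableTypeR R) -> cmeas (fun t => cexpi (f t)).
Proof.
move=> mf; split.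
- apply: (@measurableT_comp _ _ _ _ _ _ (@cos R)) => //.
  by apply: continuous_measurable_fun; exact: continuous_cos.
- apply: (@measurableT_comp _ _ _ _ _ _ (@sin R)) => //.
  by apply: continuous_measurable_fun; exact: continuous_sin.
Qed.

Lemma cinteg_cexpi_gauss a y : 0 < a ->
  cinteg leb (fun x => cexpi (y * x) * (gauss a x)%:C%C).
Proof.
move=> a0; apply: (cinteg_le _ (integrable_gauss a0)).
  apply: cmeasM; last by apply: cmeas_real; exact: measurable_gauss.
  by apply: cmeas_cexpi; apply: measurable_funM => //; exact: measurable_cst.
by move=> x; rewrite normcM normc_cexpi mul1r normc_real ger0_norm ?gauss_ge0.
Qed.

(** The real part is [phi a y]. As the Gaussian is even, the reflection x -> -x turns the integral
    into its conjugate, so the imaginary part is 0. *)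
Lemma cint_cexpi_gauss a y : 0 < a ->
  cint leb (fun x => cexpi (y * x) * (gauss a x)%:C%C) =
  ((Num.sqrt a)^-1 * expR (- (y ^+ 2 / (4 * pi * a))))%:C%C.
Proof.
move=> a0; have ic := cinteg_cexpi_gauss y a0.
have E : cint leb (fun x => cexpi (y * x) * (gauss a x)%:C%C) =
    conjc (cint leb (fun x => cexpi (y * x) * (gauss a x)%:C%C)).
  rewrite -cint_conj// -(cint_opp (cinteg_cmeas ic)); apply: eq_cint => x.
  rewrite conjcM conjc_cexpi mulrN gaussN.
  by congr (_ * _); apply: complex_ext => //=; rewrite oppr0.
apply: complex_ext => /=.
  rewrite -phiE//; congr fine; apply: eq_integral => x _.
  by rewrite mulr0 subr0.
move/(congr1 (@complex.Im R)) : E; rewrite Im_conjc /= => /eqP.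
by rewrite -subr_eq0 opprK -mulr2n mulrn_eq0 /= => /eqP.
Qed.

End gauss_line.
Section real_in_complex.
Context {R : realType}.

Lemma cint_real d (T : measurableType d) (mu : {measure set T -> \bar R}) (f : T -> R) :
  cint mu (fun x => (f x)%:C%C) = (\int[mu]_x f x)%:C%C.
Proof. by apply: complex_ext => //=; rewrite /Rintegral integral0. Qed.

Lemma cinteg_real d (T : measurableType d) (mu : {measure set T -> \bar R}) (f : T -> R) :
  mu.-integrable setT (fun x => (f x)%:E) -> cinteg mu (fun x => (f x)%:C%C).
Proof. by move=> fi; split; [exact: fi|exact: (integrable0 mu setT)]. Qed.

Lemma realcM (x y : R) : (x * y)%:C%C = x%:C%C * y%:C%C :> R[i].
Proof. by apply: complex_ext => /=; ring. Qed.

Lemma conjc_realc (x : R) : conjc x%:C%C = x%:C%C :> R[i].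
Proof. by apply: complex_ext => //=; rewrite oppr0. Qed.

Lemma realc_prod (I : Type) (r : seq I) (F : I -> R) :
  (\prod_(i <- r) F i)%:C%C = \prod_(i <- r) (F i)%:C%C :> R[i].
Proof.
elim: r => [|i r IH]; first by rewrite !big_nil.
by rewrite !big_cons realcM IH.
Qed.

End real_in_complex.

(** * Products of translated Gaussians on the line *)

Section gauss_line_products.
Context {R : realType}.
Local Notation leb := (@lebesgue_measure R).
Implicit Types a x y t u : R.

Lemma integrable_translation a (f : R -> R) :
  leb.-integrable setT (fun x => (f x)%:E) ->
  leb.-integrable setT (fun x => (f (x - a))%:E).
Proof.
move=> fi.
have mphi : measurable_fun setT (fun x : measurableTypeR R => x - a : measurableTypeR R).
  by apply: measurable_funB => //; exact: measurable_cst.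
have h A : measurable A -> _ := @lebesgue_measure_translation R a A.
by have [/(_ (cinteg_real fi)) []] := cinteg_image mphi h (cinteg_cmeas (cinteg_real fi)).
Qed.

Lemma Rintegral_translation a (f : R -> R) :
  leb.-integrable setT (fun x => (f x)%:E) ->
  \int[leb]_x f (x - a) = \int[leb]_x f x.
Proof.
move=> fi; have := cint_translation a (cinteg_cmeas (cinteg_real fi)).
by rewrite !cint_real => /(congr1 (@complex.Re R)).
Qed.

(* The Gaussian window g_0 factors as the product of g1 over the coordinates. *)
Definition g1 x : R := 2 `^ (4^-1) * gauss 1 x.

Lemma g1_ge0 x : 0 <= g1 x.
Proof. by rewrite mulr_ge0 ?powR_ge0 ?gauss_ge0. Qed.

Lemma g1N x : g1 (- x) = g1 x.
Proof. by rewrite /g1 gaussN. Qed.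

Lemma sqr_root4 : (2 `^ (4^-1)) ^+ 2 = Num.sqrt 2 :> R.
Proof.
rewrite -powR_mulrn ?powR_ge0// -powRrM -powR12_sqrt//; congr (_ `^ _).
by field.
Qed.

(** Completing the square about the midpoint m: (t - x)^2 + (t - y)^2 = 2 (t - m)^2 + (x - y)^2 / 2.
    The factor sqrt 2 later cancels the mass of [gauss 2]. *)
Lemma g1M t x y : g1 (t - x) * g1 (t - y) =
  Num.sqrt 2 * gauss (1 / 2) (x - y) * gauss 2 (t - (x + y) / 2).
Proof.
rewrite /g1 mulrACA -expr2 sqr_root4 -[RHS]mulrA; congr (_ * _).
rewrite /gauss -!expRD; congr expR.
by move: (pi : R) => p; field.
Qed.

Lemma integrable_g1M x y : leb.-integrable setT (fun t => (g1 (t - x) * g1 (t - y))%:E).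
Proof.
have h := integrable_translation ((x + y) / 2) (integrable_gauss (ltr0n R 2)).
apply: eq_integrable (integrableZl measurableT (Num.sqrt 2 * gauss (1 / 2) (x - y)) h) => //.
by move=> t _; rewrite g1M.
Qed.

Lemma Rintegral_g1M x y : \int[leb]_t (g1 (t - x) * g1 (t - y)) = gauss (1 / 2) (x - y).
Proof.
have h0 := integrable_gauss (ltr0n R 2).
have h := integrable_translation ((x + y) / 2) h0.
under eq_Rintegral do rewrite g1M.
rewrite RintegralZl// Rintegral_translation// Rintegral_gauss//.
by rewrite mulrAC mulfV ?mul1r// sqrtr_eq0 -ltNge.
Qed.

Lemma cinteg_cexpiM (f : R -> R) a : leb.-integrable setT (fun x => (f x)%:E) ->
  cinteg leb (fun t => cexpi (a * t) * (f t)%:C%C).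
Proof.
move=> fi; have mf := cinteg_cmeas (cinteg_real fi).
apply: cintegP.
  by apply: cmeasM => //; apply: cmeas_cexpi; apply: measurable_funM.
under eq_integral do rewrite normcM normc_cexpi mul1r.
exact/cinteg_lty/cinteg_real.
Qed.

(** The frequency cutoff of width growing with a transforms into a Gaussian of unit mass that
    concentrates at 0: this is where the approximate identity comes from. *)
Lemma cint_cutoff a y : 0 < a ->
  cint leb (fun x => cexpi (2 * pi * x * y) * (gauss a^-1 x)%:C%C) =
  (Num.sqrt a * gauss a y)%:C%C.
Proof.
move=> a0; have aN0 : a != 0 by rewrite gt_eqF.
have pi0 : (pi : R) != 0 by rewrite gt_eqF// pi_gt0.
transitivity (cint leb (fun x => cexpi ((2 * pi * y) * x) * (gauss a^-1 x)%:C%C)).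
  by apply: eq_cint => x; congr (cexpi _ * _); ring.
rewrite cint_cexpi_gauss ?invr_gt0//; congr (_ * expR _)%:C%C.
  by rewrite sqrtrV ?invrK// ltW.
by move: (pi : R) pi0 => p p0; field; rewrite ?p0 ?aN0.
Qed.

Lemma cinteg_cutoff a y : 0 < a ->
  cinteg leb (fun x => cexpi (2 * pi * x * y) * (gauss a^-1 x)%:C%C).
Proof.
move=> a0; have a1 : 0 < a^-1 by rewrite invr_gt0.
rewrite (_ : (fun x => _) = fun x => cexpi ((2 * pi * y) * x) * (gauss a^-1 x)%:C%C).
  exact/cinteg_cexpiM/integrable_gauss.
by apply/funext => x; congr (cexpi _ * _); ring.
Qed.

Lemma cinteg_ambiguity (x y eta : R) :
  cinteg leb (fun t => cexpi (2 * pi * eta * t) * (g1 (t - x) * g1 (t - y))%:C%C).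
Proof. exact/cinteg_cexpiM/integrable_g1M. Qed.

(** The ambiguity function of the one-dimensional Gaussian. Recentring at the midpoint produces only
    a phase, which the modulus removes, and leaves the Fourier transform of [gauss 2]. *)
Lemma normc_ambiguity (x y eta : R) :
  normc (cint leb (fun t => cexpi (2 * pi * eta * t) * (g1 (t - x) * g1 (t - y))%:C%C)) =
  gauss (1 / 2) (x - y) * gauss (1 / 2) eta.
Proof.
pose m := (x + y) / 2; pose w := 2 * pi * eta.
have pi0 : (pi : R) != 0 by rewrite gt_eqF// pi_gt0.
pose F t := cexpi (w * t) * (gauss 2 t)%:C%C : R[i].
have iF : cinteg leb F by exact: cinteg_cexpi_gauss.
have mF := cinteg_cmeas iF.
have E t : cexpi (w * t) * (g1 (t - x) * g1 (t - y))%:C%C =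
    (Num.sqrt 2 * gauss (1 / 2) (x - y))%:C%C * cexpi (w * m) * F (t - m).
  rewrite /F g1M (realcM (_ * _)) (_ : w * t = w * m + w * (t - m)); last by ring.
  by rewrite cexpiD -/m; ring.
have iFm : cinteg leb (fun t => F (t - m)).
  apply/(cinteg_image (mu := leb) (nu := leb)
     (phi := fun x : measurableTypeR R => x - m : measurableTypeR R) _ _ mF) => //.
    by apply: measurable_funB => //; exact: measurable_cst.
  by move=> A mA; exact: lebesgue_measure_translation.
transitivity (normc (cint leb (fun t =>
    (Num.sqrt 2 * gauss (1 / 2) (x - y))%:C%C * cexpi (w * m) * F (t - m)))).
  by congr normc; apply: eq_cint => t; exact: E.
rewrite cintZ// cint_translation// cint_cexpi_gauss//.
rewrite !normcM normc_cexpi !normc_real mulr1.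
rewrite ger0_norm; last by rewrite mulr_ge0 ?sqrtr_ge0 ?gauss_ge0.
rewrite ger0_norm; last by rewrite mulr_ge0 ?invr_ge0 ?sqrtr_ge0 ?expR_ge0.
have s2 : Num.sqrt 2 != 0 :> R by rewrite sqrtr_eq0 -ltNge.
rewrite -mulrA mulrCA; congr (_ * _); rewrite mulrA mulfV// [LHS]mul1r.
rewrite /gauss /w; congr expR.
by move: (pi : R) pi0 => p p0; field; rewrite ?p0.
Qed.

End gauss_line_products.

(** * The Gaussian window on R^d and its time-frequency shifts *)

Section gauss_vec.
Context {R : realType} {d : nat}.
Local Notation mu := (lebesgue_vec R d).
Implicit Types (t u x y : Rvec R d) (w z : phase R d).

Definition gaussv (a : R) x : R := \prod_(i < d) gauss a (tnth x i).

Lemma gaussvE a x : gaussv a x = expR (- (pi * a * dotv x x)).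
Proof.
rewrite /gaussv /gauss -expR_sum; congr expR.
rewrite /dotv mulr_sumr -sumrN; apply: eq_bigr => i _.
by rewrite expr2.
Qed.

Lemma gaussv_ge0 a x : 0 <= gaussv a x.
Proof. by apply: prodr_ge0 => i _; exact: gauss_ge0. Qed.

Lemma gaussv_le1 a x : 0 <= a -> gaussv a x <= 1.
Proof.
move=> a0; rewrite gaussvE -expR0 ler_expR oppr_le0 mulr_ge0//.
  by rewrite mulr_ge0// pi_ge0.
by apply: sumr_ge0 => i _; rewrite -expr2 sqr_ge0.
Qed.

Lemma tnth_subv x y i : tnth (subv x y) i = tnth x i - tnth y i.
Proof. by rewrite tnth_mktuple. Qed.

Definition G0 x : R := \prod_(i < d) g1 (tnth x i).

Lemma G0_ge0 x : 0 <= G0 x.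
Proof. by apply: prodr_ge0 => i _; exact: g1_ge0. Qed.

Lemma gauss0E x : gauss0 x = (G0 x)%:C%C.
Proof.
rewrite /gauss0 /G0 /g1 big_split /= prodr_const card_ord; congr (_ * _)%:C%C.
  rewrite -powR_mulrn ?powR_ge0// -powRrM; congr (_ `^ _).
  by rewrite mulrC.
by rewrite -/(gaussv 1 x) gaussvE mulr1.
Qed.

Lemma G0_le x : G0 x <= 2 `^ (d%:R / 4).
Proof.
have : G0 x = 2 `^ (d%:R / 4) * gaussv 1 x.
  have := gauss0E x; rewrite /gauss0 gaussvE mulr1 => /(congr1 (@complex.Re R)) /= <-//.
by move=> ->; rewrite -[leRHS]mulr1 ler_wpM2l ?powR_ge0// gaussv_le1.
Qed.

(** The function e_w of the overview. *)
Definition atom w : cfun R d := tfshift w gauss0.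

Lemma atomE w t : atom w t = cexpi (2 * pi * dotv w.2 t) * (G0 (subv t w.1))%:C%C.
Proof. by rewrite /atom /tfshift gauss0E. Qed.

Lemma normc_atom w t : normc (atom w t) = G0 (subv t w.1).
Proof. by rewrite atomE normcM normc_cexpi mul1r normc_real ger0_norm ?G0_ge0. Qed.

Lemma stftE (f : cfun R d) w : stft f w = inner f (atom w). Proof. by []. Qed.

Lemma cexpi_sum (I : Type) (r : seq I) (F : I -> R) :
  cexpi (\sum_(i <- r) F i) = \prod_(i <- r) cexpi (F i).
Proof.
elim: r => [|i r IH]; first by rewrite !big_nil cexpi0.
by rewrite !big_cons cexpiD IH.
Qed.

Lemma measurable_dotv d' (T : measurableType d') (f g : T -> Rvec R d) :
  measurable_fun setT f -> measurable_fun setT g ->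
  measurable_fun setT (fun p => dotv (f p) (g p) : measurableTypeR R).
Proof.
move=> mf mg; rewrite /dotv; apply: measurable_sum => i.
by apply: measurable_funM; [exact: (measurableT_comp (measurable_tnth i) mf)|
                            exact: (measurableT_comp (measurable_tnth i) mg)].
Qed.

Lemma measurable_subv2 d' (T : measurableType d') (f g : T -> Rvec R d) :
  measurable_fun setT f -> measurable_fun setT g ->
  measurable_fun setT (fun p => subv (f p) (g p) : Rvec R d).
Proof.
move=> mf mg; apply/measurable_fun_tnthP => i.
rewrite (_ : _ \o _ = fun p => tnth (f p) i - tnth (g p) i); last first.
  by apply/funext => p /=; rewrite tnth_subv.
by apply: measurable_funB; [exact: (measurableT_comp (measurable_tnth i) mf)|
                            exact: (measurableT_comp (measurable_tnth i) mg)].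
Qed.

Lemma measurable_gaussv a : measurable_fun setT (gaussv a : Rvec R d -> measurableTypeR R).
Proof.
rewrite (_ : gaussv a = fun x => expR (- (pi * a * dotv x x))); last first.
  by apply/funext => x; rewrite gaussvE.
apply: measurableT_comp => //; apply: measurableT_comp => //.
apply: measurable_funM; first exact: measurable_cst.
by apply: measurable_dotv.
Qed.

Lemma cmeas_gauss0 : cmeas (gauss0 : cfun R d).
Proof.
rewrite (_ : gauss0 = fun x : Rvec R d => (2 `^ (d%:R / 4) * gaussv 1 x)%:C%C); last first.
  by apply/funext => x; rewrite /gauss0 gaussvE mulr1.
apply: cmeas_real; apply: measurable_funM; first exact: measurable_cst.
exact: measurable_gaussv.
Qed.

Lemma cmeas_atom : cmeas (fun p : phase R d * Rvec R d => atom p.1 p.2).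
Proof.
have m1 : measurable_fun setT (fun p : phase R d * Rvec R d => p.1.1).
  exact: (measurableT_comp measurable_fst measurable_fst).
have m2 : measurable_fun setT (fun p : phase R d * Rvec R d => p.1.2).
  exact: (measurableT_comp measurable_snd measurable_fst).
apply: cmeasM.
  apply: cmeas_cexpi; apply: measurable_funM; first exact: measurable_cst.
  exact: measurable_dotv.
exact: (cmeas_comp cmeas_gauss0 (measurable_subv2 measurable_snd m1)).
Qed.

Lemma cmeas_atom1 w : cmeas (atom w).
Proof.
exact: (cmeas_comp cmeas_atom (pair1_measurable w)).
Qed.

Lemma cmeas_atom2 t : cmeas (atom ^~ t).
Proof.
exact: (cmeas_comp cmeas_atom (pair2_measurable t)).
Qed.

Lemma atom_prod w t : atom w t =
  \prod_(i < d) (cexpi (2 * pi * tnth w.2 i * tnth t i) *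
                 (g1 (tnth t i - tnth w.1 i))%:C%C).
Proof.
rewrite atomE big_split /= -cexpi_sum /G0 realc_prod; congr (cexpi _ * _).
  by rewrite /dotv mulr_sumr; apply: eq_bigr => i _; rewrite mulrA.
by apply: eq_bigr => i _; rewrite tnth_subv.
Qed.

(** Product form of the integrand of <e_w, e_z>, which then splits into one ambiguity integral for
    each coordinate. *)
Lemma atomM_conj w z t : atom w t * conjc (atom z t) =
  \prod_(i < d) (cexpi (2 * pi * (tnth w.2 i - tnth z.2 i) * tnth t i) *
     (g1 (tnth t i - tnth w.1 i) * g1 (tnth t i - tnth z.1 i))%:C%C).
Proof.
have cprod (I : Type) (r : seq I) (F : I -> R[i]) :
    conjc (\prod_(i <- r) F i) = \prod_(i <- r) conjc (F i).
  elim: r => [|i r IH]; first by rewrite !big_nil; apply: complex_ext => //=; rewrite oppr0.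
  by rewrite !big_cons conjcM IH.
rewrite !atom_prod cprod -big_split; apply: eq_bigr => i _.
rewrite -[LHS]/(_ * _) conjcM conjc_cexpi conjc_realc realcM mulrACA -cexpiD.
by congr (cexpi _ * _); ring.
Qed.

Lemma cinteg_atomM w z : cinteg mu (fun t => atom w t * conjc (atom z t)).
Proof.
under eq_fun do rewrite atomM_conj.
by have [] := @cint_vec_prod R d (fun (i : 'I_d) (t : R) =>
  (cexpi (2 * pi * (tnth w.2 i - tnth z.2 i) * t) *
     (g1 (t - tnth w.1 i) * g1 (t - tnth z.1 i))%:C%C))
  (fun i => cinteg_ambiguity _ _ _).
Qed.

Lemma normp_sqr z : normp z ^+ 2 = dotv z.1 z.1 + dotv z.2 z.2.
Proof.
rewrite sqr_sqrtr// addr_ge0//.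
  by apply: sumr_ge0 => i _; rewrite -expr2 sqr_ge0.
by apply: sumr_ge0 => i _; rewrite -expr2 sqr_ge0.
Qed.

Lemma normc_inner_atom w z :
  normc (inner (atom w) (atom z)) = expR (- (pi / 2 * normp (subp w z) ^+ 2)).
Proof.
rewrite innerE (eq_cint _ (atomM_conj w z)).
have [_ ->] := @cint_vec_prod R d (fun (i : 'I_d) (t : R) =>
  (cexpi (2 * pi * (tnth w.2 i - tnth z.2 i) * t) *
     (g1 (t - tnth w.1 i) * g1 (t - tnth z.1 i))%:C%C))
  (fun i => cinteg_ambiguity _ _ _).
rewrite normc_prod (eq_bigr _ (fun i _ => normc_ambiguity _ _ _)) big_split /=.
rewrite (eq_bigr (fun i => gauss (1 / 2) (tnth (subv w.1 z.1) i))); last first.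
  by move=> i _; rewrite tnth_subv.
rewrite [X in _ * X](eq_bigr (fun i => gauss (1 / 2) (tnth (subv w.2 z.2) i))); last first.
  by move=> i _; rewrite tnth_subv.
rewrite -!/(gaussv _ _) !gaussvE -expRD normp_sqr /=; congr expR.
by move: (pi : R) => p; field.
Qed.

Lemma L2_atom w : L2 (atom w).
Proof.
apply/L2P; split; first exact: cmeas_atom1.
have := cinteg_lty (cinteg_atomM w w).
by under eq_integral do rewrite normcM normc_conj -expr2.
Qed.

Lemma n2_atom w : n2 (atom w) = 1.
Proof.
have := normc_inner_atom w w; rewrite inner_self normc_real ger0_norm ?sqr_ge0//.
have -> : normp (subp w w) ^+ 2 = 0.
  rewrite normp_sqr /dotv !big1 ?addr0// => i _ /=; by rewrite tnth_subv subrr mul0r.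
rewrite mulr0 oppr0 expR0 => /eqP; rewrite sqrp_eq1 ?n2_ge0//.
by move/eqP.
Qed.

Lemma cmeas_stft (f : cfun R d) : cmeas f -> cmeas (stft f).
Proof.
move=> mf; apply: (@cmeas_cint_section _ _ _ _ _ mu
  (fun p : phase R d * Rvec R d => f p.2 * conjc (atom p.1 p.2))).
by apply: cmeasM; [exact: (cmeas_comp mf measurable_snd)|exact/cmeas_conj/cmeas_atom].
Qed.

End gauss_vec.
(** * Inversion of the short-time Fourier transform *)

Section bump.
Context {R : realType}.
Local Notation leb := (@lebesgue_measure R).
Implicit Types a t u : R.

(* The one-dimensional kernel integrated over ]l, r]: a smoothing of the indicator of ]l, r]. *)
Definition bump a (l r : R) u : R :=
  \int[leb]_t (\1_`]l, r]%classic t * (Num.sqrt a * gauss (a + 1 / 2) (t - u))).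

Let kernel a u t : R := Num.sqrt a * gauss (a + 1 / 2) (t - u).

Let kernel_ge0 a u t : 0 <= kernel a u t.
Proof. by rewrite mulr_ge0 ?sqrtr_ge0 ?gauss_ge0. Qed.

Let integrable_kernel a u : 0 < a -> leb.-integrable setT (fun t => (kernel a u t)%:E).
Proof.
move=> a0; have a1 : 0 < a + 1 / 2 by rewrite addr_gt0// divr_gt0.
have h := integrable_translation u (integrable_gauss a1).
exact: (integrableZl measurableT (Num.sqrt a) h).
Qed.

Lemma measurable_indic_itv (l r : R) :
  measurable_fun setT (\1_`]l, r]%classic : measurableTypeR R -> measurableTypeR R).
Proof. by apply: measurable_indic; exact: measurable_itv. Qed.

Lemma indic_le1 (T : Type) (A : set T) (t : T) : \1_A t <= 1 :> R.
Proof. by rewrite indicE; case: (_ \in _). Qed.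

Lemma indic_ge0 (T : Type) (A : set T) (t : T) : 0 <= \1_A t :> R.
Proof. by rewrite indicE; case: (_ \in _). Qed.

Lemma integrable_bump a l r u : 0 < a -> leb.-integrable setT
  (fun t => (\1_`]l, r]%classic t * (Num.sqrt a * gauss (a + 1 / 2) (t - u)))%:E).
Proof.
move=> a0; have ik := integrable_kernel u a0.
apply: (le_integrable measurableT _ _ ik).
- apply/measurable_EFinP; apply: measurable_funM; first exact: measurable_indic_itv.
  by apply/measurable_EFinP; exact: measurable_int ik.
- move=> t _; rewrite /= lee_fin normrM -[leRHS]mul1r ler_wpM2r//.
  by rewrite ger0_norm ?indic_le1 ?indic_ge0.
Qed.

Lemma bump_ge0 a l r u : 0 <= bump a l r u.
Proof. by apply: Rintegral_ge0 => t _; rewrite mulr_ge0 ?indic_ge0 ?kernel_ge0. Qed.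

(** Uniformity in a is the point, since this dominates the passage to the limit. Factor
    [gauss (a + 1 / 2)] as [gauss (1 / 2)] times [gauss a]: the second, with sqrt a, has mass one.
    For t in ]l, r] the first is at most the stated bound because t^2 <= (|l| + |r|)^2 and (t -
    u/2)^2 >= 0. *)
Lemma bump_le a l r u : 0 < a ->
  bump a l r u <= expR (pi * (`|l| + `|r|) ^+ 2 / 2) * gauss (1 / 4) u.
Proof.
move=> a0; set M := `|l| + `|r|; set C := _ * gauss _ u.
have C0 : 0 <= C by rewrite mulr_ge0 ?expR_ge0 ?gauss_ge0.
have sa : Num.sqrt a != 0 by rewrite sqrtr_eq0 -ltNge.
have h := integrable_translation u (integrable_gauss a0).
have -> : C = \int[leb]_t ((C * Num.sqrt a) * gauss a (t - u)).
  rewrite RintegralZl// Rintegral_translation ?integrable_gauss// Rintegral_gauss//.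
  by rewrite -mulrA mulfV// mulr1.
apply: le_Rintegral => //.
- exact: integrable_bump.
- exact: (integrableZl measurableT (C * Num.sqrt a) h).
move=> t _; rewrite indicE; have [|_] := boolP (t \in `]l, r]%classic); last first.
  rewrite mul0r; apply: mulr_ge0; last exact: gauss_ge0.
  by apply: mulr_ge0 => //; exact: sqrtr_ge0.
rewrite inE /= in_itv /= => /andP[lt tr]; rewrite [leLHS]mul1r.
rewrite (mulrC C) -[leRHS]mulrA ler_wpM2l ?sqrtr_ge0//.
have -> : gauss (a + 1 / 2) (t - u) = gauss (1 / 2) (t - u) * gauss a (t - u).
  by rewrite /gauss -expRD; congr expR; ring.
rewrite ler_wpM2r ?gauss_ge0// /C /gauss -expRD ler_expR.
have tM : t ^+ 2 <= M ^+ 2.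
  rewrite -[t ^+ 2]real_normK ?num_real// ler_pXn2r ?nnegrE ?addr_ge0// /M.
  rewrite ler_norml; have := ler_norm r; have := ler_norm (- l); rewrite normrN.
  have := normr_ge0 r; have := normr_ge0 l => ? ? ? ?.
  by apply/andP; split; lra.
have := sqr_ge0 (t - u / 2); have := pi_ge0 R.
move: (pi : R) => p p0 hs.
rewrite -subr_ge0 (_ : _ - _ = p * ((M ^+ 2 - t ^+ 2) / 2 + (t - u / 2) ^+ 2)); last by field.
by rewrite mulr_ge0// addr_ge0// divr_ge0// subr_ge0.
Qed.

(** The kernel has mass sqrt(a / (a + 1/2)), so the difference is the kernel integrated against the
    change of the indicator, which lives on |t - u| >= del. There half of the exponent a gives the
    factor [gauss (a / 2) del]; the other half still integrates, with sqrt a, to sqrt 2. *)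
Lemma bump_dist a l r u del : 0 < a -> 0 <= del ->
  (forall t, \1_`]l, r]%classic t != \1_`]l, r]%classic u :> R -> del <= `|t - u|) ->
  `|bump a l r u - Num.sqrt (a / (a + 1 / 2)) * \1_`]l, r]%classic u|
    <= Num.sqrt 2 * gauss (a / 2) del.
Proof.
move=> a0 del0 far; have a1 : 0 < a + 1 / 2 by rewrite addr_gt0// divr_gt0.
have a2 : 0 < a / 2 by rewrite divr_gt0.
have hk := integrable_kernel u a0.
have hg := integrable_translation u (integrable_gauss a2).
have E : Num.sqrt (a / (a + 1 / 2)) * \1_`]l, r]%classic u =
    \int[leb]_t (\1_`]l, r]%classic u * kernel a u t).
  rewrite RintegralZl// mulrC /kernel RintegralZl ?integrable_translation ?integrable_gauss//.
  rewrite Rintegral_translation ?integrable_gauss// Rintegral_gauss//.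
  by rewrite sqrtrM ?sqrtrV// ltW.
have iu : leb.-integrable setT (fun t => (\1_`]l, r]%classic u * kernel a u t)%:E).
  exact: (integrableZl measurableT _ hk).
have ib := integrable_bump l r u a0.
rewrite E -RintegralB//.
have iB : leb.-integrable setT (fun t => (\1_`]l, r]%classic t * kernel a u t -
    \1_`]l, r]%classic u * kernel a u t)%:E).
  by under eq_fun do rewrite EFinB; exact: integrableB.
apply: (le_trans (le_normr_Rintegral measurableT iB)).
have -> : Num.sqrt 2 * gauss (a / 2) del =
    \int[leb]_t ((Num.sqrt a * gauss (a / 2) del) * gauss (a / 2) (t - u)).
  rewrite RintegralZl// Rintegral_translation ?integrable_gauss// Rintegral_gauss//.
  rewrite sqrtrM ?(ltW a0)// invfM mulrACA mulfV ?sqrtr_eq0 -?ltNge// mul1r.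
  by rewrite sqrtrV// invrK mulrC.
apply: le_Rintegral => //.
- exact: (@integrable_norm _ _ _ leb setT (fun t => \1_`]l, r]%classic t * kernel a u t -
    \1_`]l, r]%classic u * kernel a u t) iB).
- exact: (integrableZl measurableT _ hg).
move=> t _; rewrite -mulrBl normrM (ger0_norm (kernel_ge0 _ _ _)).
have [->|ne] := eqVneq (\1_`]l, r]%classic t : R) (\1_`]l, r]%classic u).
  by rewrite subrr normr0 mul0r !mulr_ge0 ?sqrtr_ge0 ?gauss_ge0.
apply: (@le_trans _ _ (1 * kernel a u t)).
  rewrite ler_wpM2r//.
  have := indic_le1 `]l, r]%classic t; have := indic_ge0 `]l, r]%classic t.
  have := indic_le1 `]l, r]%classic u; have := indic_ge0 `]l, r]%classic u.
  by move=> ? ? ? ?; rewrite ler_norml; apply/andP; split; lra.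
rewrite mul1r /kernel -mulrA ler_wpM2l ?sqrtr_ge0// /gauss -expRD ler_expR.
have dt : del ^+ 2 <= (t - u) ^+ 2.
  rewrite -[leRHS]real_normK ?num_real// ler_pXn2r ?nnegrE//; exact: far.
have := pi_ge0 R; move: (pi : R) => p p0.
rewrite -subr_ge0 (_ : _ - _ = p * (a / 2 * ((t - u) ^+ 2 - del ^+ 2) + (t - u) ^+ 2 / 2)); last by field.
rewrite mulr_ge0// addr_ge0//; last by rewrite divr_ge0// sqr_ge0.
by rewrite mulr_ge0 ?(ltW a2)// subr_ge0.
Qed.

(** Bounds the defect of the mass of the kernel from one; for s in [0, 1] one has 1 - s <= 1 -
    s^2. *)
Lemma sqrt_ratio_dist a : 0 < a -> `|Num.sqrt (a / (a + 1 / 2)) - 1| <= a^-1.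
Proof.
move=> a0; have a1 : 0 < a + 1 / 2 by rewrite addr_gt0// divr_gt0.
set q := a / _; set s := Num.sqrt q.
have q0 : 0 <= q by rewrite divr_ge0// ltW.
have q1 : q <= 1 by rewrite ler_pdivrMr// [leRHS]mul1r lerDl divr_ge0.
have s0 : 0 <= s by exact: sqrtr_ge0.
have s2 : s ^+ 2 = q by rewrite sqr_sqrtr.
have s1 : s <= 1 by nra.
rewrite ler0_norm ?subr_le0// opprB.
have : 1 - s <= 1 - q by nra.
move=> /le_trans; apply.
have -> : 1 - q = (1 / 2) / (a + 1 / 2).
  have N : a + 1 / 2 != 0 by rewrite gt_eqF.
  by rewrite /q -{1}(mulfV N) -mulrBl; congr (_ * _); ring.
rewrite ler_pdivrMr// mulrDr mulVf ?gt_eqF//.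
have : 0 <= a^-1 by rewrite invr_ge0 ltW.
by move=> ?; lra.
Qed.

Lemma gauss_le_inv a del : 0 < a -> 0 < del -> gauss (a / 2) del <= (a * del ^+ 2)^-1.
Proof.
move=> a0 d0; rewrite /gauss expRN lef_pV2 ?posrE ?expR_gt0 ?mulr_gt0 ?exprn_gt0//.
have h : 1 + pi * (a / 2) * del ^+ 2 <= expR (pi * (a / 2) * del ^+ 2) by exact: expR_ge1Dx.
apply: le_trans h; have := pi_ge2 R; have : 0 < a * del ^+ 2 by rewrite mulr_gt0 ?exprn_gt0.
move: (pi : R) => p; rewrite (_ : p * (a / 2) * del ^+ 2 = p / 2 * (a * del ^+ 2)); last by field.
by move: (a * del ^+ 2) => y; nra.
Qed.

Lemma cvg_bump l r u : u != l -> u != r ->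
  (fun n => bump n.+1%:R l r u) @ \oo --> (\1_`]l, r]%classic u : R).
Proof.
move=> ul ur.
(* A point closer to u than both endpoints lies on the same side of each of them as u does. *)
pose del := Num.min `|u - l| `|u - r|.
have del0 : 0 < del by rewrite lt_min !normr_gt0 !subr_eq0 ul ur.
have far t : \1_`]l, r]%classic t != \1_`]l, r]%classic u :> R -> del <= `|t - u|.
  move=> ne.
  have tu : t != u by apply: contraNneq ne => ->.
  rewrite ge_min.
  move: ne; rewrite !indicE !mem_setE !in_itv /=.
  case: (ltP l t) => h1; case: (leP t r) => h2; case: (ltP l u) => h3; case: (leP u r) => h4 //=;
  rewrite ?eqxx// => _; apply/orP;
  (try by left; rewrite ler_normr; do 2 (case: ler0P => ?; try lra));
  (try by right; do 2 (case: ler0P => ?; try lra)).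
apply/cvgrPdist_le => e e0.
(* Both errors are of order 1/n: sqrt 2 / del^2 comes from the points far from u, and 1 from the
   mass of the kernel. *)
pose N := (Num.sqrt 2 / del ^+ 2 + 1 : R).
have N0 : 0 < N by rewrite addr_gt0 // divr_gt0 ?exprn_gt0// sqrtr_gt0.
near=> n.
have n0 : 0 < n.+1%:R :> R by [].
have h := bump_dist n0 (ltW del0) far.
have h2 := sqrt_ratio_dist n0; have h3 := gauss_le_inv n0 del0.
have h4 : N / n.+1%:R <= e.
  rewrite ler_pdivrMr// mulrC -ler_pdivrMr//.
  apply: (@le_trans _ _ n%:R); last by rewrite ler_nat.
  by near: n; exact: nbhs_infty_ger.
have h5 (I : R) : 0 <= I <= 1 ->
    `|I - Num.sqrt (n.+1%:R / (n.+1%:R + 1 / 2)) * I| <= n.+1%:R^-1.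
  move=> /andP[I0 I1]; rewrite -{1}[I]mul1r -mulrBl normrM distrC.
  by rewrite -[leRHS]mulr1 ler_pM// ger0_norm.
rewrite distrC in h; apply: le_trans h4.
set B := bump _ _ _ _ in h *; have {}h5 := h5 (\1_`]l, r]%classic u) _; rewrite indic_ge0 indic_le1 in h5.
have {h5} := h5 isT.
move: (\1_`]l, r]%classic u : R) h => I; set Q := Num.sqrt (n.+1%:R / _) * I => h h5.
rewrite -(subrKA Q) (le_trans (ler_normD _ _))//.
rewrite /N mulrDl mul1r addrC lerD//.
apply: (le_trans h); rewrite -mulrA ler_wpM2l ?sqrtr_ge0//.
by rewrite (le_trans h3)// invfM mulrC.
Unshelve. all: by end_near.
Qed.

End bump.
Section phase_measure.
Context {R : realType} {d : nat}.
Local Notation mu := (lebesgue_vec R d).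
Local Open Scope ereal_scope.

(* A copy of lebesgue_phase carrying the sigma-finite instance needed for Fubini's theorem. *)
Definition phase_measure : set (phase R d) -> \bar R := mu \x mu.

HB.instance Definition _ := Measure.copy phase_measure (@lebesgue_phase R d).

Let phase_sigma_finite : sigma_finite setT phase_measure.
Proof.
have /sigma_finiteP[F [TF ndF Foo]] := sigma_finiteT mu.
exists (fun n => F n `*` F n).
  rewrite -setXTT TF predeqE => -[x y]; split.
    move=> [/= [n _ Fnx] [k _ Fky]]; exists (maxn n k) => //; split.
    - by move: x Fnx; exact/subsetPset/ndF/leq_maxl.
    - by move: y Fky; exact/subsetPset/ndF/leq_maxr.
  by move=> [n _ []/= ? ?]; split; exists n.
move=> k; have [? ?] := Foo k; split; first exact: measurableX.
by rewrite /phase_measure product_measure1E// lte_mul_pinfty// ge0_fin_numE.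
Qed.

HB.instance Definition _ := Measure_isSigmaFinite.Build _ _ _ phase_measure
  phase_sigma_finite.

End phase_measure.
Arguments phase_measure : clear implicits.

(** * The reconstruction formula *)

Section inversion.
Context {R : realType} {d : nat}.
Local Notation leb := (@lebesgue_measure R).
Local Notation mu := (lebesgue_vec R d).
Local Notation ph := (phase_measure R d).
Implicit Types (f h : cfun R d) (t u : Rvec R d) (w z : phase R d).

(** Closed form of the damped integral of e_w(t) times the conjugate of e_w(u) over phase space. The
    position integral contributes [gauss (1 / 2)] and the frequency integral sqrt a times [gauss a],
    whence the exponent a + 1/2. *)
Definition kernelv (a : R) t u : R :=
  \prod_(i < d) (Num.sqrt a * gauss (a + 1 / 2) (tnth t i - tnth u i)).

Lemma kernelv_ge0 a t u : 0 <= kernelv a t u.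
Proof. by apply: prodr_ge0 => i _; rewrite mulr_ge0 ?sqrtr_ge0 ?gauss_ge0. Qed.

Lemma measurable_kernelv d' (T : measurableType d') (a : R) (p q : T -> Rvec R d) :
  measurable_fun setT p -> measurable_fun setT q ->
  measurable_fun setT (fun x => kernelv a (p x) (q x) : measurableTypeR R).
Proof.
move=> mp mq; rewrite (_ : (fun x => _) =
   fun x => Num.sqrt a ^+ d * gaussv (a + 1 / 2) (subv (p x) (q x))).
  apply: measurable_funM; first exact: measurable_cst.
  exact: (measurableT_comp (measurable_gaussv _) (measurable_subv2 mp mq)).
apply/funext => x; rewrite /kernelv big_split /= prodr_const card_ord; congr (_ * _).
by apply: eq_bigr => i _; rewrite tnth_subv.
Qed.

Lemma cint_ge0E d' (T : measurableType d') (m : {measure set T -> \bar R}) (r : T -> R) :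
  cinteg m (fun x => (r x)%:C%C) -> (forall x, 0 <= r x) ->
  (\int[m]_x (r x)%:E = (complex.Re (cint m (fun x => (r x)%:C%C)))%:E)%E.
Proof.
by move=> [ri _] r0; rewrite /= /Rintegral fineK//; exact: integrable_fin_num.
Qed.

Let overlap t u x : R := G0 (subv t x) * G0 (subv u x).

Let overlap_prod t u x :
  (overlap t u x)%:C%C =
  \prod_(i < d) (g1 (tnth x i - tnth t i) * g1 (tnth x i - tnth u i))%:C%C :> R[i].
Proof.
rewrite -realc_prod; congr (_%:C)%C; rewrite /overlap /G0 -big_split /=.
by apply: eq_bigr => i _; rewrite !tnth_subv -g1N opprB -[X in _ * X]g1N opprB.
Qed.

Let cint_overlap t u : cinteg mu (fun x => (overlap t u x)%:C%C) /\
  cint mu (fun x => (overlap t u x)%:C%C) = (gaussv (1 / 2) (subv t u))%:C%C.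
Proof.
have [h1 h2] := @cint_vec_prod R d (fun (i : 'I_d) (x : R) =>
   (g1 (x - tnth t i) * g1 (x - tnth u i))%:C%C)
   (fun i => cinteg_real (integrable_g1M _ _)).
split; first by under eq_fun do rewrite overlap_prod.
rewrite (eq_cint _ (overlap_prod t u)) h2 /gaussv realc_prod; apply: eq_bigr => i _.
by rewrite cint_real Rintegral_g1M tnth_subv.
Qed.

Let wave a (y : Rvec R d) (xi : Rvec R d) : R[i] :=
  cexpi (2 * pi * dotv xi y) * (gaussv a^-1 xi)%:C%C.

Let cint_wave a y : 0 < a -> cinteg mu (wave a y) /\
  cint mu (wave a y) = (\prod_(i < d) (Num.sqrt a * gauss a (tnth y i)))%:C%C.
Proof.
move=> a0.
have [h1 h2] := @cint_vec_prod R d (fun (i : 'I_d) (x : R) =>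
   cexpi (2 * pi * x * tnth y i) * (gauss a^-1 x)%:C%C)
   (fun i => cinteg_cutoff _ a0).
have E xi : wave a y xi = \prod_(i < d)
    (cexpi (2 * pi * tnth xi i * tnth y i) * (gauss a^-1 (tnth xi i))%:C%C).
  rewrite /wave big_split /= -cexpi_sum /gaussv realc_prod; congr (cexpi _ * _).
  by rewrite /dotv mulr_sumr; apply: eq_bigr => i _; rewrite mulrA.
split; first by rewrite (funext E).
rewrite (eq_cint _ E) h2 realc_prod; apply: eq_bigr => i _.
exact: cint_cutoff.
Qed.

Let atom_atom a t u w : (gaussv a^-1 w.2)%:C%C * atom w t * conjc (atom w u) =
  (overlap t u w.1)%:C%C * wave a (subv t u) w.2.
Proof.
rewrite !atomE conjcM conjc_cexpi conjc_realc /overlap /wave realcM.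
have -> : cexpi (2 * pi * dotv w.2 (subv t u)) =
   cexpi (2 * pi * dotv w.2 t) * cexpi (- (2 * pi * dotv w.2 u)) :> R[i].
  rewrite -cexpiD; congr cexpi; rewrite -mulrBr; congr (_ * _).
  by rewrite /dotv -sumrB; apply: eq_bigr => i _; rewrite tnth_subv; ring.
by ring.
Qed.

(** The integrand is a function of position, [overlap], times a function of frequency, [wave], so
    the integral over phase space is the product of two known ones. *)
Lemma cint_atom_atom a t u : 0 < a ->
  cinteg ph (fun w => (gaussv a^-1 w.2)%:C%C * atom w t * conjc (atom w u)) /\
  cint ph (fun w => (gaussv a^-1 w.2)%:C%C * atom w t * conjc (atom w u)) =
    (kernelv a t u)%:C%C.
Proof.
move=> a0; have [q1 q2] := cint_overlap t u; have [v1 v2] := cint_wave (subv t u) a0.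
have [p1 p2] := cint_prod q1 v1.
split; first by under eq_fun do rewrite atom_atom.
rewrite (eq_cint _ (atom_atom a t u)) p2 q2 v2 -realcM; congr (_%:C)%C.
rewrite /gaussv /kernelv -big_split; apply: eq_bigr => i _.
rewrite tnth_subv -[LHS]/(_ * _) mulrCA; congr (_ * _).
by rewrite /gauss -expRD; congr expR; ring.
Qed.

Lemma int_normc_atom_atom a t u : 0 < a ->
  (\int[ph]_w (normc ((gaussv a^-1 w.2)%:C%C * atom w t * conjc (atom w u)))%:E =
   (gaussv (1 / 2) (subv t u) * Num.sqrt a ^+ d)%:E)%E.
Proof.
move=> a0; have [q1 q2] := cint_overlap t u.
(* At [y0] the wave loses its phase, so the modulus of the integrand is again an overlap times a
   wave and the preceding formulas evaluate its integral. *)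
pose y0 : Rvec R d := [tuple 0 | i < d].
have [v1 v2] := cint_wave y0 a0; have [p1 p2] := cint_prod q1 v1.
have w0 xi : wave a y0 xi = (gaussv a^-1 xi)%:C%C.
  rewrite /wave (_ : dotv _ _ = 0) ?mulr0 ?cexpi0 ?mul1r//.
  by rewrite /dotv big1// => i _; rewrite tnth_mktuple mulr0.
have E w : (overlap t u w.1)%:C%C * wave a y0 w.2 =
    (overlap t u w.1 * gaussv a^-1 w.2)%:C%C.
  by rewrite w0 realcM.
have N w : normc ((gaussv a^-1 w.2)%:C%C * atom w t * conjc (atom w u)) =
    overlap t u w.1 * gaussv a^-1 w.2.
  rewrite normcM normcM normc_conj !normc_atom normc_real ger0_norm ?gaussv_ge0//.
  by rewrite /overlap; ring.
under eq_integral do rewrite N.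
rewrite cint_ge0E; last 2 first.
- by under eq_fun do rewrite -E.
- by move=> w; rewrite !mulr_ge0 ?G0_ge0 ?gaussv_ge0.
congr EFin; rewrite -(eq_cint _ E) p2 q2 v2 -realcM /=; congr (_ * _).
rewrite (eq_bigr (fun=> Num.sqrt a)) ?prodr_const ?card_ord// => i _.
by rewrite tnth_mktuple /gauss expr0n mulr0 oppr0 expR0 mulr1.
Qed.

Lemma L2_gaussv (a : R) t : 0 < a -> L2 (fun u => (gaussv a (subv u t))%:C%C).
Proof.
move=> a0; have a20 : 0 < 2 * a by rewrite mulr_gt0.
have [i1 _] := @Rintegral_vec_prod R d (fun (i : 'I_d) (x : R) => gauss (2 * a) (x - tnth t i))
  (fun i => integrable_translation (tnth t i) (integrable_gauss a20)).
apply: (L2_le _ i1).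
  apply: cmeas_real; apply: (measurableT_comp (measurable_gaussv a)).
  exact: measurable_subv.
move=> u; rewrite normc_real ger0_norm ?gaussv_ge0// /gaussv -prodrXl.
rewrite le_eqVlt; apply/orP; left; apply/eqP; apply: eq_bigr => i _.
by rewrite tnth_subv /gauss expr2 -expRD; congr expR; ring.
Qed.

Lemma gaussvN a t u : gaussv a (subv t u) = gaussv a (subv u t).
Proof.
rewrite /gaussv; apply: eq_bigr => i _.
by rewrite !tnth_subv -gaussN opprB.
Qed.

(* V f(w) e_w is not jointly integrable with the integral defining V f, so the frequencies are
   first damped by the factor exp(-pi |w.2|^2 / a); the damped reconstruction is the integral of f
   against kernelv a, which becomes an approximate identity as a tends to infinity. *)
Lemma cutoff_reproducing f a t : L2 f -> 0 < a ->
  cint ph (fun w => (gaussv a^-1 w.2)%:C%C * stft f w * atom w t) =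
  cint mu (fun u => f u * (kernelv a t u)%:C%C).
Proof.
move=> Lf a0; have mf := L2_cmeas Lf.
pose F u w := f u * ((gaussv a^-1 w.2)%:C%C * atom w t * conjc (atom w u)).
have mF : cmeas (fun p : Rvec R d * phase R d => F p.1 p.2).
  apply: cmeasM; first exact: (cmeas_comp mf measurable_fst).
  apply: cmeasM; first apply: cmeasM.
  - apply: cmeas_real; apply: (measurableT_comp (measurable_gaussv a^-1)).
    exact: (measurableT_comp measurable_snd measurable_snd).
  - exact: (cmeas_comp (cmeas_atom2 t) measurable_snd).
  - apply: cmeas_conj.
    exact: (cmeas_comp cmeas_atom (@measurable_swap _ _ (Rvec R d) (phase R d))).
transitivity (cint ph (fun w => cint mu (F ^~ w))).
  apply: eq_cint => w; rewrite /F stftE innerE mulrAC -cintZ; last first.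
    by apply: cinteg_inner => //; exact: L2_atom.
  by apply: eq_cint => u; ring.
rewrite -(@cint_swap _ _ _ _ _ mu ph F mF).
  apply: eq_cint => u; have [h1 h2] := cint_atom_atom t u a0.
  by rewrite /F cintZ// h2.
under eq_integral => u _.
  under eq_integral do rewrite normcM EFinM.
  rewrite ge0_integralZl//; last 3 first.
  - by apply: emeas_normc; have [h1 _] := cint_atom_atom t u a0; exact: cinteg_cmeas h1.
  - by move=> w _; rewrite lee_fin normc_ge0.
  - by rewrite lee_fin normc_ge0.
  rewrite int_normc_atom_atom// -EFinM mulrA mulrC; over.
have Lg := L2_gaussv t (_ : 0 < 1 / 2).
have {}Lg : L2 (fun u => (gaussv (1 / 2) (subv u t))%:C%C) by apply: Lg; rewrite divr_gt0.
under eq_integral do rewrite EFinM.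
rewrite ge0_integralZl//.
- rewrite lte_mul_pinfty ?lee_fin ?exprn_ge0 ?sqrtr_ge0//.
  apply: le_lt_trans (ltry (n2 f * n2 (fun u => (gaussv (1 / 2) (subv u t))%:C%C))).
  apply: le_trans (int_normcM_le Lf Lg).
  rewrite le_eqVlt; apply/orP; left; apply/eqP; apply: eq_integral => u _.
  by rewrite normc_real ger0_norm ?gaussv_ge0// gaussvN.
- apply/measurable_EFinP; apply: measurable_funM; first exact: cmeas_normc.
  apply: (measurableT_comp (measurable_gaussv (1 / 2))).
  by apply: measurable_subv2 => //; exact: measurable_cst.
- by move=> u _; rewrite lee_fin mulr_ge0 ?normc_ge0 ?gaussv_ge0.
Qed.

Definition bumpv (a : R) (l r : 'I_d -> R) u : R :=
  \prod_(i < d) bump a (l i) (r i) (tnth u i).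

Lemma bumpv_ge0 a l r u : 0 <= bumpv a l r u.
Proof. by apply: prodr_ge0 => i _; exact: bump_ge0. Qed.

Lemma indic_box (l r : 'I_d -> R) t :
  \1_(box l r) t = \prod_(i < d) \1_`]l i, r i]%classic (tnth t i) :> R.
Proof.
have [tb|ntb] := pselect (box l r t).
  rewrite indicE mem_set// big1// => i _; rewrite indicE mem_set//= in_itv.
  exact: tb.
rewrite indicE memNset//; move/existsNP : ntb => [i /negP ti].
rewrite (bigD1 i)//= indicE memNset ?mul0r//= in_itv /=; exact/negP.
Qed.

Lemma Rintegral_box_kernelv a l r u : 0 < a ->
  mu.-integrable setT (fun t => (\1_(box l r) t * kernelv a t u)%:E) /\
  \int[mu]_t (\1_(box l r) t * kernelv a t u) = bumpv a l r u.
Proof.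
move=> a0.
have [h1 h2] := @Rintegral_vec_prod R d (fun (i : 'I_d) (t : R) =>
  \1_`]l i, r i]%classic t * (Num.sqrt a * gauss (a + 1 / 2) (t - tnth u i)))
  (fun i => integrable_bump (l i) (r i) (tnth u i) a0).
have E t : \1_(box l r) t * kernelv a t u = \prod_(i < d)
   (\1_`]l i, r i]%classic (tnth t i) * (Num.sqrt a * gauss (a + 1 / 2) (tnth t i - tnth u i))).
  by rewrite indic_box -big_split.
split; first by under eq_fun do rewrite E.
by under eq_Rintegral do rewrite E.
Qed.

Let boxC (l r : 'I_d -> R) : R :=
  \prod_(i < d) expR (pi * (`|l i| + `|r i|) ^+ 2 / 2).

Let boxC_ge0 l r : 0 <= boxC l r.
Proof. by apply: prodr_ge0 => i _; exact: expR_ge0. Qed.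

Lemma bumpv_le a l r u : 0 < a -> bumpv a l r u <= boxC l r * gaussv (1 / 4) u.
Proof.
move=> a0; rewrite /bumpv /boxC /gaussv -big_split.
by apply: ler_prod => i _; rewrite bump_ge0 /=; exact: bump_le.
Qed.

Let vec0 : Rvec R d := [tuple 0 | i < d].

Let subv0 u : subv u vec0 = u.
Proof. by apply: eq_from_tnth => i; rewrite !tnth_mktuple subr0. Qed.

Let L2_gaussv0 (a : R) : 0 < a -> L2 (fun u => (gaussv a u)%:C%C).
Proof. by move=> /(L2_gaussv vec0); under eq_fun do rewrite subv0. Qed.

Let integrable_dominant f l r : L2 f ->
  mu.-integrable setT (fun u => (boxC l r * (normc (f u) * gaussv (1 / 4) u))%:E).
Proof.
move=> Lf; have Lg : L2 (fun u => (gaussv (1 / 4) u)%:C%C) by apply: L2_gaussv0; rewrite divr_gt0.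
have ii : mu.-integrable setT (fun u => (normc (f u) * gaussv (1 / 4) u)%:E).
  apply: eq_integrable (cinteg_normc (cinteg_inner Lf Lg)) => // u _.
  by rewrite normcM normc_conj normc_real ger0_norm ?gaussv_ge0.
exact: (integrableZl measurableT _ ii).
Qed.

Lemma measurable_indic_box l r :
  measurable_fun setT (\1_(box l r) : Rvec R d -> measurableTypeR R).
Proof. by apply: measurable_indic; exact: measurable_box. Qed.

(** Fubini moves the kernel from f to the indicator of the box. Removing the cutoff then only
    requires the explicit functions [bumpv] to converge, with f a mere square-integrable factor. *)
Lemma box_test f a l r : L2 f -> 0 < a ->
  cint mu (fun t => (\1_(box l r) t)%:C%C * cint mu (fun u => f u * (kernelv a t u)%:C%C)) =
  cint mu (fun u => f u * (bumpv a l r u)%:C%C).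
Proof.
move=> Lf a0; have mf := L2_cmeas Lf.
pose F u t := f u * (\1_(box l r) t * kernelv a t u)%:C%C.
have mF : cmeas (fun p : Rvec R d * Rvec R d => F p.1 p.2).
  apply: cmeasM; first exact: (cmeas_comp mf measurable_fst).
  apply: cmeas_real; apply: measurable_funM.
    exact: (measurableT_comp (measurable_indic_box l r) measurable_snd).
  exact: measurable_kernelv.
transitivity (cint mu (fun t => cint mu (F ^~ t))).
  apply: eq_cint => t; rewrite -cintZ; last first.
    have Lk : L2 (fun u => (Num.sqrt a ^+ d)%:C%C * (gaussv (a + 1 / 2) (subv u t))%:C%C).
      by apply: L2Z; apply: L2_gaussv; rewrite addr_gt0// divr_gt0.
    have := cinteg_inner Lf Lk; congr (cinteg _ _); apply/funext => u.
    rewrite -realcM conjc_realc; congr (_ * _%:C)%C.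
    rewrite gaussvN /kernelv big_split /= prodr_const card_ord; congr (_ * _).
    by apply: eq_bigr => i _; rewrite tnth_subv.
  by apply: eq_cint => u; rewrite /F realcM; ring.
rewrite -cint_swap//.
  apply: eq_cint => u; have [h1 h2] := Rintegral_box_kernelv l r u a0.
  by rewrite /F cintZ ?cint_real ?h2//; exact: cinteg_real.
under eq_integral => u _.
  under eq_integral => t _.
    rewrite normcM normc_real ger0_norm ?mulr_ge0 ?indic_ge0 ?kernelv_ge0// EFinM; over.
  have [h1 h2] := Rintegral_box_kernelv l r u a0.
  rewrite ge0_integralZl//; last 3 first.
  - exact: measurable_int h1.
  - by move=> t _; rewrite lee_fin mulr_ge0 ?indic_ge0 ?kernelv_ge0.
  - by rewrite lee_fin normc_ge0.
  rewrite -[X in (_ * X)%E]fineK; last exact: integrable_fin_num.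
  rewrite -/(Rintegral mu setT _) h2 -EFinM; over.
have /integrableP[md doo] := integrable_dominant l r Lf.
apply: le_lt_trans doo; apply: ge0_le_integral => //.
- by move=> u _; rewrite lee_fin mulr_ge0 ?normc_ge0 ?bumpv_ge0.
- apply/measurable_EFinP; apply: measurable_funM; first exact: cmeas_normc.
  rewrite (_ : bumpv a l r = fun u => \int[mu]_t (\1_(box l r) t * kernelv a t u)); last first.
    by apply/funext => u; have [_ ->] := Rintegral_box_kernelv l r u a0.
  apply: (@measurable_Rintegral_F _ _ _ _ _ mu
    (fun p : Rvec R d * Rvec R d => \1_(box l r) p.2 * kernelv a p.2 p.1)).
  apply: measurable_funM; last exact: measurable_kernelv.
  exact: (measurableT_comp (measurable_indic_box l r) measurable_snd).
- exact: measurableT_comp.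
- move=> u _; rewrite /= lee_fin ger0_norm; last first.
    by apply: mulr_ge0; [exact: boxC_ge0|apply: mulr_ge0; [exact: normc_ge0|exact: gaussv_ge0]].
  by rewrite mulrCA ler_wpM2l ?normc_ge0 ?bumpv_le.
Qed.

Lemma cvg_prod (I : Type) (s : seq I) (v : I -> nat -> R) (l : I -> R) :
  (forall i, v i n @[n --> \oo] --> l i) ->
  (fun n => \prod_(i <- s) v i n) @ \oo --> (\prod_(i <- s) l i : R).
Proof.
move=> vl; elim: s => [|i s IH].
  by under eq_fun do rewrite big_nil; rewrite big_nil; exact: cvg_cst.
by under eq_fun do rewrite big_cons; rewrite big_cons; exact: cvgM.
Qed.

Lemma cvg_bumpv l r : {ae mu, forall u,
  (fun n => bumpv n.+1%:R l r u) @ \oo --> (\1_(box l r) u : R)}.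
Proof.
have aeall (c : 'I_d -> R) : {ae mu, forall u, forall i, tnth u i != c i}.
  by apply: filter_forall => i; exact: negligible_coord.
apply: filterS2 (aeall l) (aeall r) => u ul ur.
by rewrite indic_box; apply: cvg_prod => i; exact: cvg_bump.
Qed.

Definition resynthesis f : cfun R d :=
  fun t => cint ph (fun w => stft f w * atom w t).

Section inversion_of_one_function.
Variable f : cfun R d.
Hypotheses (Lf : L2 f) (Vf : (\int[ph]_w (normc (stft f w))%:E < +oo)%E).

Let mV : cmeas (stft f). Proof. exact/cmeas_stft/L2_cmeas. Qed.

Let iV : ph.-integrable setT (fun w => (normc (stft f w))%:E).
Proof.
apply/integrableP; split; first exact: emeas_normc.
by under eq_integral do rewrite /= ger0_norm ?normc_ge0//.
Qed.

Let cG : R := 2 `^ (d%:R / 4).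

Let iD : ph.-integrable setT (fun w => (cG * normc (stft f w))%:E).
Proof. exact: (integrableZl measurableT _ iV). Qed.

Let bound n t w : normc ((gaussv n.+1%:R^-1 w.2)%:C%C * stft f w * atom w t)
  <= cG * normc (stft f w).
Proof.
rewrite normcM normcM normc_real ger0_norm ?gaussv_ge0// mulrC; apply: ler_pM.
- exact: normc_ge0.
- by rewrite mulr_ge0 ?gaussv_ge0 ?normc_ge0.
- by rewrite normc_atom G0_le.
- by rewrite -[leRHS]mul1r ler_wpM2r ?normc_ge0// gaussv_le1 // invr_ge0.
Qed.

Let meas_cutoff n t : cmeas (fun w => (gaussv n.+1%:R^-1 w.2)%:C%C * stft f w * atom w t).
Proof.
apply: cmeasM; last exact: cmeas_atom2.
apply: cmeasM => //; apply: cmeas_real.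
exact: (measurableT_comp (measurable_gaussv _) measurable_snd).
Qed.

Lemma cinteg_resynthesis t : cinteg ph (fun w => stft f w * atom w t).
Proof.
apply: (cinteg_le _ iD); first by apply: cmeasM => //; exact: cmeas_atom2.
by move=> w; rewrite normcM mulrC ler_wpM2r ?normc_ge0// normc_atom G0_le.
Qed.

Lemma cmeas_resynthesis : cmeas (resynthesis f).
Proof.
rewrite /resynthesis; apply: (@cmeas_cint_section _ _ _ _ _ ph
  (fun p : Rvec R d * phase R d => stft f p.2 * atom p.2 p.1)).
apply: cmeasM; first exact: (cmeas_comp mV measurable_snd).
exact: (cmeas_comp cmeas_atom (@measurable_swap _ _ (Rvec R d) (phase R d))).
Qed.

Let N1 := fine (\int[ph]_w (cG * normc (stft f w))%:E).

Let cutoff_bound n t :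
  normc (cint ph (fun w => (gaussv n.+1%:R^-1 w.2)%:C%C * stft f w * atom w t)) <= N1.
Proof.
have ci : cinteg ph (fun w => (gaussv n.+1%:R^-1 w.2)%:C%C * stft f w * atom w t).
  exact: (cinteg_le (meas_cutoff n t) iD (bound n t)).
apply: (le_trans (normc_cint ci)).
apply: (@le_Rintegral _ _ _ ph setT) => //; exact: cinteg_normc.
Qed.

Lemma normc_resynthesis t : normc (resynthesis f t) <= N1.
Proof.
apply: (le_trans (normc_cint (cinteg_resynthesis t))).
apply: (@le_Rintegral _ _ _ ph setT) => //; first exact/cinteg_normc/cinteg_resynthesis.
by move=> w _; rewrite normcM mulrC ler_wpM2r ?normc_ge0// normc_atom G0_le.
Qed.

(** Here integrability of V f enters: [cG * normc (stft f w)] dominates all the damped integrands,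
    and the damping factor tends to 1 pointwise. *)
Let cutoff_cvg t :
  (fun n => normc (cint ph (fun w => (gaussv n.+1%:R^-1 w.2)%:C%C * stft f w * atom w t)
     - resynthesis f t)) @ \oo --> (0 : R).
Proof.
have [] := @cint_dominated_cvg _ _ _ ph
  (fun n w => (gaussv n.+1%:R^-1 w.2)%:C%C * stft f w * atom w t)
  (fun w => stft f w * atom w t) (fun w => cG * normc (stft f w)) (meas_cutoff ^~ t).
- by apply: cmeasM => //; exact: cmeas_atom2.
- apply: aeW => w.
  have gn : (fun n => gaussv n.+1%:R^-1 w.2) @ \oo --> (1 : R).
    rewrite (_ : (fun n => _) = (fun n => expR (- (pi * dotv w.2 w.2 * n.+1%:R^-1)))); last first.
      by apply/funext => n; rewrite gaussvE mulrAC.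
    have e0 : expR 0 = 1 :> R by rewrite expR0.
    rewrite -[X in _ --> X]e0; apply: continuous_cvg; first exact: continuous_expR.
    rewrite -[X in _ --> X]oppr0; apply: cvgN.
    rewrite -[X in _ --> X](mulr0 (pi * dotv w.2 w.2)); apply: cvgMr.
    exact: cvg_harmonic.
  rewrite (_ : (fun n => _) = (fun n => `|gaussv n.+1%:R^-1 w.2 - 1| * normc (stft f w * atom w t))).
    rewrite -[X in _ --> X](mul0r (normc (stft f w * atom w t))); apply: cvgMl.
    by rewrite -(normr0 R) -(subrr (1 : R)); apply: cvg_norm; apply: cvgB => //; exact: cvg_cst.
  apply/funext => n; rewrite -normc_real -normcM; congr normc.
  have -> : (gaussv n.+1%:R^-1 w.2 - 1)%:C%C = (gaussv n.+1%:R^-1 w.2)%:C%C - 1 :> R[i].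
    by apply: complex_ext => //=; rewrite subr0.
  by ring.
- exact: iD.
- by apply: aeW => w n; exact: bound.
by [].
Qed.

Let integrable_box l r (C : R) : mu.-integrable setT (fun t => (C * \1_(box l r) t)%:E).
Proof.
have h : mu.-integrable setT (fun t => (\1_(box l r) t)%:E).
  have [] := @Rintegral_vec_prod R d (fun (i : 'I_d) => \1_`]l i, r i]%classic).
    move=> i; apply/integrableP; split.
      by apply/measurable_EFinP; exact: measurable_indic_itv.
    under eq_integral do rewrite /= ger0_norm ?indic_ge0//.
    rewrite integral_indic ?setIT; [|exact: measurableT|exact: measurable_itv].
      by rewrite /= lebesgue_measure_itv /=; case: ifP => _; rewrite ?ltry// -EFinD ltry.
  by move=> h _; apply: eq_integrable h => // t _; rewrite indic_box.
exact: (integrableZl measurableT C h).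
Qed.

(** The damped reconstructions integrated over the box have two limits. Directly they tend to the
    left-hand side, under the uniform bound [N1]; rewritten by [cutoff_reproducing] and [box_test]
    they tend to the right-hand side, by convergence of the bumps. *)
Let resynthesis_box l r :
  cint mu (fun t => (\1_(box l r) t)%:C%C * resynthesis f t) =
  cint mu (fun t => (\1_(box l r) t)%:C%C * f t).
Proof.
have mB : cmeas (fun t => (\1_(box l r) t)%:C%C : R[i]).
  by apply: cmeas_real; exact: measurable_indic_box.
pose G n t := cint ph (fun w => (gaussv n.+1%:R^-1 w.2)%:C%C * stft f w * atom w t).
have mG n : cmeas (G n).
  apply: (@cmeas_cint_section _ _ _ _ _ ph
    (fun p : Rvec R d * phase R d => (gaussv n.+1%:R^-1 p.2.2)%:C%C * stft f p.2 * atom p.2 p.1)).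
  apply: cmeasM; last exact: (cmeas_comp cmeas_atom (@measurable_swap _ _ (Rvec R d) (phase R d))).
  apply: cmeasM; last exact: (cmeas_comp mV measurable_snd).
  apply: cmeas_real; apply: (measurableT_comp (measurable_gaussv _)).
  exact: (measurableT_comp measurable_snd measurable_snd).
have mf := L2_cmeas Lf.
have p1 : {ae mu, forall t, (fun n => normc ((\1_(box l r) t)%:C%C * G n t -
    (\1_(box l r) t)%:C%C * resynthesis f t)) @ \oo --> (0 : R)}.
  apply: aeW => t.
  under eq_fun do rewrite -mulrBr normcM.
  by rewrite -(mulr0 (normc (\1_(box l r) t)%:C%C)); apply: cvgMr; exact: cutoff_cvg.
have b1 : {ae mu, forall t, forall n, normc ((\1_(box l r) t)%:C%C * G n t) <= N1 * \1_(box l r) t}.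
  apply: aeW => t n; rewrite normcM normc_real ger0_norm ?indic_ge0// mulrC.
  by rewrite ler_wpM2r ?indic_ge0//; exact: cutoff_bound.
have [_ c1] := cint_dominated_cvg (fun n => cmeasM mB (mG n)) (cmeasM mB cmeas_resynthesis)
  p1 (integrable_box l r N1) b1.
have mb n : cmeas (fun t => (bumpv n.+1%:R l r t)%:C%C : R[i]).
  have n0 : 0 < n.+1%:R :> R by [].
  apply: cmeas_real.
  rewrite (_ : bumpv _ l r = fun u => \int[mu]_t (\1_(box l r) t * kernelv n.+1%:R t u)); last first.
    by apply/funext => u; have [_ ->] := Rintegral_box_kernelv l r u n0.
  apply: (@measurable_Rintegral_F _ _ _ _ _ mu
    (fun p : Rvec R d * Rvec R d => \1_(box l r) p.2 * kernelv n.+1%:R p.2 p.1)).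
  apply: measurable_funM; last exact: measurable_kernelv.
  exact: (measurableT_comp (measurable_indic_box l r) measurable_snd).
have p2 : {ae mu, forall t, (fun n => normc (f t * (bumpv n.+1%:R l r t)%:C%C -
    f t * (\1_(box l r) t)%:C%C)) @ \oo --> (0 : R)}.
  apply: filterS (cvg_bumpv l r) => t ct.
  rewrite (_ : (fun n => _) = (fun n => normc (f t) * `|bumpv n.+1%:R l r t - \1_(box l r) t|)).
    rewrite -[X in _ --> X](mulr0 (normc (f t))); apply: cvgMr.
    rewrite -[X in _ --> X](normr0 R) -(subrr (\1_(box l r) t : R)); apply: cvg_norm.
    by apply: cvgB => //; exact: cvg_cst.
  apply/funext => n; rewrite -mulrBr normcM -normc_real; congr (_ * normc _).
  by apply: complex_ext => //=; rewrite subr0.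
have b2 : {ae mu, forall t, forall n, normc (f t * (bumpv n.+1%:R l r t)%:C%C) <=
    boxC l r * (normc (f t) * gaussv (1 / 4) t)}.
  apply: aeW => t n; rewrite normcM normc_real ger0_norm ?bumpv_ge0// mulrCA.
  by rewrite ler_wpM2l ?normc_ge0// bumpv_le.
have [_ c2] := cint_dominated_cvg (fun n => cmeasM mf (mb n)) (cmeasM mf mB)
  p2 (integrable_dominant l r Lf) b2.
have E n : cint mu (fun t => (\1_(box l r) t)%:C%C * G n t) =
    cint mu (fun t => f t * (bumpv n.+1%:R l r t)%:C%C).
  rewrite -box_test//; apply: eq_cint => t; rewrite /G.
  by rewrite cutoff_reproducing.
set A := cint mu _; set B := cint mu _.
have BE : B = cint mu (fun t => f t * (\1_(box l r) t)%:C%C).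
  by apply: eq_cint => t; rewrite mulrC.
apply/eqP; rewrite -subr_eq0; apply/eqP/eq0_normc.
(* The constant |A - B| is squeezed between 0 and the sum of the distances of the common sequence to
   A and to B. *)
have h : (fun=> normc (A - B)) @ \oo --> (0 : R).
  apply: (@squeeze_cvgr _ _ _ _ (fun=> 0) (fun n => normc (cint mu (fun t => (\1_(box l r) t)%:C%C * G n t) - A)
    + normc (cint mu (fun t => f t * (bumpv n.+1%:R l r t)%:C%C) - B))).
  - apply: nearW => n; rewrite normc_ge0 andTb E (normcB _ A).
    by apply: le_trans (le_normcD _ _); rewrite addrA subrK.
  - exact: cvg_cst.
  - by rewrite -[X in _ --> X](addr0 (0 : R)); apply: cvgD; [exact: c1|rewrite BE; exact: c2].
by apply: (cvg_unique _ _ h) => //; exact: cvg_cst.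
Qed.

(** The factor [e] lets one real statement serve both components: e = 1 gives the real part, and e =
    i gives minus the imaginary part. *)
Let resynthesis_boxes (e : R[i]) l r : (\int[mu]_(t in box l r)
    (complex.Re (e * (resynthesis f t - f t)))%:E = 0)%E /\
  mu.-integrable (box l r) (fun t => (complex.Re (e * (resynthesis f t - f t)))%:E).
Proof.
have mB : cmeas (fun t => (\1_(box l r) t)%:C%C : R[i]).
  by apply: cmeas_real; exact: measurable_indic_box.
have iB : cinteg mu (fun t => (\1_(box l r) t)%:C%C * resynthesis f t).
  apply: (cinteg_le _ (integrable_box l r N1)).
    by apply: (cmeasM mB); exact: cmeas_resynthesis.
  move=> t; rewrite normcM normc_real ger0_norm ?indic_ge0// mulrC.
  by rewrite ler_wpM2r ?indic_ge0// normc_resynthesis.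
have Lb : L2 (fun t => (\1_(box l r) t)%:C%C).
  apply: (L2_le mB (integrable_box l r 1)) => t.
  rewrite normc_real ger0_norm ?indic_ge0// mul1r expr2 -[leRHS]mulr1.
  by rewrite ler_wpM2l ?indic_ge0 ?indic_le1.
have iF : cinteg mu (fun t => (\1_(box l r) t)%:C%C * f t).
  have := cinteg_inner Lf Lb; congr (cinteg _ _); apply/funext => t.
  by rewrite conjc_realc mulrC.
have i1 := cintegZ e (cintegB iB iF).
have E t : e * ((\1_(box l r) t)%:C%C * resynthesis f t - (\1_(box l r) t)%:C%C * f t) =
   (\1_(box l r) t)%:C%C * (e * (resynthesis f t - f t)) by ring.
have c1 : cint mu (fun t => (\1_(box l r) t)%:C%C * (e * (resynthesis f t - f t))) = 0.
  rewrite -(eq_cint _ E) cintZ ?cintB// ?resynthesis_box ?subrr ?mulr0//.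
  exact: cintegB.
rewrite (funext E) in i1; case: i1 => i1 _.
have RE t : complex.Re ((\1_(box l r) t)%:C%C * (e * (resynthesis f t - f t))) =
    complex.Re (e * (resynthesis f t - f t)) * \1_(box l r) t.
  by rewrite ReM /= mul0r subr0 mulrC.
have ER : (fun t => (complex.Re ((\1_(box l r) t)%:C%C * (e * (resynthesis f t - f t))))%:E) =
    (fun t => (complex.Re (e * (resynthesis f t - f t)))%:E) \_ (box l r).
  apply/funext => t; rewrite RE patchE indicE; case: ifP => _; first by rewrite mulr1.
  by rewrite mulr0.
split.
  rewrite integral_mkcond -ER -[LHS]fineK; last exact: integrable_fin_num.
  exact: (congr1 EFin (congr1 (@complex.Re R) c1)).
by apply/(integrable_mkcond _ (measurable_box l r)); rewrite -ER.
Qed.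

Theorem inversion : {ae mu, forall t, f t = resynthesis f t}.
Proof.
have mD : cmeas (fun t => resynthesis f t - f t).
  by apply: cmeasB; [exact: cmeas_resynthesis|exact: L2_cmeas].
have h e : {ae mu, forall t, complex.Re (e * (resynthesis f t - f t)) = 0}.
  apply: ae_eq0_boxes.
  - have me : cmeas (fun _ : Rvec R d => e) by exact: cmeas_cst.
    by have [] := cmeasM me mD.
  - by move=> a b; have [] := resynthesis_boxes e a b.
  - by move=> a b; have [] := resynthesis_boxes e a b.
have hr := h 1; have hi := h (Complex 0 1).
apply: filterS2 hr hi => t; rewrite mul1r => r0 i0; apply/esym/eqP.
rewrite -subr_eq0; apply/eqP; apply: complex_ext => //=.
by move: i0; rewrite ReM /= mul0r mul1r sub0r => /eqP; rewrite oppr_eq0 => /eqP.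
Qed.

(** The form in which the reconstruction is used. Exchanging the integrals is legitimate because the
    integral of |e_w| |h| is at most the norm of h, each e_w being a unit vector, and V f is
    integrable. *)
Lemma inner_inversion h : L2 h ->
  inner f h = cint ph (fun w => stft f w * inner (atom w) h).
Proof.
move=> Lh; have mh := L2_cmeas Lh; have mf := L2_cmeas Lf.
rewrite (inner_ae mf cmeas_resynthesis mh inversion).
pose F w t := stft f w * atom w t * conjc (h t).
have mF : cmeas (fun p => F p.1 p.2).
  apply: cmeasM; last exact/cmeas_conj/(cmeas_comp mh measurable_snd).
  by apply: cmeasM; [exact: (cmeas_comp mV measurable_fst)|exact: cmeas_atom].
transitivity (cint mu (fun t => cint ph (F ^~ t))).
  apply: eq_cint => t; rewrite mulrC /resynthesis -cintZ; last exact: cinteg_resynthesis.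
  by apply: eq_cint => w; rewrite mulrC.
rewrite -(@cint_swap _ _ _ _ _ ph mu F mF).
  apply: eq_cint => w; rewrite innerE -cintZ; last by apply: cinteg_inner => //; exact: L2_atom.
  by apply: eq_cint => t; rewrite /F mulrA.
apply: (@le_lt_trans _ _ (\int[ph]_w (normc (stft f w) * n2 h)%:E)%E).
  apply: ge0_le_integral => //.
  - by move=> w _; apply: integral_ge0 => t _; rewrite lee_fin normc_ge0.
  - apply: (@measurable_fun_fubini_tonelli_F _ _ _ _ _ mu (fun p => (normc (F p.1 p.2))%:E)).
      exact: emeas_normc.
    by move=> p; rewrite lee_fin normc_ge0.
  - by apply/measurable_EFinP; apply: measurable_funM; [exact: cmeas_normc|exact: measurable_cst].
  move=> w _.
  under eq_integral do rewrite /F -mulrA normcM EFinM normcM normc_conj.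
  rewrite ge0_integralZl//.
  - rewrite EFinM lee_wpmul2l ?lee_fin ?normc_ge0//.
    by rewrite -[n2 h]mul1r -(n2_atom w) int_normcM_le//; exact: L2_atom.
  - apply/measurable_EFinP; apply: measurable_funM; first exact/cmeas_normc/cmeas_atom1.
    exact: cmeas_normc.
  - by move=> t _; rewrite lee_fin mulr_ge0 ?normc_ge0.
  - by rewrite lee_fin normc_ge0.
have := integrableZr measurableT (n2 h) iV => /integrableP[_].
apply: le_lt_trans; rewrite le_eqVlt; apply/orP; left; apply/eqP; apply: eq_integral => w _ /=.
by rewrite ger0_norm// mulr_ge0 ?normc_ge0 ?n2_ge0.
Qed.

End inversion_of_one_function.
End inversion.
(** * Weights and time-frequency shifts *)

Section phase_norm.
Context {R : realType}.

(** Minkowski's inequality in finite dimension. It serves twice: for the triangle inequality in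
    phase space and, over finite lists, for the l^2 argument of the Bessel bound. *)
Lemma sqrt_sum_sqrD (I : finType) (a b : I -> R) :
  Num.sqrt (\sum_i (a i + b i) ^+ 2) <=
  Num.sqrt (\sum_i a i ^+ 2) + Num.sqrt (\sum_i b i ^+ 2).
Proof.
have ss0 (c : I -> R) : 0 <= \sum_i c i ^+ 2 by apply: sumr_ge0 => i _; exact: sqr_ge0.
set p := Num.sqrt (\sum_i a i ^+ 2); set q := Num.sqrt (\sum_i b i ^+ 2).
have p0 : 0 <= p by exact: sqrtr_ge0.
have q0 : 0 <= q by exact: sqrtr_ge0.
have pE : p ^+ 2 = \sum_i a i ^+ 2 by rewrite sqr_sqrtr.
have qE : q ^+ 2 = \sum_i b i ^+ 2 by rewrite sqr_sqrtr.
set S := \sum_i a i * b i.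
have SE c e : \sum_i (c * a i + e * b i) ^+ 2 = c ^+ 2 * p ^+ 2 + 2 * c * e * S + e ^+ 2 * q ^+ 2.
  by rewrite pE qE !mulr_sumr -!big_split /=; apply: eq_bigr => i _; ring.
have S0 : p * q = 0 -> S = 0.
  move=> /eqP; rewrite mulf_eq0 => /orP[] /eqP z0.
    rewrite z0 expr0n /= in pE; apply: big1 => i _.
    have /eqP := esym pE; rewrite psumr_eq0//; last by move=> j _; exact: sqr_ge0.
    by move=> /allP/(_ i (mem_index_enum i)); rewrite sqrf_eq0 => /eqP ->; rewrite mul0r.
  rewrite z0 expr0n /= in qE; apply: big1 => i _.
  have /eqP := esym qE; rewrite psumr_eq0//; last by move=> j _; exact: sqr_ge0.
  by move=> /allP/(_ i (mem_index_enum i)); rewrite sqrf_eq0 => /eqP ->; rewrite mulr0.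
have CS : S <= p * q.
  have [pq0|pq0] := eqVneq (p * q) 0; first by rewrite S0// pq0.
  have pq : 0 < p * q by rewrite lt_neqAle eq_sym pq0 mulr_ge0.
  (* Nonnegativity of this sum of squares reads 2 p^2 q^2 - 2 p q S >= 0, and p q is positive. *)
  have := ss0 (fun i => q * a i + (- p) * b i); rewrite SE => h.
  by rewrite -(ler_pM2l pq); nra.
rewrite -(ler_pXn2r (ltn0Sn 1)) ?nnegrE ?addr_ge0 ?sqrtr_ge0// sqr_sqrtr//.
have := SE 1 1; under eq_bigr do rewrite !mul1r.
by move=> ->; lra.
Qed.

Context {d : nat}.
Implicit Types (z w k l : phase R d).

(** Indexing by a sum type treats positions and frequencies as a single family of 2d coordinates,
    for the norm here and for lattice counting later. *)
Definition coord z (i : 'I_d + 'I_d) : R :=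
  match i with inl j => tnth z.1 j | inr j => tnth z.2 j end.

Lemma normpE z : normp z = Num.sqrt (\sum_i coord z i ^+ 2).
Proof.
by rewrite /normp big_sumType; congr (Num.sqrt (_ + _)); apply: eq_bigr => i _; rewrite expr2.
Qed.

Lemma coord_subp z w i : coord (subp z w) i = coord z i - coord w i.
Proof. by case: i => j; rewrite /= tnth_subv. Qed.

Lemma normp_ge0 z : 0 <= normp z. Proof. exact: sqrtr_ge0. Qed.

Lemma normp_triangle z w : normp z <= normp w + normp (subp w z).
Proof.
rewrite !normpE.
rewrite [X in _ <= _ + Num.sqrt X](_ : _ = \sum_i (coord z i - coord w i) ^+ 2); last first.
  by apply: eq_bigr => i _; rewrite coord_subp -sqrrN opprB.
apply: le_trans (sqrt_sum_sqrD _ _).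
by rewrite le_eqVlt; apply/orP; left; apply/eqP; congr (Num.sqrt _); apply: eq_bigr => i _; rewrite addrC subrK.
Qed.

Lemma normp_subpC z w : normp (subp z w) = normp (subp w z).
Proof.
by rewrite !normpE; congr Num.sqrt; apply: eq_bigr => i _; rewrite !coord_subp -sqrrN opprB.
Qed.

Lemma coord_le_normp z i : `|coord z i| <= normp z.
Proof.
rewrite normpE -sqrtr_sqr ler_sqrt; last by apply: sumr_ge0 => j _; exact: sqr_ge0.
by rewrite (bigD1 i)//= lerDl; apply: sumr_ge0 => j _; exact: sqr_ge0.
Qed.

Lemma measurable_normp : measurable_fun setT (normp : phase R d -> measurableTypeR R).
Proof.
rewrite (_ : normp = fun z : phase R d => (dotv z.1 z.1 + dotv z.2 z.2) `^ 2^-1).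
  apply: (measurableT_comp (measurable_powR _)).
  by apply: measurable_funD; apply: measurable_dotv.
apply/funext => z; rewrite powR12_sqrt//.
by rewrite -normp_sqr sqr_ge0.
Qed.

End phase_norm.

Section weight.
Context {R : realType} {d : nat}.
Variable s : R.
Hypothesis s0 : 0 <= s.
Implicit Types (z w k l : phase R d).

Let base_gt0 z : 0 < 1 + normp z. Proof. by rewrite ltr_pwDl ?normp_ge0. Qed.

Lemma nu_ge1 z : 1 <= nu s z.
Proof.
by rewrite -[leLHS](powRr0 (1 + normp z)) ler_powR// lerDl normp_ge0.
Qed.

Lemma nu_gt0 z : 0 < nu s z. Proof. exact: lt_le_trans (nu_ge1 z). Qed.

Lemma nu_submul z w : nu s z <= nu s w * nu s (subp w z).
Proof.
rewrite /nu -powRM ?(ltW (base_gt0 _))//; apply: ge0_ler_powR => //; rewrite ?nnegrE.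
- exact/ltW/base_gt0.
- by rewrite mulr_ge0// ltW.
have := normp_triangle z w; have := normp_ge0 w; have := normp_ge0 (subp w z); nra.
Qed.

Lemma nu_subpC z w : nu s (subp z w) = nu s (subp w z).
Proof. by rewrite /nu normp_subpC. Qed.

Lemma measurable_nu : measurable_fun setT (nu s : phase R d -> measurableTypeR R).
Proof.
apply: (measurableT_comp (measurable_powR s)).
by apply: measurable_funD; [exact: measurable_cst|exact: measurable_normp].
Qed.

(** With r = |z|, the bounds pi >= 2 and ln(1 + r) <= r leave the exponent s r - r^2, which is at
    most s^2 by completing the square. *)
Lemma gauss_nu_le z : expR (- (pi / 2 * normp z ^+ 2)) * nu s z <= expR (s ^+ 2).
Proof.
have r0 := normp_ge0 z; have p2 := pi_ge2 R.
have -> : nu s z = expR (s * ln (1 + normp z)).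
  by rewrite mulrC expRM lnK// posrE.
rewrite -expRD ler_expR.
have Lr : ln (1 + normp z) <= normp z by apply: le_ln1Dx; rewrite (lt_le_trans _ r0).
have h : s * ln (1 + normp z) <= s * normp z by rewrite ler_wpM2l.
have h2 : 1 * normp z ^+ 2 <= pi / 2 * normp z ^+ 2.
  by rewrite ler_wpM2r ?sqr_ge0// ler_pdivlMr// mul1r.
have := sqr_ge0 (s - normp z); have := sqr_ge0 s; have := sqr_ge0 (normp z); rewrite sqrrB; lra.
Qed.

End weight.

(** * Time-frequency shifts as unitary operators *)

Section tfshift_theory.
Context {R : realType} {d : nat}.
Local Notation mu := (lebesgue_vec R d).
Implicit Types (f g h : cfun R d) (z w k l : phase R d) (t : Rvec R d).

Lemma dotvN (x y : Rvec R d) : dotv [tuple - tnth x i | i < d] y = - dotv x y.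
Proof. by rewrite /dotv -sumrN; apply: eq_bigr => i _; rewrite tnth_mktuple mulNr. Qed.

Lemma dotvBr (x y a : Rvec R d) : dotv x (subv y a) = dotv x y - dotv x a.
Proof. by rewrite /dotv -sumrB; apply: eq_bigr => i _; rewrite tnth_subv mulrBr. Qed.

Lemma dotvBl (x y a : Rvec R d) : dotv (subv x y) a = dotv x a - dotv y a.
Proof. by rewrite /dotv -sumrB; apply: eq_bigr => i _; rewrite tnth_subv mulrBl. Qed.

Lemma tfshift_meas z f : cmeas f -> cmeas (tfshift z f).
Proof.
move=> mf; apply: cmeasM; last exact: (cmeas_comp mf (measurable_subv z.1)).
apply: cmeas_cexpi.
apply: measurable_funM; first exact: measurable_cst.
by apply: measurable_dotv => //; exact: measurable_cst.
Qed.

Lemma normc_tfshift z f t : normc (tfshift z f t) = normc (f (subv t z.1)).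
Proof. by rewrite normcM normc_cexpi mul1r. Qed.

Let L2_tfshift_iff z f : cmeas f -> L2 (tfshift z f) <-> L2 f.
Proof.
move=> mf; have mf2 := emeas_sqr_normc mf.
have E : (\int[mu]_t (normc (tfshift z f t) ^+ 2)%:E = \int[mu]_t (normc (f t) ^+ 2)%:E)%E.
  under eq_integral do rewrite normc_tfshift.
  by apply: (ge0_integral_vec_translation z.1 mf2) => t; rewrite lee_fin sqr_ge0.
by rewrite !L2P E; split=> -[_ foo]; split=> //; exact: tfshift_meas.
Qed.

Lemma L2_tfshift z f : L2 f -> L2 (tfshift z f).
Proof. by move=> Lf; rewrite L2_tfshift_iff//; exact: L2_cmeas. Qed.

Lemma L2_gauss0 : L2 (gauss0 : cfun R d).
Proof.
pose w : phase R d := ([tuple 0 | i < d], [tuple 0 | i < d]).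
by rewrite -(L2_tfshift_iff w cmeas_gauss0); exact: L2_atom.
Qed.

Lemma tfshiftM_conj z f g t :
  tfshift z f t * conjc (tfshift z g t) = f (subv t z.1) * conjc (g (subv t z.1)).
Proof.
rewrite conjcM mulrACA mulc_conj normc_cexpi expr1n.
by rewrite (_ : 1%:C%C = 1 :> R[i]) ?mul1r.
Qed.

Lemma inner_tfshift z f g : L2 f -> L2 g -> inner (tfshift z f) (tfshift z g) = inner f g.
Proof.
move=> Lf Lg; rewrite !innerE (eq_cint _ (tfshiftM_conj z f g)).
by have [_ ->] := cint_vec_translation z.1 (cinteg_cmeas (cinteg_inner Lf Lg)).
Qed.

Lemma n2_tfshift z f : L2 f -> n2 (tfshift z f) = n2 f.
Proof.
move=> Lf; have := inner_tfshift z Lf Lf; rewrite !inner_self.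
move=> /(congr1 (@complex.Re R)) /= h; apply/eqP.
by rewrite -(@eqrXn2 _ 2) ?n2_ge0//; apply/eqP.
Qed.

(** The shifts compose up to a phase. Under a modulus the phase disappears, so an inner product of
    shifts by l and k depends only on k - l. *)
Lemma tfshift_comp k l f t : tfshift l (tfshift (subp k l) f) t =
  cexpi (- (2 * pi * dotv (subp k l).2 l.1)) * tfshift k f t.
Proof.
rewrite /tfshift /= !mulrA -!cexpiD; congr (cexpi _ * f _).
  by rewrite !(dotvBr, dotvBl); ring.
by apply: eq_from_tnth => i; rewrite !tnth_subv; ring.
Qed.

Lemma normc_inner_tfshift k l f g : L2 f -> L2 g ->
  normc (inner (tfshift l f) (tfshift k g)) = normc (inner f (tfshift (subp k l) g)).
Proof.
move=> Lf Lg; have Lkl := L2_tfshift (subp k l) Lg.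
rewrite -(inner_tfshift l Lf Lkl) (funext (tfshift_comp k l g)).
rewrite innerZr; [|exact: L2_tfshift|exact: L2_tfshift].
by rewrite normcM normc_conj normc_cexpi mul1r.
Qed.

Definition negp z : phase R d :=
  ([tuple - tnth z.1 i | i < d], [tuple - tnth z.2 i | i < d]).

(** The explicit adjoint of pi(z), the shift by -z up to a phase. It is the witness showing that
    [adjoint (tfshift z)] is a genuine adjoint and not the default of [xget]. *)
Definition tfshift_adj z f : cfun R d :=
  fun t => cexpi (- (2 * pi * dotv z.2 z.1)) * tfshift (negp z) f t.

Lemma tfshift_adjK z f : tfshift z (tfshift_adj z f) = f.
Proof.
apply/funext => t; rewrite /tfshift_adj /tfshift /= !mulrA -!cexpiD.
rewrite dotvN dotvBr.
rewrite (_ : 2 * pi * _ + _ + _ = 0); last by ring.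
rewrite cexpi0 mul1r; congr f.
by apply: eq_from_tnth => i; rewrite !tnth_subv tnth_mktuple; ring.
Qed.

Lemma L2_tfshift_adj z f : L2 f -> L2 (tfshift_adj z f).
Proof. by move=> Lf; exact/L2Z/L2_tfshift. Qed.

Lemma inner_tfshift_adj z f g : L2 f -> L2 g ->
  inner (tfshift z f) g = inner f (tfshift_adj z g).
Proof.
move=> Lf Lg; rewrite -{1}(tfshift_adjK z g) inner_tfshift//.
exact: L2_tfshift_adj.
Qed.

Lemma n2_tfshift_adj z f : L2 f -> n2 (tfshift_adj z f) = n2 f.
Proof.
by move=> Lf; rewrite -{2}(tfshift_adjK z f) n2_tfshift//; exact: L2_tfshift_adj.
Qed.

End tfshift_theory.

(** * Weighted decay of inner products of functions in M^1 *)

Section key_estimate.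
Context {R : realType} {d : nat}.
Variable s : R.
Hypothesis s0 : 0 <= s.
Local Notation mu := (lebesgue_vec R d).
Local Notation ph := (phase_measure R d).
Implicit Types (f g h : cfun R d) (z w k l : phase R d).

Definition m1 f : R := fine (M1norm s f).

Let m1_integrand_ge0 f w : (0 <= (normc (stft f w) * nu s w)%:E)%E.
Proof. by rewrite lee_fin mulr_ge0 ?normc_ge0// ltW// nu_gt0. Qed.

Lemma M1norm_ge0 f : (0 <= M1norm s f)%E.
Proof. by apply: integral_ge0 => w _; exact: m1_integrand_ge0. Qed.

Lemma m1_ge0 f : 0 <= m1 f.
Proof. exact/fine_ge0/M1norm_ge0. Qed.

Lemma M1norm_m1 f : M1 s f -> M1norm s f = (m1 f)%:E.
Proof. by move=> [_ foo]; rewrite fineK// ge0_fin_numE// M1norm_ge0. Qed.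

Let measurable_m1_integrand f : L2 f ->
  measurable_fun setT (fun w => (normc (stft f w) * nu s w)%:E).
Proof.
move=> Lf; apply/measurable_EFinP; apply: measurable_funM; last exact: measurable_nu.
exact/cmeas_normc/cmeas_stft/L2_cmeas.
Qed.

Let M1_integrable f : M1 s f -> ph.-integrable setT (fun w => (normc (stft f w) * nu s w)%:E).
Proof.
move=> [Lf foo]; apply/integrableP; split; first exact: measurable_m1_integrand.
apply: le_lt_trans foo; rewrite le_eqVlt; apply/orP; left; apply/eqP.
by apply: eq_integral => w _; rewrite gee0_abs.
Qed.

Lemma M1_stft_lty f : M1 s f -> (\int[ph]_w (normc (stft f w))%:E < +oo)%E.
Proof.
move=> Mf; have [Lf foo] := Mf; apply: le_lt_trans foo.
apply: ge0_le_integral => //.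
- by move=> w _; rewrite lee_fin normc_ge0.
- exact/emeas_normc/cmeas_stft/L2_cmeas.
- exact: measurable_m1_integrand.
- by move=> w _; rewrite lee_fin ler_peMr ?normc_ge0// nu_ge1.
Qed.

(* Insert the reconstruction formula for f and split the weight with
   nu_s(z) <= nu_s(w) nu_s(w - z). *)
Lemma weighted_inner_le f h z K : M1 s f -> L2 h ->
  (forall w, normc (inner (atom w) h) * nu s (subp w z) <= K) ->
  normc (inner f h) * nu s z <= K * m1 f.
Proof.
move=> Mf Lh hK; have [Lf _] := Mf.
have bd w : normc (stft f w * inner (atom w) h) * nu s z <=
    K * (normc (stft f w) * nu s w).
  rewrite normcM; apply: (@le_trans _ _ ((normc (stft f w) * nu s w) *
    (normc (inner (atom w) h) * nu s (subp w z)))).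
    rewrite [leRHS]mulrACA ler_wpM2l ?mulr_ge0 ?normc_ge0//; exact: nu_submul.
  by rewrite mulrC ler_wpM2r// mulr_ge0 ?normc_ge0// ltW// nu_gt0.
have mh : cmeas (fun w => inner (atom w) h).
  apply: (@cmeas_cint_section _ _ _ _ _ mu
    (fun p : phase R d * Rvec R d => atom p.1 p.2 * conjc (h p.2))).
  by apply: cmeasM; [exact: cmeas_atom|exact/cmeas_conj/(cmeas_comp (L2_cmeas Lh) measurable_snd)].
have iF : cinteg ph (fun w => stft f w * inner (atom w) h).
  apply: (cinteg_le (g := fun w => K * (normc (stft f w) * nu s w))).
  - by apply: (cmeasM _ mh); exact/cmeas_stft/L2_cmeas.
  - exact: (integrableZl measurableT K (M1_integrable Mf)).
  - by move=> w; apply: le_trans (bd w); rewrite ler_peMr ?normc_ge0// nu_ge1.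
rewrite (inner_inversion Lf (M1_stft_lty Mf) Lh).
apply: (@le_trans _ _ (fine (\int[ph]_w (normc (stft f w * inner (atom w) h))%:E) * nu s z)).
  by rewrite ler_wpM2r ?(ltW (nu_gt0 s0 z))//; exact: normc_cint.
have ifin : (\int[ph]_w (normc (stft f w * inner (atom w) h))%:E \is a fin_num)%E.
  rewrite ge0_fin_numE; first exact: cinteg_lty.
  by apply: integral_ge0 => w _; rewrite lee_fin normc_ge0.
rewrite -lee_fin EFinM fineK// [leRHS]EFinM -M1norm_m1//.
rewrite muleC -ge0_integralZl//.
- rewrite -ge0_integralZl//.
  + apply: ge0_le_integral => //.
    * by move=> w _; rewrite -EFinM lee_fin mulr_ge0 ?normc_ge0// ltW// nu_gt0.
    * exact/measurable_funeM/emeas_normc/cinteg_cmeas/iF.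
    * by apply: measurable_funeM; have := measurable_m1_integrand Lf.
    * by move=> w _; rewrite -!EFinM lee_fin mulrC bd.
  + by have := measurable_m1_integrand Lf.
  + rewrite lee_fin; apply: le_trans (hK z).
    by rewrite mulr_ge0 ?normc_ge0// ltW// nu_gt0.
- exact/emeas_normc/cinteg_cmeas/iF.
- by move=> w _; rewrite lee_fin normc_ge0.
- by rewrite lee_fin ltW// nu_gt0.
Qed.

(** The bound of [gauss_nu_le], and the constant C of the weighted estimates. *)
Definition nuC : R := expR (s ^+ 2).

Lemma stft_nu_le f z : M1 s f -> normc (stft f z) * nu s z <= nuC * m1 f.
Proof.
move=> Mf; apply: weighted_inner_le => //; first exact: L2_atom.
by move=> w; rewrite normc_inner_atom; exact: gauss_nu_le.
Qed.

Lemma inner_nu_le f g z : M1 s f -> M1 s g ->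
  normc (inner f (tfshift z g)) * nu s z <= nuC * m1 f * m1 g.
Proof.
move=> Mf Mg; have [Lg _] := Mg; rewrite mulrAC.
apply: weighted_inner_le => //; first exact: L2_tfshift.
move=> w.
have e : normc (inner (atom w) (tfshift z g)) = normc (stft g (subp w z)).
  rewrite (inner_conj (L2_tfshift z Lg) (L2_atom w)) normc_conj.
  exact: (normc_inner_tfshift w z Lg L2_gauss0).
by rewrite e; exact: stft_nu_le.
Qed.

(** Pairing f with itself at the origin of phase space in [weighted_inner_le] gives |f|^2 <= C
    |f|_{M^1_s}^2; since C >= 1, its square root may be replaced by C. *)
Lemma n2_le_m1 f : M1 s f -> n2 f <= nuC * m1 f.
Proof.
move=> Mf; have [Lf _] := Mf.
pose o : phase R d := ([tuple 0 | i < d], [tuple 0 | i < d]).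
have subo w : subp w o = w.
  by case: w => a b; congr (_, _); apply: eq_from_tnth => i; rewrite tnth_subv tnth_mktuple subr0.
have := @weighted_inner_le f f o (nuC * m1 f) Mf Lf.
rewrite inner_self normc_real ger0_norm ?sqr_ge0// => h.
have {}h : n2 f ^+ 2 <= nuC * m1 f * m1 f.
  apply: le_trans (h _); first by rewrite ler_peMr ?sqr_ge0// nu_ge1.
  move=> w; rewrite subo; apply: le_trans (stft_nu_le w Mf).
  by rewrite (inner_conj Lf (L2_atom w)) normc_conj.
have C1 : 1 <= nuC by rewrite -[leLHS]expR0 ler_expR sqr_ge0.
have c0 : 0 <= nuC by exact: le_trans C1.
rewrite -(ler_pXn2r (ltn0Sn 1)) ?nnegrE ?n2_ge0 ?mulr_ge0 ?m1_ge0//.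
apply: le_trans h _; rewrite exprMn -mulrA -expr2 ler_wpM2r ?sqr_ge0//.
by rewrite expr2 ler_peMr.
Qed.

End key_estimate.
(** * Bounded operators and the localization estimate *)

Section operators.
Context {R : realType} {d : nat}.
Local Notation mu := (lebesgue_vec R d).
Local Notation op := (cfun R d -> cfun R d).
Implicit Types (f g h : cfun R d) (T S A : op) (C : R).

Lemma bounded_op_L2 T f : bounded_op T -> L2 f -> L2 (T f).
Proof. by case=> h _ _; exact: h. Qed.

Lemma opnorm_ge0 T : bounded_op T -> (0 <= opnorm T)%E.
Proof.
move=> [LT _ _]; have L0 := @L20 R d.
apply: (@le_trans _ _ (L2norm (T (fun=> 0)))).
  by rewrite L2norm_n2 ?lee_fin ?n2_ge0//; exact: LT.
apply: ereal_sup_ubound; exists (fun=> 0) => //; split=> //.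
by rewrite L2norm_n2// n20 ?lee01//; exact: aeW.
Qed.

Lemma bounded_op0 T : bounded_op T -> {ae mu, forall t, T (fun=> 0) t = 0}.
Proof.
move=> [LT linT _]; have L0 := @L20 R d.
apply: filterS (linT 1 _ _ L0 L0) => t.
rewrite (_ : (fun _ => 1 * 0 + 0) = (fun=> 0)); last by apply/funext => u; rewrite mulr0 addr0.
by rewrite mul1r -[LHS]addr0 => /addrI <-.
Qed.

Lemma bounded_opZ T (a : R[i]) f : bounded_op T -> L2 f ->
  {ae mu, forall t, T (fun u => a * f u) t = a * T f t}.
Proof.
move=> bT Lf; have [LT linT _] := bT; have L0 := @L20 R d.
apply: filterS2 (linT a _ _ Lf L0) (bounded_op0 bT) => t.
rewrite (_ : (fun u => a * f u + 0) = (fun u => a * f u)); last by apply/funext => u; rewrite addr0.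
by move=> -> ->; rewrite addr0.
Qed.

Lemma bounded_opB T f g : bounded_op T -> L2 f -> L2 g ->
  {ae mu, forall t, T (fun u => f u - g u) t = T f t - T g t}.
Proof.
move=> [LT linT _] Lf Lg.
apply: filterS (linT (-1) _ _ Lg Lf) => t.
rewrite (_ : (fun u => -1 * g u + f u) = (fun u => f u - g u)); last first.
  by apply/funext => u; rewrite mulN1r addrC.
by move=> ->; rewrite mulN1r addrC.
Qed.

Lemma n2_bounded_op T f : bounded_op T -> L2 f -> n2 (T f) <= fine (opnorm T) * n2 f.
Proof.
move=> bT Lf; have [LT _ foo] := bT; set M := fine _.
have M0 : 0 <= M by exact/fine_ge0/opnorm_ge0.
have scaled c : 0 <= c -> c * n2 f <= 1 -> c * n2 (T f) <= M.
  move=> c0 c1; have Lcf : L2 (fun u => c%:C%C * f u) by exact: L2Z.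
  have e : n2 (T (fun u => c%:C%C * f u)) = c * n2 (T f).
    rewrite (n2_ae _ _ (bounded_opZ c%:C%C bT Lf)); first by rewrite n2Z ?normc_real ?ger0_norm//; exact: LT.
      exact/L2_cmeas/LT.
    exact/L2_cmeas/L2Z/LT.
  rewrite -e -lee_fin fineK; last by rewrite ge0_fin_numE// opnorm_ge0.
  rewrite -L2norm_n2; last exact: LT.
  apply: ereal_sup_ubound; exists (fun u => c%:C%C * f u) => //; split=> //.
  by rewrite L2norm_n2// n2Z// normc_real ger0_norm// lee_fin.
(* If [n2 f] is 0, every multiple of f lies in the unit ball. Were [n2 (T f)] positive, scaling by
   (M + 1) / [n2 (T f)] would give M + 1 <= M. *)
have [f0|f0] := eqVneq (n2 f) 0.
  rewrite f0 mulr0 leNgt; apply/negP => Tf0.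
  have := scaled ((M + 1) / n2 (T f)); rewrite f0 mulr0 divfK ?gt_eqF// => /(_ _ ler01).
  by rewrite divr_ge0 ?addr_ge0 ?(ltW Tf0)// => /(_ isT); rewrite leNgt ltrDl ltr01.
have fp : 0 < n2 f by rewrite lt_neqAle eq_sym f0 n2_ge0.
have := scaled (n2 f)^-1; rewrite mulVf// lexx invr_ge0 n2_ge0 => /(_ isT isT).
by rewrite ler_pdivrMl// mulrC.
Qed.

Lemma opnorm_le T C : (forall f, L2 f -> L2 (T f)) -> 0 <= C ->
  (forall f, L2 f -> n2 (T f) <= C * n2 f) -> (opnorm T <= C%:E)%E.
Proof.
move=> LT C0 TC; apply: ge_ereal_sup => _ [f [Lf f1] <-].
rewrite L2norm_n2 ?lee_fin; last exact: LT.
move: f1; rewrite L2norm_n2// lee_fin => f1.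
by apply: le_trans (TC _ Lf) _; rewrite -[leRHS]mulr1 ler_wpM2l.
Qed.

Lemma bounded_op_intro T C : (forall f, L2 f -> L2 (T f)) ->
  (forall (a : R[i]) f g, L2 f -> L2 g ->
     {ae mu, forall t, T (fun u => a * f u + g u) t = a * T f t + T g t}) ->
  0 <= C -> (forall f, L2 f -> n2 (T f) <= C * n2 f) -> bounded_op T.
Proof. by move=> LT linT C0 TC; split=> //; apply: le_lt_trans (opnorm_le LT C0 TC) _; exact: ltry. Qed.

(** Operators act on representatives and are linear only almost everywhere. Boundedness makes them
    respect almost-everywhere equality, which is what allows two of them to be composed. *)
Lemma bounded_op_ae T f g : bounded_op T -> L2 f -> L2 g ->
  {ae mu, forall t, f t = g t} -> {ae mu, forall t, T f t = T g t}.
Proof.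
move=> bT Lf Lg fg; have Lfg := L2B Lf Lg.
have z : n2 (T (fun u => f u - g u)) = 0.
  apply/eqP; rewrite eq_le n2_ge0 andbT; apply: le_trans (n2_bounded_op bT Lfg) _.
  rewrite (@n20 _ _ (fun t => f t - g t)) ?mulr0//; last exact: L2_cmeas.
  by apply: filterS fg => t ->; rewrite subrr.
have := n2_eq0 (bounded_op_L2 bT Lfg) z.
apply: filterS2 (bounded_opB bT Lf Lg) => t -> /eqP.
by rewrite subr_eq0 => /eqP.
Qed.

Lemma bounded_op_comp T S : bounded_op T -> bounded_op S -> bounded_op (fun f => T (S f)).
Proof.
move=> bT bS; have [LT linT _] := bT; have [LS linS _] := bS.
apply: (@bounded_op_intro _ (fine (opnorm T) * fine (opnorm S))).
- by move=> f Lf; exact/LT/LS.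
- move=> a f g Lf Lg.
  have Lafg : L2 (fun u => a * f u + g u) by apply: L2D => //; exact: L2Z.
  have LaS : L2 (fun u => a * S f u + S g u) by apply: L2D; [exact/L2Z/LS|exact: LS].
  have := bounded_op_ae bT (LS _ Lafg) LaS (linS a f g Lf Lg).
  by apply: filterS2 (linT a _ _ (LS _ Lf) (LS _ Lg)) => t -> ->.
- by rewrite mulr_ge0// fine_ge0// opnorm_ge0.
move=> f Lf; apply: le_trans (n2_bounded_op bT (LS _ Lf)) _.
rewrite -mulrA ler_wpM2l//; first by rewrite fine_ge0// opnorm_ge0.
exact: n2_bounded_op.
Qed.

Lemma bounded_op_zero : bounded_op ((fun _ _ => 0) : op).
Proof.
apply: (@bounded_op_intro _ 0) => //.
- by move=> f _; exact: L20.
- by move=> a f g _ _; apply: aeW => t; rewrite mulr0 addr0.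
by move=> f _; rewrite mul0r n20//; exact: aeW.
Qed.

Lemma adjoint_cases T : is_adjoint T (adjoint T) \/ adjoint T = (fun _ _ => 0).
Proof.
have [ex|nex] := pselect (exists S, is_adjoint T S); [left|right].
  exact: (@xgetPex _ _ [set S | is_adjoint T S]).
by apply: xgetPN => S hS; apply: nex; exists S.
Qed.

Lemma bounded_op_adjoint T : bounded_op (adjoint T).
Proof. by have [[]//|->] := adjoint_cases T; exact: bounded_op_zero. Qed.

(* The zero map satisfies this bound too, so the existence of an adjoint is not needed. *)
Lemma normc_inner_adjoint_le T f g : bounded_op T -> L2 f -> L2 g ->
  normc (inner (adjoint T f) g) <= n2 f * n2 (T g).
Proof.
move=> bT Lf Lg; have [[bS adjS]|->] := adjoint_cases T.
  rewrite (inner_conj Lg (bounded_op_L2 bS Lf)) normc_conj -adjS// mulrC.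
  by apply: inner_CS => //; exact: bounded_op_L2.
rewrite innerE; under eq_fun do rewrite mul0r.
by rewrite cint0 normc0 mulr_ge0// n2_ge0.
Qed.

Lemma is_adjoint_tfshift z : is_adjoint (tfshift z) (tfshift_adj z : op).
Proof.
split; last by move=> f g Lf Lg; exact: inner_tfshift_adj.
apply: (@bounded_op_intro _ 1) => //.
- by move=> f; exact: L2_tfshift_adj.
- by move=> a f g _ _; apply: aeW => t; rewrite /tfshift_adj /tfshift; ring.
by move=> f Lf; rewrite n2_tfshift_adj// mul1r.
Qed.

Lemma is_adjoint_adjoint_tfshift z : is_adjoint (tfshift z) (adjoint (tfshift z) : op).
Proof.
apply: (@xgetPex _ _ [set S | is_adjoint (tfshift z) S]).
by exists (tfshift_adj z); exact: is_adjoint_tfshift.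
Qed.

Lemma bounded_op_tfshift z : bounded_op (tfshift z : op).
Proof.
apply: (@bounded_op_intro _ 1) => //.
- by move=> f; exact: L2_tfshift.
- by move=> a f g _ _; apply: aeW => t; rewrite /tfshift; ring.
by move=> f Lf; rewrite n2_tfshift// mul1r.
Qed.

Lemma bounded_op_alpha z T : bounded_op T -> bounded_op (alpha z T).
Proof.
move=> bT; apply: bounded_op_comp; first exact: bounded_op_tfshift.
by apply: bounded_op_comp => //; exact: bounded_op_adjoint.
Qed.

(** The chosen adjoint A is known only through its defining identity, so the identity is tested on A
    f: |A f|^2 = <pi(z) A f, f>, and pi(z) is isometric. *)
Lemma n2_adjoint_tfshift_le z f : L2 f -> n2 (adjoint (tfshift z) f) <= n2 f.
Proof.
move=> Lf; have [bA adjA] := is_adjoint_adjoint_tfshift z.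
set A := adjoint (tfshift z) in bA adjA *.
have LA := bounded_op_L2 bA Lf.
have h : n2 (A f) ^+ 2 <= n2 (A f) * n2 f.
  have := inner_CS (L2_tfshift z LA) Lf.
  by rewrite adjA// n2_tfshift// inner_self normc_real ger0_norm ?sqr_ge0.
have [->|A0] := eqVneq (n2 (A f)) 0; first exact: n2_ge0.
by rewrite -(@ler_pM2l _ (n2 (A f))) -?expr2// lt_neqAle eq_sym A0 n2_ge0.
Qed.

Lemma inner_adjoint_tfshift z f g : L2 f -> L2 g ->
  inner (adjoint (tfshift z) f) g = inner f (tfshift z g).
Proof.
move=> Lf Lg; have [bA adjA] := is_adjoint_adjoint_tfshift z.
rewrite (inner_conj Lg (bounded_op_L2 bA Lf)) -adjA//.
by rewrite -inner_conj//; exact: L2_tfshift.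
Qed.

End operators.

(** * Series of rank-one operators and the localization estimate *)

Section trace_class_series.
Context {R : realType} {d : nat}.
Local Notation op := (cfun R d -> cfun R d).
Implicit Types (f g h : cfun R d) (z k l : phase R d).
Variables (s : R) (T : op) (phi psi : nat -> cfun R d).
Hypotheses (s0 : 0 <= s) (bT : bounded_op T).
Hypotheses (Mphi : forall n, M1 s (phi n)) (Mpsi : forall n, M1 s (psi n)).
Hypothesis summable : (\sum_(0 <= n <oo) (M1norm s (phi n) * M1norm s (psi n)) < +oo)%E.
Hypothesis cvgT : (fun N => opnorm (fun h t =>
  T h t - \sum_(0 <= n < N) rank1 (phi n) (psi n) h t)) @ \oo --> 0%E.

Let Lphi n : L2 (phi n). Proof. by have [] := Mphi n. Qed.
Let Lpsi n : L2 (psi n). Proof. by have [] := Mpsi n. Qed.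

Let partial N h t := \sum_(0 <= n < N) rank1 (phi n) (psi n) h t.

Let L2_partial N h : L2 (partial N h).
Proof. by apply: L2_sum => n; exact: L2Z. Qed.

Let n2_partial N h : n2 (partial N h) <=
  \sum_(0 <= n < N) normc (inner h (psi n)) * n2 (phi n).
Proof.
apply: le_trans (n2_sum _ _) _; first by move=> n; exact: L2Z.
by apply: ler_sum => n _; rewrite n2Z.
Qed.

Definition series_total : R := fine (\sum_(0 <= n <oo) (M1norm s (phi n) * M1norm s (psi n)))%E.

Lemma series_total_ge0 : 0 <= series_total.
Proof. by apply: fine_ge0; apply: nneseries_ge0 => n _ _; rewrite mule_ge0// M1norm_ge0. Qed.

Lemma le_series_total N : \sum_(0 <= n < N) m1 s (phi n) * m1 s (psi n) <= series_total.
Proof.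
have g0 n : (0 <= n)%N -> true -> (0 <= M1norm s (phi n) * M1norm s (psi n))%E.
  by move=> _ _; rewrite mule_ge0// M1norm_ge0.
rewrite -lee_fin fineK; last by rewrite ge0_fin_numE//; exact: nneseries_ge0.
apply: le_trans (nneseries_lim_ge N g0).
rewrite -sumEFin; apply: lee_sum => n _.
by rewrite EFinM (M1norm_m1 s0 (Mphi n)) (M1norm_m1 s0 (Mpsi n)).
Qed.

Let remainder N : op := fun h t => T h t - partial N h t.

(** Makes the operator norm of the remainder a finite bound on every vector. The crude constant
    depends on N and serves only this purpose. *)
Let bounded_remainder N : bounded_op (remainder N).
Proof.
have [LT linT _] := bT.
pose C := fine (opnorm T) + \sum_(0 <= n < N) n2 (psi n) * n2 (phi n).
apply: (@bounded_op_intro _ _ _ C).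
- by move=> f Lf; apply: L2B; [exact: LT|exact: L2_partial].
- move=> a f g Lf Lg; apply: filterS (linT a f g Lf Lg) => t.
  rewrite /remainder /partial => ->.
  rewrite mulrBr addrACA -opprD; congr (_ - _).
  rewrite mulr_sumr -big_split; apply: eq_bigr => n _ /=.
  rewrite /rank1 (innerDl (L2Z a Lf) Lg (Lpsi n)) (innerZl a Lf (Lpsi n)).
  by move: (inner _ _) (inner _ _) => b c; ring.
- rewrite addr_ge0 ?fine_ge0 ?opnorm_ge0//.
  by apply: sumr_ge0 => n _; rewrite mulr_ge0// n2_ge0.
move=> f Lf; apply: le_trans (n2B (LT _ Lf) (L2_partial N f)) _.
rewrite mulrDl lerD//; first exact: n2_bounded_op.
apply: le_trans (n2_partial N f) _; rewrite mulr_suml; apply: ler_sum => n _.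
by rewrite mulrAC ler_wpM2r ?n2_ge0// mulrC; exact: inner_CS.
Qed.

Definition tail_bound N : R := fine (opnorm (remainder N)).

Lemma tail_bound_ge0 N : 0 <= tail_bound N.
Proof. exact/fine_ge0/opnorm_ge0/bounded_remainder. Qed.

Lemma cvg_tail_bound : tail_bound @ \oo --> (0 : R).
Proof. by have /fine_cvgP[] := cvgT. Qed.

(** N terms of the series are kept and the rest is charged to [tail_bound N]. The outer shift is
    isometric; the inner adjoint shift moves onto [psi n] inside the coefficients and contracts h in
    the remainder. *)
Lemma n2_alpha_le k h N : L2 h -> n2 (alpha k T h) <=
  \sum_(0 <= n < N) normc (inner h (tfshift k (psi n))) * n2 (phi n) + tail_bound N * n2 h.
Proof.
move=> Lh; have [bA _] := is_adjoint_adjoint_tfshift (R := R) (d := d) k.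
have LA := bounded_op_L2 bA Lh; have [LT _ _] := bT.
rewrite n2_tfshift; last exact: LT.
apply: le_trans (n2_dist (LT _ LA) (L2_partial N (adjoint (tfshift k) h))) _; apply: lerD.
  apply: le_trans (n2_partial _ _) _; apply: ler_sum => n _.
  by rewrite inner_adjoint_tfshift.
apply: le_trans (n2_bounded_op (bounded_remainder N) LA) _.
apply: ler_wpM2l; first exact/fine_ge0/opnorm_ge0/bounded_remainder.
exact: n2_adjoint_tfshift_le.
Qed.

(** Passage to the limit in N. As [c] may be the norm of any fixed vector, this replaces the
    summation of infinite series of vectors. *)
Lemma le_of_tail_bound (x K c : R) : (forall N, x <= K + tail_bound N * c) -> x <= K.
Proof.
move=> h; rewrite -[leRHS]addr0 -(mul0r c).
have cv : (fun N => K + tail_bound N * c) @ \oo --> K + 0 * c.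
  by apply: cvgD; [exact: cvg_cst|apply: cvgMl; exact: cvg_tail_bound].
by rewrite -(cvg_lim _ cv)//; apply: limr_ge; [apply/cvg_ex; eexists; exact: cv|exact: nearW].
Qed.

Local Notation C := (nuC s).
Let C0 : 0 <= C. Proof. exact: expR_ge0. Qed.

(** One factor C comes from [inner_nu_le], applied to the coefficients, and one from [n2_le_m1],
    applied to [phi m]. All the decay in k - l arises here. *)
Let n2_alpha_tfshift_le k l n :
  n2 (alpha l T (tfshift k (psi n))) <= C ^+ 2 * m1 s (psi n) * series_total / nu s (subp k l).
Proof.
have nu0 := nu_gt0 s0 (subp k l).
apply: (le_of_tail_bound (c := n2 (tfshift k (psi n)))) => N.
apply: le_trans (n2_alpha_le l N (L2_tfshift k (Lpsi n))) _; rewrite lerD2r.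
apply: (@le_trans _ _ (C ^+ 2 * m1 s (psi n) / nu s (subp k l) *
    \sum_(0 <= m < N) m1 s (phi m) * m1 s (psi m))); last first.
  rewrite [leRHS]mulrAC ler_wpM2l ?le_series_total//.
  by rewrite divr_ge0 ?(ltW nu0)// mulr_ge0 ?m1_ge0// sqr_ge0.
rewrite mulr_sumr; apply: ler_sum => m _.
have h1 : normc (inner (tfshift k (psi n)) (tfshift l (psi m))) <=
    C * m1 s (psi m) * m1 s (psi n) / nu s (subp k l).
  rewrite ler_pdivlMr// (inner_conj (L2_tfshift l (Lpsi m)) (L2_tfshift k (Lpsi n))) normc_conj.
  by rewrite normc_inner_tfshift//; exact: inner_nu_le.
have h2 := n2_le_m1 s0 (Mphi m).
apply: le_trans (ler_pM (normc_ge0 _) (n2_ge0 _) h1 h2) _.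
rewrite le_eqVlt; apply/orP; left; apply/eqP.
by move: (m1 _ _) (m1 _ _) (m1 _ _) (nu _ _) C => a b c e c0; ring.
Qed.

(** The adjoint is moved to the other side of each coefficient, where [n2_alpha_tfshift_le] applies.
    The norms of [phi m] supply the third factor C, and the second summation supplies the second
    factor [series_total]. *)
Lemma n2_alpha_adjoint_le k l f : L2 f ->
  n2 (alpha k T (adjoint (alpha l T) f)) <=
  C ^+ 3 * series_total ^+ 2 / nu s (subp k l) * n2 f.
Proof.
move=> Lf; have nu0 := nu_gt0 s0 (subp k l).
have LA := bounded_op_L2 (bounded_op_adjoint (alpha l T)) Lf.
apply: (le_of_tail_bound (c := n2 (adjoint (alpha l T) f))) => N.
apply: le_trans (n2_alpha_le k N LA) _; rewrite lerD2r.
apply: (@le_trans _ _ (C ^+ 3 * series_total / nu s (subp k l) * n2 f *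
    \sum_(0 <= m < N) m1 s (phi m) * m1 s (psi m))); last first.
  rewrite expr2 [leRHS](_ : _ = C ^+ 3 * series_total / nu s (subp k l) * n2 f * series_total).
    apply: ler_wpM2l; last exact: le_series_total.
    rewrite !mulr_ge0 ?invr_ge0 ?n2_ge0 ?series_total_ge0 ?(ltW nu0)// exprn_ge0//.
  by move: (n2 _) (nu _ _) C series_total => a b c e; ring.
rewrite mulr_sumr; apply: ler_sum => m _.
have h1 : normc (inner (adjoint (alpha l T) f) (tfshift k (psi m))) <=
    n2 f * (C ^+ 2 * m1 s (psi m) * series_total / nu s (subp k l)).
  apply: le_trans (normc_inner_adjoint_le _ Lf (L2_tfshift k (Lpsi m))) _.
    exact: bounded_op_alpha.
  by apply: ler_wpM2l; [exact: n2_ge0|exact: n2_alpha_tfshift_le].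
have h2 := n2_le_m1 s0 (Mphi m).
apply: le_trans (ler_pM (normc_ge0 _) (n2_ge0 _) h1 h2) _.
rewrite le_eqVlt; apply/orP; left; apply/eqP.
by move: (n2 _) (m1 _ _) (m1 _ _) (nu _ _) C series_total => a b c e c0 f0; ring.
Qed.

End trace_class_series.
(** * Lattice-point counting and the Bessel bound *)

Section p_series.
Context {R : realType}.
Variable p : R.
Hypothesis p1 : 1 < p.

Let q : R := 2 `^ (1 - p).

Let q1 : q < 1.
Proof.
by rewrite /q /powR pnatr_eq0 /= expR_lt1 pmulr_llt0 ?ln_gt0 ?ltr1n// subr_lt0.
Qed.

(* Cauchy condensation: the block 2^n <= m + 1 < 2^(n+1) contributes at most q^n. *)
Let sum_dyadic n : \sum_(0 <= m < 2 ^ n - 1) (m.+1%:R `^ p)^-1 <= \sum_(0 <= j < n) q ^+ j.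
Proof.
elim: n => [|n IH]; first by rewrite expn0 subnn !big_geq.
have le1 : (2 ^ n - 1 <= 2 ^ n.+1 - 1)%N by rewrite leq_sub2r// leq_exp2l.
rewrite (big_cat_nat (leq0n _) le1)/= big_nat_recr//=; apply: lerD => //.
apply: (@le_trans _ _ (\sum_(2 ^ n - 1 <= m < 2 ^ n.+1 - 1) ((2 ^ n)%:R `^ p)^-1)).
  apply: ler_sum_nat => m /andP[m1 _].
  have nm : (2 ^ n <= m.+1)%N by move: m1; rewrite leq_subLR add1n.
  rewrite lef_pV2 ?posrE ?powR_gt0 ?ltr0n ?expn_gt0//.
  by rewrite ge0_ler_powR ?nnegrE ?ler_nat// ltW// (lt_trans ltr01).
rewrite big_const_nat iter_addr addr0.
have -> : (2 ^ n.+1 - 1 - (2 ^ n - 1) = 2 ^ n)%N.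
  by rewrite expnS mul2n -addnn subnBA ?expn_gt0// subnK ?addn_gt0 ?expn_gt0// addnK.
rewrite -[leLHS]mulr_natr mulrC.
have -> : q ^+ n = (2 ^ n)%:R `^ (1 - p).
  by rewrite /q -powR_mulrn ?powR_ge0// natrX -(powR_mulrn n (ler0n R 2)) -!powRrM mulrC.
rewrite powRD; last by apply/implyP => _; rewrite pnatr_eq0 -lt0n expn_gt0.
by rewrite powRr1 ?ler0n// powRN.
Qed.

Lemma p_series_bounded : exists2 C : R, 0 <= C &
  forall n, \sum_(0 <= m < n) (m.+1%:R `^ p)^-1 <= C.
Proof.
have q0 : 0 <= q by exact: powR_ge0.
exists (1 - q)^-1; first by rewrite invr_ge0 subr_ge0 ltW.
move=> n.
(* The first n terms thus lie within the first n dyadic blocks, whose sums are dominated by a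
   geometric series. *)
have n2 : (n <= 2 ^ n - 1)%N by rewrite -ltnS subn1 prednK ?expn_gt0// ltn_expl.
apply: (@le_trans _ _ (\sum_(0 <= m < 2 ^ n - 1) (m.+1%:R `^ p)^-1)).
  rewrite [leRHS](big_cat_nat (leq0n _) n2)/= lerDl.
  by apply: sumr_ge0 => i _; rewrite invr_ge0 powR_ge0.
apply: le_trans (sum_dyadic n) _.
have := subrX1 q n; rewrite big_mkord => e.
rewrite -[leRHS]mul1r ler_pdivlMr ?subr_gt0// mulrC -[leLHS]opprK -mulNr opprB -e.
by rewrite opprB gerBl exprn_ge0.
Qed.

End p_series.

(** * Inverse weights summed over a relatively separated set *)

Section counting.
Context {R : realType} {d : nat}.
Implicit Types (z w k l : phase R d).
Variables (X : set (phase R d)) (s : R).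
Hypotheses (sepX : relatively_separated X) (sd : (2 * d)%:R < s).

Local Notation I := ('I_d + 'I_d)%type.

Let s_gt0 : 0 < s. Proof. by rewrite (le_lt_trans _ sd)// ler0n. Qed.

(** The condition s > 2d leaves each of the 2d coordinates an exponent p = s / (2d) greater than 1,
    hence a convergent p-series. For d = 0 there are no coordinates, and 2 is an arbitrary
    choice. *)
Let exponent : exists2 p : R, 1 < p & p * #|{: I}|%:R <= s.
Proof.
have cI : #|{: I}| = (2 * d)%N by rewrite card_sum !card_ord mul2n addnn.
have [d0|d0] := posnP d.
  exists 2; first by rewrite ltr1n.
  by rewrite cI d0 muln0 mulr0 ltW.
exists (s / (2 * d)%:R); last by rewrite cI divfK// pnatr_eq0 muln_eq0/= -lt0n.
by rewrite ltr_pdivlMr ?mul1r// ltr0n muln_gt0.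
Qed.

(* The cell of l relative to k: the sign and the integer part of each coordinate of l - k. *)
Let cell k l (i : I) : bool * nat :=
  (0 <= coord (subp l k) i, Num.truncn `|coord (subp l k) i|).

(** Each coordinate of l - k is at most its norm, so the power p times 2d of 1 + |k - l| can be
    shared out, one factor to the power p for each coordinate. *)
Let invnu_le p k l : 1 < p -> p * #|{: I}|%:R <= s ->
  (nu s (subp k l))^-1 <= \prod_(i : I) ((cell k l i).2.+1%:R `^ p)^-1.
Proof.
move=> p1 pI; have p0 : 0 <= p by rewrite ltW// (lt_trans ltr01).
have b1 : 1 <= 1 + normp (subp k l) by rewrite lerDl normp_ge0.
rewrite prodfV lef_pV2 ?posrE ?nu_gt0 ?(ltW s_gt0)//; last first.
  by apply: prodr_gt0 => i _; rewrite powR_gt0.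
apply: (@le_trans _ _ ((1 + normp (subp k l)) `^ (p * #|{: I}|%:R))); last by rewrite /nu ler_powR.
rewrite powRrM powR_mulrn ?powR_ge0// -prodr_const.
apply: ler_prod => i _; rewrite powR_ge0 /=.
apply: ge0_ler_powR => //; rewrite ?nnegrE//; first by rewrite (le_trans ler01).
rewrite -natr1 addrC lerD2l normp_subpC; apply: le_trans (coord_le_normp _ i).
by have /andP[] := truncn_itv (normr_ge0 (coord (subp l k) i)).
Qed.

Let cell_count N k (c : I -> bool * nat) (r : seq (phase R d)) :
  (forall z, (X `&` unit_cube z #<= `I_N)%card) ->
  uniq r -> (forall l, l \in r -> X l) ->
  (\sum_(l <- r | [forall i, cell k l i == c i]) 1 <= N)%N.
Proof.
move=> XN ur rX.
(* With integer part m, a nonnegative coordinate lies in [m, m + 1[ and a negative one in ]-(m + 1),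
   -m]. The lower ends of these intervals place the whole cell in one unit cube. *)
pose corner (i : I) : R := if (c i).1 then (c i).2%:R else - (c i).2.+1%:R.
pose z : phase R d := ([tuple tnth k.1 i + corner (inl i) | i < d],
                       [tuple tnth k.2 i + corner (inr i) | i < d]).
have coordz i : coord z i = coord k i + corner i by case: i => j; rewrite /= tnth_mktuple.
pose r' := [seq l <- r | [forall i, cell k l i == c i]].
have sub l : l \in r' -> (X `&` unit_cube z) l.
  rewrite mem_filter => /andP[/forallP cl /rX Xl]; split=> //.
  have h i : 0 <= coord (subp l z) i <= 1.
    have /eqP := cl i; rewrite coord_subp coordz /corner => <- /=.
    have := truncn_itv (normr_ge0 (coord (subp l k) i)); rewrite coord_subp.
    case: (lerP 0 (coord l i - coord k i)) => w0.
      by rewrite ger0_norm// -natr1 => /andP[t1 t2]; apply/andP; split; lra.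
    by rewrite ltr0_norm// -natr1 => /andP[t1 t2]; apply/andP; split; lra.
  by move=> i; split; [exact: (h (inl i))|exact: (h (inr i))].
have fin : finite_set (X `&` unit_cube z).
  exact: card_le_finite (XN z) (finite_II N).
rewrite -big_filter sum1_size -/r'; apply: leq_trans (geq_card_fset_set (XN z)).
apply: uniq_leq_size; first exact: filter_uniq.
by move=> l lr; rewrite in_fset_set// inE; exact: sub.
Qed.

Lemma sum_invnu_bounded : exists2 C : R, 0 <= C &
  forall (r : seq (phase R d)) k, uniq r -> (forall l, l \in r -> X l) ->
    \sum_(l <- r) (nu s (subp k l))^-1 <= C.
Proof.
have [N XN] := sepX; have [p p1 pI] := exponent.
have [C0 C00 C0P] := p_series_bounded p1.
exists (N%:R * (C0 + C0) ^+ #|{: I}|); first by rewrite mulr_ge0// exprn_ge0// addr_ge0.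
move=> r k ur rX.
(* Largest integer part met in [r]. It makes the cells that occur elements of the finite type
   [{ffun I -> J}]; the final bound does not depend on it. *)
pose M := (\max_(l <- r) \max_(i : I) (cell k l i).2)%N.
have lM l i : l \in r -> ((cell k l i).2 < M.+1)%N.
  move=> lr; rewrite ltnS /M (big_rem l)//=; apply: leq_trans (leq_maxl _ _).
  by rewrite (bigD1 i)//= leq_maxl.
pose J := (bool * 'I_M.+1)%type.
pose wt (j : J) : R := (j.2.+1%:R `^ p)^-1.
have wt0 j : 0 <= wt j by rewrite invr_ge0 powR_ge0.
pose cl l : {ffun I -> J} := [ffun i => ((cell k l i).1, inord (cell k l i).2)].
apply: (@le_trans _ _ (\sum_(l <- r) \prod_i wt (cl l i))).
  rewrite big_seq [leRHS]big_seq; apply: ler_sum => l lr.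
  apply: le_trans (invnu_le k l p1 pI) _.
  by rewrite le_eqVlt; apply/orP; left; apply/eqP; apply: eq_bigr => i _; rewrite /wt ffunE /= inordK// lM.
(* Grouped by cell: the summand depends on the cell alone, and a cell holds at most N points of
   [r]. *)
rewrite (partition_big cl predT)//=.
apply: (@le_trans _ _ (\sum_(c : {ffun I -> J}) N%:R * \prod_i wt (c i))).
  apply: ler_sum => c _.
  rewrite (eq_bigr (fun l => 1%N%:R * \prod_i wt (c i))); last first.
    by move=> l /eqP <-; rewrite mul1r.
  rewrite -mulr_suml ler_wpM2r//; first by apply: prodr_ge0 => i _.
  rewrite -natr_sum ler_nat.
  apply: leq_trans (@cell_count N k (fun i => ((c i).1, val (c i).2)) r XN ur rX).
  rewrite big_seq_cond [leqRHS]big_seq_cond.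
  rewrite leq_eqVlt; apply/orP; left; apply/eqP; apply: eq_bigl => l.
  case lr : (l \in r) => //=; apply/eqP/forallP => [<- i|h].
    by rewrite ffunE /= inordK ?lM//; case: (cell k l i).
  apply/ffunP => i; rewrite ffunE; have /eqP -> := h i; rewrite /= inord_val.
  by case: (c i).
(* By distributivity the sum over cells is a product over coordinates. Each factor sums over two
   signs and over integer parts, so it is at most C0 + C0. *)
rewrite -mulr_sumr ler_wpM2l// -(bigA_distr_bigA (fun (i : I) (j : J) => wt j)) /=.
rewrite prodr_const lerXn2r ?nnegrE ?addr_ge0//; first exact: sumr_ge0.
rewrite -(pair_big xpredT xpredT (fun (b : bool) (m : 'I_M.+1) => (m.+1%:R `^ p)^-1)) /=.
by rewrite big_bool lerD// -(big_mkord xpredT (fun m => (m.+1%:R `^ p)^-1)).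
Qed.

End counting.
Lemma sqrt_sumr_sqrD (R : realType) (K : Type) (r : seq K) (a b : K -> R) :
  Num.sqrt (\sum_(k <- r) (a k + b k) ^+ 2) <=
  Num.sqrt (\sum_(k <- r) a k ^+ 2) + Num.sqrt (\sum_(k <- r) b k ^+ 2).
Proof.
rewrite (big_tnth _ _ _ _ (fun k => (a k + b k) ^+ 2)) (big_tnth _ _ _ _ (fun k => a k ^+ 2)).
rewrite (big_tnth _ _ _ _ (fun k => b k ^+ 2)).
exact: (sqrt_sum_sqrD (fun i => a (tnth (in_tuple r) i)) (fun i => b (tnth (in_tuple r) i))).
Qed.

Lemma sqrt_sumr_sqr_sum (R : realType) (K : Type) (r : seq K) (u : nat -> K -> R) N :
  Num.sqrt (\sum_(k <- r) (\sum_(0 <= n < N) u n k) ^+ 2) <=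
  \sum_(0 <= n < N) Num.sqrt (\sum_(k <- r) u n k ^+ 2).
Proof.
elim: N => [|N IH].
  rewrite [leRHS]big_geq// big1 ?sqrtr0// => k _.
  by rewrite big_geq// expr0n.
rewrite [leRHS]big_nat_recr//=; under eq_bigr do rewrite big_nat_recr//=.
by apply: le_trans (sqrt_sumr_sqrD _ _ _) _; rewrite lerD2r.
Qed.

(** * Schur's test and the Bessel bound on finite lists *)

Section bessel.
Context {R : realType} {d : nat}.
Local Notation op := (cfun R d -> cfun R d).
Implicit Types (f g h : cfun R d) (k l : phase R d).
Variables (s : R) (r : seq (phase R d)) (C : R).
Hypotheses (s0 : 0 <= s) (rC : forall k, \sum_(l <- r) (nu s (subp k l))^-1 <= C).

Let C0 : 0 <= C.
Proof.
pose o : phase R d := ([tuple 0 | i < d], [tuple 0 | i < d]).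
apply: le_trans (rC o); apply: sumr_ge0 => l _.
by rewrite invr_ge0 ltW// nu_gt0.
Qed.

(** From 2 c_k c_l <= c_k^2 + c_l^2; the two resulting double sums agree because nu_s(k - l) is
    symmetric, and each row sums to at most C. *)
Let schur (c : phase R d -> R) :
  \sum_(k <- r) \sum_(l <- r) c k * c l / nu s (subp k l) <= C * \sum_(k <- r) c k ^+ 2.
Proof.
pose A := \sum_(k <- r) \sum_(l <- r) c k ^+ 2 / nu s (subp k l).
have AC : A <= C * \sum_(k <- r) c k ^+ 2.
  rewrite mulr_sumr; apply: ler_sum => k _.
  by rewrite -mulr_sumr mulrC ler_wpM2r ?sqr_ge0.
have A2 : A = \sum_(k <- r) \sum_(l <- r) c l ^+ 2 / nu s (subp k l).
  rewrite /A exchange_big; apply: eq_bigr => k _; apply: eq_bigr => l _.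
  by rewrite nu_subpC.
have AE : 2 * A = \sum_(k <- r) \sum_(l <- r) (c k ^+ 2 / nu s (subp k l) + c l ^+ 2 / nu s (subp k l)).
  rewrite mulr_natl mulr2n {2}A2 -big_split; apply: eq_bigr => k _ /=.
  by rewrite -big_split.
apply: le_trans AC; rewrite -(@ler_pM2l _ 2)// AE.
rewrite mulr_sumr; apply: ler_sum => k _; rewrite mulr_sumr; apply: ler_sum => l _ /=.
rewrite -mulrDl mulrA ler_wpM2r ?invr_ge0 ?(ltW (nu_gt0 s0 _))//.
have := sqr_ge0 (c k - c l); nra.
Qed.

(* With c_k = <f, pi(k) g>, sum |c_k|^2 = <f, sum c_k pi(k) g>, and Schur's test bounds the
   norm of sum c_k pi(k) g. *)
Lemma tfshift_bessel g f : M1 s g -> L2 f ->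
  \sum_(k <- r) normc (inner f (tfshift k g)) ^+ 2 <= nuC s * C * (m1 s g * n2 f) ^+ 2.
Proof.
move=> Mg Lf; have [Lg _] := Mg.
pose c k := inner f (tfshift k g); pose a k := normc (c k).
pose G t := \sum_(k <- r) c k * tfshift k g t.
have Lk k : L2 (fun t => c k * tfshift k g t) by exact/L2Z/L2_tfshift.
have LG : L2 G by exact: L2_sum.
rewrite -/(\sum_(k <- r) a k ^+ 2); set S := \sum_(k <- r) a k ^+ 2.
have S0 : 0 <= S by apply: sumr_ge0 => k _; exact: sqr_ge0.
have SG : S <= n2 f * n2 G.
  apply: le_trans (inner_CS Lf LG).
  rewrite [inner f G]inner_sumr//.
  rewrite (eq_bigr (fun k => (a k ^+ 2)%:C%C)) => [|k _]; last first.
    by rewrite innerZr//; [rewrite mulrC mulc_conj|exact: L2_tfshift].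
  have -> : \sum_(k <- r) (a k ^+ 2)%:C%C = S%:C%C :> R[i].
    by rewrite /S; elim/big_rec2: _ => // k x y _ ->; apply: complex_ext => //=; rewrite addr0.
  by rewrite normc_real ler_norm.
pose M := nuC s * m1 s g * m1 s g.
have M0 : 0 <= M by rewrite !mulr_ge0 ?m1_ge0 ?expR_ge0.
have G2 : n2 G ^+ 2 <= M * (C * S).
  have -> : n2 G ^+ 2 = normc (inner G G) by rewrite inner_self normc_real ger0_norm ?sqr_ge0.
  rewrite [inner G G]inner_suml//; apply: le_trans (normc_sum _ _ _) _.
  apply: (@le_trans _ _ (M * \sum_(k <- r) \sum_(l <- r) a k * a l / nu s (subp k l))); last first.
    by rewrite ler_wpM2l// schur.
  rewrite mulr_sumr; apply: ler_sum => k _.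
  rewrite [inner _ G]inner_sumr//; apply: le_trans (normc_sum _ _ _) _.
  rewrite mulr_sumr; apply: ler_sum => l _.
  rewrite innerZl ?innerZr//; try exact: L2_tfshift.
  rewrite mulrA normcM (normcM (c k)) normc_conj -/(a k) -/(a l).
  rewrite [leRHS]mulrCA ler_wpM2l ?mulr_ge0 ?normc_ge0//.
  rewrite ler_pdivlMr ?nu_gt0// nu_subpC (normc_inner_tfshift l k Lg Lg).
  exact: inner_nu_le.
(* S occurs on both sides because the norm of G is itself bounded through S; one factor S cancels,
   the case S = 0 being immediate. *)
have S2 : S ^+ 2 <= n2 f ^+ 2 * (M * (C * S)).
  apply: le_trans (_ : (n2 f * n2 G) ^+ 2 <= _).
    by rewrite lerXn2r ?nnegrE// mulr_ge0// n2_ge0.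
  by rewrite exprMn ler_wpM2l ?sqr_ge0.
have -> : nuC s * C * (m1 s g * n2 f) ^+ 2 = n2 f ^+ 2 * (M * C).
  by rewrite /M; move: (nuC s) (m1 s g) (n2 f) => x y z; ring.
have [->|Sn0] := eqVneq S 0.
  by apply: mulr_ge0; [exact: sqr_ge0|exact: mulr_ge0].
have Sp : 0 < S by rewrite lt_neqAle eq_sym Sn0.
have e2 : n2 f ^+ 2 * (M * C) * S = n2 f ^+ 2 * (M * (C * S)) by rewrite -[LHS]mulrA -[M * C * S]mulrA.
by rewrite -(ler_pM2r Sp) -[leLHS]expr2 e2.
Qed.

Variables (T : op) (phi psi : nat -> cfun R d).
Hypothesis bT : bounded_op T.
Hypotheses (Mphi : forall n, M1 s (phi n)) (Mpsi : forall n, M1 s (psi n)).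
Hypothesis summable : (\sum_(0 <= n <oo) (M1norm s (phi n) * M1norm s (psi n)) < +oo)%E.
Hypothesis cvgT : (fun N => opnorm (fun h t =>
  T h t - \sum_(0 <= n < N) rank1 (phi n) (psi n) h t)) @ \oo --> 0%E.

Lemma alpha_bessel f : L2 f -> \sum_(k <- r) n2 (alpha k T f) ^+ 2 <=
  (nuC s * Num.sqrt (nuC s * C) * series_total s phi psi * n2 f) ^+ 2.
Proof.
move=> Lf; set K := nuC s * _ * _ * _.
have nuC0 : 0 <= nuC s by exact: expR_ge0.
have K0 : 0 <= K by rewrite !mulr_ge0 ?sqrtr_ge0 ?n2_ge0 ?series_total_ge0.
have S0 : 0 <= \sum_(k <- r) n2 (alpha k T f) ^+ 2 by apply: sumr_ge0 => k _; exact: sqr_ge0.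
rewrite -[leLHS]sqr_sqrtr// lerXn2r ?nnegrE ?sqrtr_ge0//.
(* The remainder is paid once for each index of [r], so its l^2 norm carries the square root of the
   length. As [r] is finite this still vanishes with N, and the resulting bound does not see the
   length. *)
apply: (le_of_tail_bound cvgT (c := n2 f * Num.sqrt (\sum_(k <- r) 1))) => N.
pose b k := \sum_(0 <= n < N) normc (inner f (tfshift k (psi n))) * n2 (phi n).
pose e := tail_bound T phi psi N * n2 f.
have e0 : 0 <= e.
  by apply: mulr_ge0; [exact: (tail_bound_ge0 bT Mphi Mpsi)|exact: n2_ge0].
apply: (@le_trans _ _ (Num.sqrt (\sum_(k <- r) (b k + e) ^+ 2))).
  rewrite ler_wsqrtr//; apply: ler_sum => k _.
  have ab : n2 (alpha k T f) <= b k + e by exact: (n2_alpha_le bT Mphi Mpsi k N Lf).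
  have a0 : 0 <= n2 (alpha k T f) by exact: n2_ge0.
  by apply: lerXn2r => //; rewrite nnegrE// (le_trans a0 ab).
apply: le_trans (sqrt_sumr_sqrD _ _ _) _; apply: lerD; last first.
  rewrite mulrA -/e (eq_bigr (fun _ => e ^+ 2 * 1)) => [|k _]; last by rewrite mulr1.
  by rewrite -mulr_sumr sqrtrM ?sqr_ge0// sqrtr_sqr ger0_norm.
apply: le_trans (sqrt_sumr_sqr_sum _ _ _) _.
apply: (@le_trans _ _ (nuC s * Num.sqrt (nuC s * C) * n2 f *
   \sum_(0 <= n < N) m1 s (phi n) * m1 s (psi n))); last first.
  rewrite /K [leRHS]mulrAC; apply: ler_wpM2l.
    by rewrite !mulr_ge0 ?sqrtr_ge0 ?n2_ge0.
  exact: le_series_total.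
rewrite mulr_sumr; apply: ler_sum => n _.
under eq_bigr do rewrite exprMn.
rewrite -mulr_suml mulrC sqrtrM ?sqr_ge0// sqrtr_sqr ger0_norm ?n2_ge0//.
have h1 := n2_le_m1 s0 (Mphi n).
have h2 : Num.sqrt (\sum_(k <- r) normc (inner f (tfshift k (psi n))) ^+ 2) <=
    Num.sqrt (nuC s * C) * (m1 s (psi n) * n2 f).
  rewrite -[X in _ * X]ger0_norm ?mulr_ge0 ?m1_ge0 ?n2_ge0// -sqrtr_sqr -sqrtrM ?mulr_ge0//.
  by rewrite ler_wsqrtr// tfshift_bessel.
apply: le_trans (ler_pM (n2_ge0 _) (sqrtr_ge0 _) h1 h2) _.
rewrite le_eqVlt; apply/orP; left; apply/eqP.
by move: (nuC s) (Num.sqrt _) (m1 _ _) (m1 _ _) (n2 _) => x1 x2 x3 x4 x5; ring.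
Qed.

End bessel.

Theorem theorem4p3 (R : realType) (d : nat) (X : set (phase R d)) (s : R)
    (T : cfun R d -> cfun R d) :
  relatively_separated X ->
  (2 * d)%:R < s ->
  Bnu s T ->
  intrinsically_localized X s (g_gabor T) /\ g_Bessel X (g_gabor T).
Proof.
move=> sepX sd [bT [phi [psi [Mphi Mpsi summable cvgT]]]].
have s0 : 0 <= s by rewrite ltW// (le_lt_trans _ sd)// ler0n.
have balpha k : bounded_op (alpha k T) by exact: bounded_op_alpha.
split; split=> [k Xk|]; try exact: balpha.
  split=> [k l Xk Xl|].
    by apply: bounded_op_comp; [exact: balpha|exact: bounded_op_adjoint].
  pose K := nuC s ^+ 3 * series_total s phi psi ^+ 2.
  have K0 : 0 <= K.
    by rewrite mulr_ge0 ?sqr_ge0// exprn_ge0// expR_ge0.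
  apply: (@le_lt_trans _ _ K%:E); last exact: ltry.
  apply: ge_ereal_sup => _ [k Xk [l Xl <-]].
  have nu0 := nu_gt0 s0 (subp k l).
  apply: (@le_trans _ _ ((K / nu s (subp k l))%:E * (nu s (subp k l))%:E)%E); last first.
    by rewrite -EFinM divfK ?gt_eqF.
  apply: lee_wpmul2r; first by rewrite lee_fin ltW.
  apply: opnorm_le.
  - move=> f Lf; apply: bounded_op_L2; first exact: balpha.
    by apply: bounded_op_L2; [exact: bounded_op_adjoint|].
  - by rewrite divr_ge0// ltW.
  - by move=> f Lf; exact: (n2_alpha_adjoint_le s0 bT Mphi Mpsi summable cvgT).
have [C C0 rC] := sum_invnu_bounded sepX sd.
pose K := nuC s * Num.sqrt (nuC s * C) * series_total s phi psi.
(* The added 1 keeps the bound positive even when K is 0. *)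
exists (K ^+ 2 + 1); first by rewrite ltr_pwDr// sqr_ge0.
(* The sum over X is the supremum of the sums over finite subsets A. Listed without repetition, A
   falls under the finite estimate, and K is the same for all A. *)
move=> f Lf; apply: ge_ereal_sup => _ [A [finA AX] <-].
rewrite fsbig_finite//.
have rA k : \sum_(l <- finmap.enum_fset (fset_set A)) (nu s (subp k l))^-1 <= C.
  apply: rC => [|l]; first exact: finmap.fset_uniq.
  by rewrite in_fset_set// inE => /AX.
rewrite (eq_bigr (fun k => (n2 (alpha k T f) ^+ 2)%:E)); last first.
  by move=> k _; rewrite L2norm_n2 ?EFin_expe//; apply: bounded_op_L2 => //; exact: balpha.
rewrite sumEFin L2norm_n2// -EFin_expe -EFinM lee_fin.
apply: le_trans (alpha_bessel s0 rA bT Mphi Mpsi summable cvgT Lf) _.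
by rewrite -/K exprMn ler_wpM2r ?sqr_ge0// lerDl.
Qed.
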